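(* Let $F_\varepsilon$, $0\le\varepsilon\le\varepsilon_0$, be a family of real-analytic exact symplectic maps of the form $$\bar I=I+\varepsilon a(I,\varphi),\qquad \bar\varphi=\varphi+\omega(I)+\varepsilon b(I,\varphi)\pmod 1,$$ satisfying the standing assumptions listed in the context (analyticity on $\mathcal D_F$, uniform boundedness of $a,b$), with $\omega=h_0'$ where $h_0$ is strongly convex on a real neighbourhood of $B_R$. Then there are constants $\gamma_0>0$ and $r_0\in(0,1)$ with the following property. For every $\gamma\ge\gamma_0$ there are positive constants $\varepsilon_1\le\varepsilon_0$, $c_2$, $c_3$ such that if $0<\varepsilon\le\varepsilon_1$, $n\in\mathbb N$ satisfies $n<\varepsilon^{-d/(2(d+1))}$, and $I_*\in B_R$ satisfies $n\,\omega(I_* )\in\mathbb Z^d$, then every trajectory $(I_k,\varphi_k)=F_\varepsilon^k(I_0,\varphi_0)$ with real initial conditions satisfying $|I_0-I_*|<r_0\rho_n$ and $\varphi_0\in\mathbb T^d$ satisfies $$|I_k-I_*|<\rho_n\qquad\text{for all integers } 0\le k\le T_\varepsilon=c_2\exp\left(c_3\,\varepsilon^{-1/(2(d+1))}\right),$$ where $\rho_n=\gamma\,n^{-1}\varepsilon^{1/(2(d+1))}$.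
   Context: Let $d\ge1$, $\mathbb T^d=\mathbb R^d/\mathbb Z^d$. The notation $|\cdot|$ is the maximum norm on $\mathbb R^d$ or $\mathbb C^d$. $B_R\subset\mathbb R^d$ is a ball of radius $R>0$. Standing assumptions. There are $\varepsilon_0,\sigma,r>0$ (with $\sigma,r$ independent of $\varepsilon$) such that for every $0\le\varepsilon\le\varepsilon_0$ the map $F_\varepsilon:(I,\varphi)\mapsto(\bar I,\bar\varphi)$ is real-analytic, the functions $a,b$ (which may depend on $\varepsilon$; the dependence is hidden in the notation) are $\mathbb Z^d$-periodic in $\varphi$, and the lift of $F_\varepsilon$ (i.e. the functions $\omega,a,b$) has an analytic continuation onto the complex neighbourhood $$\mathcal D_F=\{(I,\varphi)\in\mathbb C^{2d}:\ \mathrm{dist}(I,B_R)\le\sigma,\ |\operatorname{Im}\varphi|\le r\}$$ of $B_R\times\mathbb R^d$. The supremum norms of $a$ and $b$ on $\mathcal D_F$ are bounded uniformly in $\varepsilon\in[0,\varepsilon_0]$. The function $\omega$ does not depend on $\varepsilon$. Exact symplectic means that $F_\varepsilon$ preserves the symplectic form $\sum_l dI_l\wedge d\varphi_l$ and preserves the loop action $\oint_\gamma\sum_l I_l\,d\varphi_l$ for all loops $\gamma$ in its domain. The frequency map is a gradient, $\omega=h_0'$, and strong convexity of $h_0$ means: there is $\nu>0$ such that $(\omega'(I)v)\cdot v\ge\nu\,v\cdot v$ for all $v\in\mathbb R^d$ and all real $I$ in the domain, i.e. all $I\in\mathbb R^d$ with $\mathrm{dist}(I,B_R)\le\sigma$.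 The constants $\varepsilon_1,c_2,c_3$ may depend on $\gamma$ and on the family but not on $\varepsilon$, $n$, $I_*$ or the initial condition. *)

(* Defs.v *)
From mathcomp Require Import all_boot all_order all_algebra.
From mathcomp Require Import all_classical all_reals all_analysis.
From mathcomp Require Export complex.

Set Implicit Arguments.
Unset Strict Implicit.
Unset Printing Implicit Defensive.

Import Order.TTheory GRing.Theory Num.Theory.
Import numFieldNormedType.Exports.

Local Open Scope classical_set_scope.
Local Open Scope ring_scope.
Local Open Scope complex_scope.

(* The library norm on row vectors and on pairs is the maximum norm; over R[i]
   it takes its values in R[i], whence the real part. *)
Definition cnorm (R : realType) (V : normedModType R[i]) (z : V) : R :=
  complex.Re `|z|.

Definition cvec (R : realType) (d : nat) (x : 'rV[R]_d) : 'rV[R[i]]_d :=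
  map_mx (fun t : R => t%:C) x.

Definition imvec (R : realType) (d : nat) (z : 'rV[R[i]]_d) : 'rV[R]_d :=
  map_mx (fun t : R[i] => complex.Im t) z.

Definition cpair (R : realType) (d : nat) (x : 'rV[R]_d * 'rV[R]_d) :
    'rV[R[i]]_d * 'rV[R[i]]_d :=
  (cvec x.1, cvec x.2).

Definition dot (R : realType) (d : nat) (u v : 'rV[R]_d) : R :=
  \sum_(l < d) u 0 l * v 0 l.

Definition Zvec (R : realType) (d : nat) : set 'rV[R]_d :=
  range (fun m : 'rV[int]_d => map_mx (fun z : int => z%:~R) m).

Definition Bball (R : realType) (d : nat) (center : 'rV[R]_d) (radius : R) :
    set 'rV[R]_d :=
  [set I | `|center - I| <= radius].

Definition cdist (R : realType) (d : nat) (z : 'rV[R[i]]_d)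
    (B : set 'rV[R]_d) : R :=
  inf [set cnorm (z - cvec x) | x in B].

Definition action_domain (R : realType) (d : nat) (B : set 'rV[R]_d)
    (sigma : R) : set 'rV[R[i]]_d :=
  [set z | cdist z B <= sigma].

Definition map_domain (R : realType) (d : nat) (B : set 'rV[R]_d)
    (sigma r : R) : set ('rV[R[i]]_d * 'rV[R[i]]_d) :=
  [set z | cdist z.1 B <= sigma /\ `|imvec z.2| <= r].

(* [g] is an analytic continuation of [f] onto the closed set [D]: it is
   holomorphic on some open neighbourhood of [D] and extends [f] there.
   [iV], [iW] embed the real spaces into the complex ones. *)
Definition analytic_continuation (R : realType) (V W : normedModType R[i])
    (V0 W0 : Type) (iV : V0 -> V) (iW : W0 -> W)
    (D : set V) (f : V0 -> W0) (g : V -> W) : Prop :=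
  exists U : set V,
    [/\ open U, D `<=` U, (forall z, U z -> differentiable g z)
      & (forall x, U (iV x) -> g (iV x) = iW (f x))].

Definition lift_map (R : realType) (d : nat) (omega : 'rV[R]_d -> 'rV[R]_d)
    (a b : 'rV[R]_d * 'rV[R]_d -> 'rV[R]_d) (eps : R)
    (x : 'rV[R]_d * 'rV[R]_d) : 'rV[R]_d * 'rV[R]_d :=
  (x.1 + eps *: a x, x.2 + omega x.1 + eps *: b x).

(* Points of the torus are given by arbitrary representatives in R^d, so a
   trajectory satisfies the angle equation modulo Z^d only. *)
Definition trajectory (R : realType) (d : nat)
    (F : 'rV[R]_d * 'rV[R]_d -> 'rV[R]_d * 'rV[R]_d)
    (u : nat -> 'rV[R]_d * 'rV[R]_d) : Prop :=
  forall k, (u k.+1).1 = (F (u k)).1 /\ Zvec ((u k.+1).2 - (F (u k)).2).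

Definition symplectic_form (R : realType) (d : nat)
    (u v : 'rV[R]_d * 'rV[R]_d) : R :=
  dot u.1 v.2 - dot v.1 u.2.

(* A C^1 loop in [D] modulo Z^d in the angles, through a lift to R^d; it need
   not be contractible. *)
Definition is_loop (R : realType) (d : nat) (D : set ('rV[R]_d * 'rV[R]_d))
    (c : R -> 'rV[R]_d * 'rV[R]_d) : Prop :=
  [/\ (forall t, derivable c t 1) /\ continuous (derive1 c),
      (forall t, 0 <= t <= 1 -> D (c t)),
      (c 1).1 = (c 0).1 & Zvec ((c 1).2 - (c 0).2)].

Definition loop_action (R : realType) (d : nat)
    (c : R -> 'rV[R]_d * 'rV[R]_d) : R :=
  Rintegral lebesgue_measure `[0, 1]
    (fun t => dot (c t).1 (derive1 (fun s => (c s).2) t)).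

Definition exact_symplectic (R : realType) (d : nat)
    (D : set ('rV[R]_d * 'rV[R]_d))
    (F : 'rV[R]_d * 'rV[R]_d -> 'rV[R]_d * 'rV[R]_d) : Prop :=
  (forall x, D x -> differentiable F x /\
     forall u v, symplectic_form ('d F x u) ('d F x v) = symplectic_form u v)
  /\ (forall c, is_loop D c -> loop_action (F \o c) = loop_action c).

Definition is_gradient (R : realType) (d : nat) (D : set 'rV[R]_d)
    (h : 'rV[R]_d -> R) (omega : 'rV[R]_d -> 'rV[R]_d) : Prop :=
  forall I, D I -> differentiable h I /\ forall v, 'd h I v = dot (omega I) v.

(* Strong convexity of h, expressed through its gradient omega. *)
Definition strongly_convex (R : realType) (d : nat) (D : set 'rV[R]_d)
    (omega : 'rV[R]_d -> 'rV[R]_d) : Prop :=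
  exists2 nu : R, 0 < nu &
    forall I, D I -> forall v, nu * dot v v <= dot ('d omega I v) v.

Definition rho (R : realType) (d : nat) (gamma eps : R) (n : nat) : R :=
  gamma * n%:R^-1 * eps `^ (1 / (2 * d.+1%:R)).

Definition stability_time (R : realType) (d : nat) (c2 c3 eps : R) : R :=
  c2 * expR (c3 * eps `^ (- (1 / (2 * d.+1%:R)))).

(* Main.v *)
Require Import Defs.
From mathcomp Require Import all_boot all_order all_algebra.
From mathcomp Require Import all_classical all_reals all_analysis.
From mathcomp Require Import ring lra.

Set Implicit Arguments.
Unset Strict Implicit.
Unset Printing Implicit Defensive.

Import Order.TTheory GRing.Theory Num.Theory.
Import numFieldNormedType.Exports.
Local Open Scope classical_set_scope.
Local Open Scope ring_scope.

(** Put mu = eps^(1/(2(d+1))); the bound on n implies n^2 eps <= mu^2, and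
    rho = gamma mu / n.  Since n omega(Istar) is an integer vector, F^n is close
    to the identity on the torus near Istar.  In the variables I = Istar + rho J
    the return map f = F^n - (0, n omega(Istar)) reads
<<
      f (J, phi) = (J + p, phi + W(J) + q),
      W(J) = n (omega(Istar + rho J) - omega(Istar)),
>>
    where |p| <= M mu / gamma, W = O(gamma mu) and q = O(mu^2).  Hence f is
    within eta = C mu of the identity on a complex neighbourhood of fixed size.
    An exact map at distance eta from the identity conserves an energy up to an
    error that is exponentially small in 1/eta, and strong convexity makes this
    energy confine J.

    The energy is an action, and no normal form is needed to find it.  For
    x = (J, phi) let P_x be the polynomial curve of degree m, with m of order
    1/eta, that takes the values x, f x, ..., f^m x at 0, 1, ..., m; let c_x be
    the segment from the origin to (J, phi mod 1), and write Lam(c) for the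
    integral of I . dphi along c.  The energy is
<<
      H(x) = Lam(P_x) - (Lam(f o c_x) - Lam(c_x)).
>>
    The segment c_x, the curve P_x from x to f x and the reverse of c_{f x} form
    a loop on the torus.  Exactness on this loop gives
    H(f x) - H(x) = Lam(P_{f x}) - Lam(f o P_x) ([energy_drift]).  The curves
    P_{f x} and f o P_x agree at 0, 1, ..., m and are bounded on the disc of
    radius 4m; a holomorphic function with that many zeros is O(2^-m) on the
    disc of radius 2 ([defect_small]).  This is the source of the exponential.

    An integration by parts turns H(x) into the integral over s in [0, 1] of
    J . W(sJ), up to O(M mu / gamma) coming from p and O(mu^2) coming from q and
    from P_x ([energy_integral]).  By strong convexity of h0 and the Lipschitz
    continuity of omega, H is then squeezed between two multiples of
    gamma mu |J|^2 ([energy_ge], [energy_le]).  The first error is dominated when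
    gamma is large, the second one when eps is small, so that J cannot leave
    |J| < 1/2 before the accumulated drift of H is of order gamma mu, which
    takes an exponentially long time ([action_confined]).

    The complex analysis rests on the maximum modulus principle, obtained from
    Goursat's theorem in logarithmic polar coordinates.  Dividing by the zeros
    yields the bound used for [defect_small] and the Schwarz lemma, and the
    Schwarz lemma then plays the role of the Cauchy estimates: it bounds the
    finite differences of f ([fdiff_bound]), the Lipschitz constants of the
    curves, and the variation of the real derivative of F ([second_difference]). *)

(** * Integrals of continuous functions on a segment *)

Lemma eqW (R : realType) (x y : R) : x = y -> x <= y. Proof. by move=> ->. Qed.

Definition integ (R : realType) (a b : R) (f : R -> R) : R :=
  Rintegral lebesgue_measure `[a, b] f.

Definition cont_on (R : realType) (a b : R) (f : R -> R) :=
  forall x, a <= x <= b -> {for x, continuous f}.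

Lemma cont_on_integrable (R : realType) (a b : R) (f : R -> R) :
  cont_on a b f -> lebesgue_measure.-integrable `[a, b] (EFin \o f).
Proof.
move=> cf; apply: continuous_compact_integrable; first exact: segment_compact.
apply: continuous_in_subspaceT => x.
by rewrite inE /= in_itv /= => /cf.
Qed.

Lemma cont_on_sub (R : realType) (a b c e : R) (f : R -> R) :
  a <= c -> e <= b -> cont_on a b f -> cont_on c e f.
Proof.
move=> ac eb cf x /andP[cx xe]; apply: cf.
by rewrite (le_trans ac cx) (le_trans xe eb).
Qed.

Lemma integ_split (R : realType) (a c b : R) (f : R -> R) :
  a <= c -> c <= b -> cont_on a b f -> integ a b f = integ a c f + integ c b f.
Proof.
move=> ac cb cf; rewrite /integ.
have := @Rintegral_itvB R f (BLeft a) (BRight b) c (cont_on_integrable cf).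
rewrite !bnd_simp => /(_ ac cb) E.
rewrite Rintegral_itv_obnd_cbnd in E; first by rewrite -E addrC subrK.
apply: integrableS (cont_on_integrable (cont_on_sub ac (lexx b) cf)) => //.
by apply: subset_itvr; rewrite bnd_simp.
Qed.

Lemma integD (R : realType) (a b : R) (f g : R -> R) :
  cont_on a b f -> cont_on a b g ->
  integ a b (fun x => f x + g x) = integ a b f + integ a b g.
Proof.
by move=> cf cg; rewrite /integ RintegralD //; exact: cont_on_integrable.
Qed.

Lemma integB (R : realType) (a b : R) (f g : R -> R) :
  cont_on a b f -> cont_on a b g ->
  integ a b (fun x => f x - g x) = integ a b f - integ a b g.
Proof.
by move=> cf cg; rewrite /integ RintegralB //; exact: cont_on_integrable.
Qed.

Lemma integ_cst (R : realType) (a b : R) (k : R) : a <= b ->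
  integ a b (fun=> k) = k * (b - a).
Proof.
move=> ab; rewrite /integ Rintegral_cst //; congr (_ * _).
have := @lebesgue_measure_itv R `[a, b]; rewrite /= lte_fin => ->.
move: ab; rewrite le_eqVlt => /predU1P[->|ab]; first by rewrite ltxx subrr /=.
by rewrite ab.
Qed.

Lemma cst_cont_on (R : realType) (a b k : R) : cont_on a b (fun=> k).
Proof. by move=> x _; exact: cvg_cst. Qed.

Lemma integ_le (R : realType) (a b : R) (f g : R -> R) :
  cont_on a b f -> cont_on a b g ->
  (forall x, a <= x <= b -> f x <= g x) -> integ a b f <= integ a b g.
Proof.
move=> cf cg fg; apply: le_Rintegral => //; try exact: cont_on_integrable.
Qed.

Lemma integ_bound (R : realType) (a b B : R) (f : R -> R) : a <= b ->
  cont_on a b f -> (forall x, a <= x <= b -> `|f x| <= B) ->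
  `|integ a b f| <= B * (b - a).
Proof.
move=> ab cf fB; rewrite ler_norml -mulNr -!integ_cst //; apply/andP; split.
  apply: integ_le => // [|x /fB]; first exact: cst_cont_on.
  by rewrite ler_norml => /andP[].
apply: integ_le => // [|x /fB]; first exact: cst_cont_on.
by rewrite ler_norml => /andP[].
Qed.

Lemma integ_FTC (R : realType) (a b : R) (K k : R -> R) : a < b ->
  cont_on a b k ->
  (forall x, a <= x <= b -> is_derive x 1 K (k x)) ->
  integ a b k = K b - K a.
Proof.
move=> ab ck dK; rewrite /integ /Rintegral.
rewrite (@continuous_FTC2 _ k K) //.
- apply: continuous_in_subspaceT => x.
  by rewrite inE /= in_itv /= => /ck.
- have cK x : a <= x <= b -> {for x, continuous K}.
    move=> /dK h; apply: differentiable_continuous.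
    by apply/derivable1_diffP; exact: ex_derive.
  split.
  + move=> x; rewrite in_itv /= => /andP[ax xb].
    by have := dK x; rewrite !ltW // => /(_ isT) h; exact: ex_derive.
  + by apply: cvg_at_right_filter; apply: cK; rewrite lexx ltW.
  + by apply: cvg_at_left_filter; apply: cK; rewrite lexx ltW.
- move=> x; rewrite in_itv /= => /andP[ax xb].
  have := dK x; rewrite !ltW // => /(_ isT) h.
  by rewrite derive1E derive_val.
Qed.

(** The integral starts at a - 1 so that the fundamental theorem of calculus
    applies at both ends of [a, b] as interior points. *)
Lemma primitive_exists (R : realType) (a b : R) (k : R -> R) : a < b ->
  (forall x, {for x, continuous k}) ->
  exists K : R -> R, forall x, a <= x <= b -> is_derive x 1 K (k x).
Proof.
move=> ab ck; exists (fun x => integ (a - 1) x k) => x /andP[ax xb].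
have lt1 : x < b + 1 by rewrite (le_lt_trans xb) // ltrDl.
have [] := @continuous_FTC1_closed R k (a - 1) x (b + 1) lt1 _ _ (ck x).
- by apply: cont_on_integrable => y _; exact: ck.
- by rewrite (lt_le_trans _ ax) // ltrBlDr ltrDl.
by move=> d; rewrite derive1E => <-; exact: derivableP.
Qed.

(** * Goursat's theorem on rectangles *)

(** Complex differentiability of u + iv at s + it, with derivative al + i be,
    in terms of the real and imaginary parts. *)
Definition cauchy_riemann (R : realType) (u v : R -> R -> R) (s t : R) :=
  exists al be : R, forall e, 0 < e -> exists2 dl, 0 < dl &
    forall s' t', `|s' - s| < dl -> `|t' - t| < dl ->
    `|u s' t' - u s t - (al * (s' - s) - be * (t' - t))|
       <= e * (`|s' - s| + `|t' - t|) /\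
    `|v s' t' - v s t - (be * (s' - s) + al * (t' - t))|
       <= e * (`|s' - s| + `|t' - t|).

(** The imaginary part of the contour integral of u + iv around the rectangle. *)
Definition flux (R : realType) (u v : R -> R -> R) (a b c d : R) :=
  integ c d (fun t => u b t - u a t) - integ a b (fun s => v s d - v s c).

Lemma continuousP_eps (R : realType) (f : R -> R) (x : R) :
  (forall e, 0 < e -> exists2 dl, 0 < dl &
    forall y, `|y - x| < dl -> `|f y - f x| <= e) ->
  {for x, continuous f}.
Proof.
move=> H; apply/cvgrPdist_le => e e0; have [dl dl0 K] := H e e0.
near=> y; rewrite distrC; apply: K.
by near: y; apply: cvgr_distC_lt.
Unshelve. all: by end_near. Qed.

Lemma linear_growth_continuous (R : realType) (f : R -> R) (x B dl : R) :
  0 < dl -> (forall y, `|y - x| < dl -> `|f y - f x| <= B * `|y - x|) ->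
  {for x, continuous f}.
Proof.
move=> dl0 H; apply: continuousP_eps => e e0.
have B1 : 0 < `|B| + 1 by rewrite ltr_wpDl.
exists (Num.min dl (e / (`|B| + 1))); first by rewrite lt_min dl0 divr_gt0.
move=> y; rewrite lt_min => /andP[y1 y2]; apply: (le_trans (H _ y1)).
move: y2; rewrite ltr_pdivlMr // => y2; apply: le_trans (ltW y2).
rewrite mulrC ler_wpM2l //; apply: (le_trans (ler_norm B)); lra.
Qed.

Lemma cauchy_riemann_continuous (R : realType) (u v : R -> R -> R) (s t : R) :
  cauchy_riemann u v s t -> {for t, continuous (u s)} /\
    {for s, continuous (fun x => v x t)}.
Proof.
move=> [al [be /(_ 1 ltr01) [dl dl0 H]]]; split.
  apply: (@linear_growth_continuous _ _ _ (`|be| + 1) dl dl0) => y hy.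
  have [|h _] := H s y _ hy; first by rewrite subrr normr0.
  move: h; rewrite subrr mulr0 normr0 !add0r opprK mul1r => h.
  rewrite mulrDl mul1r -normrM.
  by rewrite -[X in `|X|](addrK (be * (y - t))) (le_trans (ler_normB _ _)) // addrC lerD2l.
apply: (@linear_growth_continuous _ _ _ (`|be| + 1) dl dl0) => y hy.
have [|_ h] := H y t hy; first by rewrite subrr normr0.
move: h; rewrite subrr mulr0 normr0 !addr0 mul1r => h.
rewrite mulrDl mul1r -normrM.
by rewrite -[X in `|X|](subrK (be * (y - s))) (le_trans (ler_normD _ _)) // addrC lerD2l.
Qed.

Lemma contB (R : realType) (f g : R -> R) (x : R) :
  {for x, continuous f} -> {for x, continuous g} ->
  {for x, continuous (fun y => f y - g y)}.
Proof. by move=> cf cg; exact: cvgB. Qed.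

(** A property of rectangles that always passes to one of the four quarters
    accumulates at a point: the lower left corners increase in each coordinate
    and their suprema are the coordinates of that point. *)
Lemma rectangle_bisection (R : realType) (a0 c0 w h : R)
    (bad : R -> R -> nat -> Prop) :
  0 < w -> 0 < h -> bad a0 c0 0%N ->
  (forall a c k, bad a c k -> exists i j : bool,
     bad (a + i%:R * (w / 2 ^+ k.+1)) (c + j%:R * (h / 2 ^+ k.+1)) k.+1) ->
  exists s t, forall k, exists a c,
    [/\ bad a c k, a0 <= a /\ c0 <= c, a <= s <= a + w / 2 ^+ k &
        c <= t <= c + h / 2 ^+ k].
Proof.
move=> w0 h0 bad0 step.
have [p [p0 pS]] : exists p : nat -> R * R, p 0%N = (a0, c0) /\
   forall k, bad (p k).1 (p k).2 k /\ exists i j : bool,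
     p k.+1 = ((p k).1 + i%:R * (w / 2 ^+ k.+1), (p k).2 + j%:R * (h / 2 ^+ k.+1)).
  have nx (q : R * R * nat) : exists r : R * R, bad q.1.1 q.1.2 q.2 ->
      bad r.1 r.2 q.2.+1 /\ exists i j : bool,
     r = (q.1.1 + i%:R * (w / 2 ^+ q.2.+1), q.1.2 + j%:R * (h / 2 ^+ q.2.+1)).
    case: (pselect (bad q.1.1 q.1.2 q.2)) => [hb|nb]; last by exists (0, 0) => /nb.
    have [i [j hij]] := step _ _ _ hb.
    by eexists (_, _) => _; split; [exact: hij|exists i, j].
  have [F FP] := choice nx.
  pose p := fix p k := if k is k'.+1 then F (p k', k') else (a0, c0).
  exists p; split=> // k.
  have bk : bad (p k).1 (p k).2 k.
    by elim: k => [//|k IH] /=; have [] := FP (p k, k) IH.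
  by split=> //; have [] := FP (p k, k) bk.
have wk k : 0 < w / 2 ^+ k by rewrite divr_gt0 // exprn_gt0.
have hk k : 0 < h / 2 ^+ k by rewrite divr_gt0 // exprn_gt0.
have half (x : R) k : x / 2 ^+ k = x / 2 ^+ k.+1 + x / 2 ^+ k.+1.
  have : (2 : R) ^+ k != 0 by rewrite expf_neq0.
  by rewrite exprS => ?; field.
have key (x : R) (pr : nat -> R) : 0 < x ->
   (forall k, exists i : bool, pr k.+1 = pr k + i%:R * (x / 2 ^+ k.+1)) ->
   exists s, forall k, pr 0%N <= pr k /\ pr k <= s <= pr k + x / 2 ^+ k.
  move=> x0 pp.
  have xk k : 0 < x / 2 ^+ k by rewrite divr_gt0 // exprn_gt0.
  have up k j : pr k <= pr (k + j)%N /\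
       pr (k + j)%N + x / 2 ^+ (k + j) <= pr k + x / 2 ^+ k.
    elim: j => [|j [IH1 IH2]]; first by rewrite addn0.
    rewrite addnS; have [i ->] := pp (k + j)%N.
    have := half x (k + j)%N; have := xk (k + j).+1.
    by case: i => /=; lra.
  (* Every left end lies to the left of every right end. *)
  have bd k j : pr j <= pr k + x / 2 ^+ k.
    have [kj|jk] := leqP k j.
      by have := (up k (j - k)%N).2; rewrite subnKC //; have := xk j; lra.
    by have := (up j (k - j)%N).1; rewrite subnKC ?(ltnW jk) //; have := xk k; lra.
  exists (sup (range pr)) => k; split; first by have := (up 0%N k).1; rewrite add0n.
  apply/andP; split.
    apply: ub_le_sup; last by exists k.
    by exists (pr 0%N + x / 2 ^+ 0) => _ [j _ <-].
  by apply: ge_sup; [exists (pr 0%N), 0%N|move=> _ [j _ <-]].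
have [|s hs] := key w (fun k => (p k).1) w0.
  by move=> k; have [_ [i [j ->]]] := pS k; exists i.
have [|t ht] := key h (fun k => (p k).2) h0.
  by move=> k; have [_ [i [j ->]]] := pS k; exists j.
exists s, t => k; exists (p k).1, (p k).2.
have [] := hs k; have [] := ht k; rewrite p0 /= => *; split=> //.
by have [] := pS k.
Qed.

Lemma flux_split_h (R : realType) (u v : R -> R -> R) (a m b c d : R) :
  a <= m -> m <= b -> 
  cont_on c d (u a) -> cont_on c d (u m) -> cont_on c d (u b) ->
  cont_on a b (fun s => v s c) -> cont_on a b (fun s => v s d) ->
  flux u v a b c d = flux u v a m c d + flux u v m b c d.
Proof.
move=> am mb ua um ub vc vd; rewrite /flux.
have vv : cont_on a b (fun s => v s d - v s c).
  by move=> x hx; apply: contB; [exact: vd|exact: vc].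
rewrite (integ_split am mb vv) !integB //; first ring.
all: by [exact: cont_on_sub vc | exact: cont_on_sub vd].
Qed.

Lemma flux_split_v (R : realType) (u v : R -> R -> R) (a b c m d : R) :
  c <= m -> m <= d -> 
  cont_on c d (u a) -> cont_on c d (u b) ->
  cont_on a b (fun s => v s c) -> cont_on a b (fun s => v s m) ->
  cont_on a b (fun s => v s d) ->
  flux u v a b c d = flux u v a b c m + flux u v a b m d.
Proof.
move=> cm md ua ub vc vm vd; rewrite /flux.
have uu : cont_on c d (fun t => u b t - u a t).
  by move=> x hx; apply: contB; [exact: ub|exact: ua].
rewrite (integ_split cm md uu) !integB //; first ring.
all: by [exact: cont_on_sub ua | exact: cont_on_sub ub].
Qed.

Definition rectangle_continuous (R : realType) (u v : R -> R -> R) (a b c d : R) :=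
  forall s t, a <= s <= b -> c <= t <= d ->
  {for t, continuous (u s)} /\ {for s, continuous (fun x => v x t)}.

Lemma flux_quarters (R : realType) (u v : R -> R -> R) (a c W H : R) : 0 < W -> 0 < H ->
  rectangle_continuous u v a (a + (W + W)) c (c + (H + H)) ->
  flux u v a (a + (W + W)) c (c + (H + H)) =
    flux u v a (a + W) c (c + H) + flux u v (a + W) (a + (W + W)) c (c + H) +
    (flux u v a (a + W) (c + H) (c + (H + H)) +
     flux u v (a + W) (a + (W + W)) (c + H) (c + (H + H))).
Proof.
move=> W0 H0 cuv.
have [a1 a2] : a <= a + W /\ a + W <= a + (W + W) by split; lra.
have [c1 c2] : c <= c + H /\ c + H <= c + (H + H) by split; lra.
have a3 := le_trans a1 a2; have c3 := le_trans c1 c2.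
have uC s c' d' : a <= s <= a + (W + W) -> c <= c' -> d' <= c + (H + H) -> cont_on c' d' (u s).
  move=> hs hc hd x /andP[x1 x2].
  by apply: (cuv s x hs _).1; rewrite (le_trans hc x1) (le_trans x2 hd).
have vC t a' b' : c <= t <= c + (H + H) -> a <= a' -> b' <= a + (W + W) ->
    cont_on a' b' (fun s => v s t).
  move=> ht ha hb x /andP[x1 x2].
  by apply: (cuv x t _ ht).2; rewrite (le_trans ha x1) (le_trans x2 hb).
have sa : a <= a <= a + (W + W) by rewrite lexx.
have sm : a <= a + W <= a + (W + W) by rewrite a1.
have sb : a <= a + (W + W) <= a + (W + W) by rewrite lexx a3.
have tc : c <= c <= c + (H + H) by rewrite lexx.
have tm : c <= c + H <= c + (H + H) by rewrite c1.
have td : c <= c + (H + H) <= c + (H + H) by rewrite lexx c3.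
rewrite (@flux_split_v _ u v a (a + (W + W)) c (c + H) (c + (H + H)) c1 c2 (uC a _ _ sa _ _)
  (uC _ _ _ sb _ _) (vC c _ _ tc _ _) (vC _ _ _ tm _ _) (vC _ _ _ td _ _)) //.
by congr (_ + _); apply: flux_split_h => //; [exact: uC|exact: uC|exact: uC|exact: vC|exact: vC
  |exact: uC|exact: uC|exact: uC|exact: vC|exact: vC].
Qed.

(** The flux of the affine part of (u, v) vanishes by the Cauchy-Riemann
    equations, so only the remainder contributes. *)
Lemma flux_small (R : realType) (u v : R -> R -> R) (a c W H s t al be e : R) :
  0 < W -> 0 < H -> 0 <= e -> a <= s <= a + W -> c <= t <= c + H ->
  rectangle_continuous u v a (a + W) c (c + H) ->
  (forall s' t', `|s' - s| <= W -> `|t' - t| <= H ->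
    `|u s' t' - u s t - (al * (s' - s) - be * (t' - t))| <= e * (`|s' - s| + `|t' - t|) /\
    `|v s' t' - v s t - (be * (s' - s) + al * (t' - t))| <= e * (`|s' - s| + `|t' - t|)) ->
  `|flux u v a (a + W) c (c + H)| <= 2 * e * (W + H) ^+ 2.
Proof.
move=> W0 H0 e0 hs ht cuv lin.
have near_s s' : a <= s' <= a + W -> `|s' - s| <= W.
  by move: hs; clear => *; rewrite ler_norml; lra.
have near_t t' : c <= t' <= c + H -> `|t' - t| <= H.
  by move: ht; clear => *; rewrite ler_norml; lra.
have aW : a <= a + W by rewrite lerDl ltW.
have cH : c <= c + H by rewrite lerDl ltW.
have two (x y x' y' z w : R) : `|x| <= e * (x' + z) -> `|y| <= e * (y' + w) ->
    x' + z <= W + H -> y' + w <= W + H -> `|x - y| <= 2 * e * (W + H).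
  move=> hx hy h1 h2; apply: (le_trans (ler_normB _ _)).
  have := ler_wpM2l e0 h1; have := ler_wpM2l e0 h2; move: hx hy; clear; lra.
have bu t' : c <= t' <= c + H -> `|u (a + W) t' - u a t' - al * W| <= 2 * e * (W + H).
  move=> ht'; have n2 := near_t t' ht'.
  have n1 : `|a + W - s| <= W by apply: near_s; rewrite lexx aW.
  have n3 : `|a - s| <= W by apply: near_s; rewrite lexx aW.
  have [h1 _] := lin _ _ n1 n2; have [h2 _] := lin _ _ n3 n2.
  have -> : u (a + W) t' - u a t' - al * W =
   (u (a + W) t' - u s t - (al * (a + W - s) - be * (t' - t))) -
   (u a t' - u s t - (al * (a - s) - be * (t' - t))) by ring.
  by apply: two h1 h2 _ _; exact: lerD.
have bv s' : a <= s' <= a + W -> `|v s' (c + H) - v s' c - al * H| <= 2 * e * (W + H).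
  move=> hs'; have n1 := near_s s' hs'.
  have n2 : `|c + H - t| <= H by apply: near_t; rewrite lexx cH.
  have n3 : `|c - t| <= H by apply: near_t; rewrite lexx cH.
  have [_ h1] := lin _ _ n1 n2; have [_ h2] := lin _ _ n1 n3.
  have -> : v s' (c + H) - v s' c - al * H =
   (v s' (c + H) - v s t - (be * (s' - s) + al * (c + H - t))) -
   (v s' c - v s t - (be * (s' - s) + al * (c - t))) by ring.
  by apply: two h1 h2 _ _; exact: lerD.
have sa : a <= a <= a + W by rewrite lexx.
have sb : a <= a + W <= a + W by rewrite lexx aW.
have tc : c <= c <= c + H by rewrite lexx.
have td : c <= c + H <= c + H by rewrite lexx cH.
have cu : cont_on c (c + H) (fun t' => u (a + W) t' - u a t').
  by move=> x hx; apply: contB; [exact: (cuv _ _ sb hx).1|exact: (cuv _ _ sa hx).1].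
have cv : cont_on a (a + W) (fun s' => v s' (c + H) - v s' c).
  by move=> x hx; apply: contB; [exact: (cuv _ _ hx td).2|exact: (cuv _ _ hx tc).2].
have -> : flux u v a (a + W) c (c + H) =
  integ c (c + H) (fun t' => u (a + W) t' - u a t' - al * W) -
  integ a (a + W) (fun s' => v s' (c + H) - v s' c - al * H).
  rewrite /flux (integB cu (@cst_cont_on _ _ _ (al * W))).
  rewrite (integB cv (@cst_cont_on _ _ _ (al * H))) !integ_cst //; ring.
have B1 := @integ_bound _ c (c + H) (2 * e * (W + H)) _ cH
  (fun x hx => contB (cu x hx) (@cst_cont_on _ _ _ (al * W) x hx)) bu.
have B2 := @integ_bound _ a (a + W) (2 * e * (W + H)) _ aW
  (fun x hx => contB (cv x hx) (@cst_cont_on _ _ _ (al * H) x hx)) bv.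
apply: (le_trans (ler_normB _ _)); apply: (le_trans (lerD B1 B2)).
by apply: eqW; ring.
Qed.

Lemma quarter_arith (R : realType) (x y z w X : R) :
  `|x| < X / 4 -> `|y| < X / 4 -> `|z| < X / 4 -> `|w| < X / 4 -> `|x + y + (z + w)| < X.
Proof.
move=> *; apply: (le_lt_trans (ler_normD _ _)).
by have := ler_normD x y; have := ler_normD z w; lra.
Qed.

Lemma subinterval (R : realType) (a x b W : R) (i : bool) : 0 < W -> a <= x ->
  x + (W + W) <= b -> a <= x + i%:R * W /\ x + i%:R * W + W <= b.
Proof. by case: i => *; rewrite /= ?mul1r ?mul0r; split; lra. Qed.

(** If the flux ka were not zero, some quarter would carry at least ka / 4,
    and so on. At the point where these rectangles accumulate,
    differentiability bounds the flux through the k-th one by an arbitrarily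
    small multiple of 4^-k. *)
Lemma goursat_rectangle (R : realType) (u v : R -> R -> R) (a w c h : R) :
  0 < w -> 0 < h ->
  (forall s t, a <= s <= a + w -> c <= t <= c + h -> cauchy_riemann u v s t) ->
  flux u v a (a + w) c (c + h) = 0.
Proof.
move=> w0 h0 CR; apply/eqP; apply: contraT => nz.
pose ka := `|flux u v a (a + w) c (c + h)|.
have ka0 : 0 < ka by rewrite normr_gt0.
pose wk k := w / 2 ^+ k; pose hk k := h / 2 ^+ k.
have wk0 k : 0 < wk k by rewrite divr_gt0 // exprn_gt0.
have hk0 k : 0 < hk k by rewrite divr_gt0 // exprn_gt0.
have half (x : R) k : x / 2 ^+ k = x / 2 ^+ k.+1 + x / 2 ^+ k.+1.
  have : (2 : R) ^+ k != 0 by rewrite expf_neq0.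
  by rewrite exprS => ?; field.
have cuv a' b' c' d' : a <= a' -> b' <= a + w -> c <= c' -> d' <= c + h ->
    rectangle_continuous u v a' b' c' d'.
  move=> ha hb hc hd s t /andP[s1 s2] /andP[t1 t2].
  apply: (@cauchy_riemann_continuous _ u v s t); apply: CR.
    by rewrite (le_trans ha s1) (le_trans s2 hb).
  by rewrite (le_trans hc t1) (le_trans t2 hd).
pose bad a' c' k := [/\ a <= a' /\ a' + wk k <= a + w, c <= c' /\ c' + hk k <= c + h &
  ka / 4 ^+ k <= `|flux u v a' (a' + wk k) c' (c' + hk k)|].
have bad0 : bad a c 0%N.
  by rewrite /bad /wk /hk !expr0 !divr1; split.
have step a' c' k : bad a' c' k -> exists i j : bool,
     bad (a' + i%:R * (w / 2 ^+ k.+1)) (c' + j%:R * (h / 2 ^+ k.+1)) k.+1.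
  move=> [[a1 a2] [c1 c2] K].
  have EW : wk k = wk k.+1 + wk k.+1 by exact: half.
  have EH : hk k = hk k.+1 + hk k.+1 by exact: half.
  pose Fl (i j : bool) := flux u v (a' + i%:R * wk k.+1) (a' + i%:R * wk k.+1 + wk k.+1)
         (c' + j%:R * hk k.+1) (c' + j%:R * hk k.+1 + hk k.+1).
  have E : flux u v a' (a' + wk k) c' (c' + hk k) =
     Fl false false + Fl true false + (Fl false true + Fl true true).
    rewrite EW in a2 *; rewrite EH in c2 *.
    by rewrite (flux_quarters (wk0 _) (hk0 _) (cuv _ _ _ _ a1 a2 c1 c2)) /Fl !mul0r !mul1r
      !addr0 !addrA.
  have [i [j hij]] : exists i j, ka / 4 ^+ k.+1 <= `|Fl i j|.
    apply: contrapT => nij.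
    have E4 : ka / 4 ^+ k.+1 = (ka / 4 ^+ k) / 4.
      have : (4 : R) ^+ k != 0 by rewrite expf_neq0.
      by rewrite exprS => ?; field.
    have lt i j : `|Fl i j| < (ka / 4 ^+ k) / 4.
      by rewrite -E4 ltNge; apply/negP => hij; apply: nij; exists i, j.
    have := quarter_arith (lt false false) (lt true false) (lt false true) (lt true true).
    by rewrite -E ltNge K.
  rewrite EW in a2; rewrite EH in c2.
  by exists i, j; split; [exact: subinterval (wk0 _) a1 a2|exact: subinterval (hk0 _) c1 c2|].
have [s [t st]] := rectangle_bisection w0 h0 bad0 step.
have [hs ht] : a <= s <= a + w /\ c <= t <= c + h.
  have [a' [c' [[[a1 a2] [c1 c2] _] _ /andP[s1 s2] /andP[t1 t2]]]] := st 0%N.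
  by split; [rewrite (le_trans a1 s1) (le_trans s2 a2)|rewrite (le_trans c1 t1) (le_trans t2 c2)].
have [al [be H]] := CR s t hs ht.
(* This choice makes the bound of [flux_small] a quarter of the lower bound. *)
pose e := ka / (8 * (w + h) ^+ 2).
have e0 : 0 < e by rewrite divr_gt0 // mulr_gt0 // exprn_gt0 // addr_gt0.
have [dl dl0 {}H] := H e e0.
have [k [wkd hkd]] : exists k, wk k < dl /\ hk k < dl.
  pose N := Num.bound ((w + h) / dl).
  have wh : 0 <= (w + h) / dl by rewrite divr_ge0 // ltW // addr_gt0.
  have : (w + h) / dl < 2 ^+ N.
    apply: (lt_trans (archi_boundP wh)); rewrite -natrX ltr_nat.
    exact: ltn_expl.
  rewrite ltr_pdivrMr // => B; exists N.
  by rewrite /wk /hk !ltr_pdivrMr ?exprn_gt0 // mulrC; split; lra.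
have [a' [c' [[[a1 a2] [c1 c2] K] _ sa tc]]] := st k.
have B : `|flux u v a' (a' + wk k) c' (c' + hk k)| <= 2 * e * (wk k + hk k) ^+ 2.
  apply: (flux_small (wk0 k) (hk0 k) (ltW e0) sa tc (cuv _ _ _ _ a1 a2 c1 c2)) => s' t' hs' ht'.
  by apply: H; [exact: le_lt_trans hs' wkd|exact: le_lt_trans ht' hkd].
have E : 2 * e * (wk k + hk k) ^+ 2 = ka / 4 ^+ k / 4.
  rewrite /e /wk /hk.
  have -> : (4 : R) ^+ k = 2 ^+ k * 2 ^+ k by rewrite -exprMn; congr (_ ^+ _); ring.
  have n1 : (2 : R) ^+ k != 0 by rewrite expf_neq0.
  have n2 : w + h != 0 by rewrite gt_eqF // addr_gt0.
  by field; rewrite n1 n2.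
have p : 0 < ka / 4 ^+ k by rewrite divr_gt0 // exprn_gt0.
have := le_trans K B; rewrite E; move: p; clear; lra.
Qed.

(** * The real-valued norm and the complex exponential *)

Local Open Scope complex_scope.

Notation CK R := (R[i] : numFieldType).

Section cnorm_theory.
Variables (R : realType) (V : normedModType R[i]).
Implicit Types (x y z : V).

Lemma normE z : `|z| = (cnorm z)%:C.
Proof.
rewrite /cnorm; have := ger0_Im (normr_ge0 z).
by case: `|z| => p q /= ->.
Qed.

Lemma cnorm_ge0 z : 0 <= cnorm z.
Proof. by have := normr_ge0 z; rewrite normE ler0c. Qed.

Lemma cnorm_le z (e : R) : (cnorm z <= e) = (`|z| <= e%:C).
Proof. by rewrite normE lecR. Qed.

Lemma cnorm_lt z (e : R) : (cnorm z < e) = (`|z| < e%:C).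
Proof. by rewrite normE ltcR. Qed.

Lemma cnormD x y : cnorm (x + y) <= cnorm x + cnorm y.
Proof. by rewrite cnorm_le rmorphD /= -!normE ler_normD. Qed.

Lemma cnormN x : cnorm (- x) = cnorm x.
Proof. by rewrite /cnorm normrN. Qed.

Lemma cnormB x y : cnorm (x - y) <= cnorm x + cnorm y.
Proof. by rewrite -(cnormN y) cnormD. Qed.

Lemma cnorm_distC x y : cnorm (x - y) = cnorm (y - x).
Proof. by rewrite /cnorm distrC. Qed.

Lemma cnorm0 : cnorm (0 : V) = 0.
Proof. by rewrite /cnorm normr0. Qed.

Lemma cnorm_eq0 x : cnorm x = 0 -> x = 0.
Proof. by move=> h; apply/eqP; rewrite -normr_eq0 normE h. Qed.

Lemma cnormZ (a : CK R) x : cnorm (a *: x) = cnorm a * cnorm x.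
Proof. 
have : `|a *: x| = `|a| * `|x| by rewrite normrZ.
rewrite !normE -rmorphM /= => h; exact: (complexI h).
Qed.

Lemma cnorm_tri (z x y : V) : cnorm (x - y) <= cnorm (x - z) + cnorm (z - y).
Proof. by rewrite -[x - y](subrKA z) cnormD. Qed.

End cnorm_theory.

Section scalar_cnorm.
Variable (R : realType).
Implicit Types (z w : CK R).

Lemma cnormM z w : cnorm (z * w) = cnorm z * cnorm w.
Proof. exact: Normc.normcM. Qed.

Lemma cnormV z : cnorm (z^-1) = (cnorm z)^-1.
Proof. exact: Normc.normcV. Qed.

Lemma cnorm1 : cnorm (1 : CK R) = 1.
Proof. exact: Normc.normc1. Qed.

Lemma cnorm_real (x : R) : cnorm (x%:C : CK R) = `|x|.
Proof. by rewrite /cnorm normc_def /= expr0n /= addr0 sqrtr_sqr. Qed.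

Lemma sqr_cnorm z : cnorm z ^+ 2 = complex.Re z ^+ 2 + complex.Im z ^+ 2.
Proof.
rewrite /cnorm normc_def /= sqr_sqrtr // addr_ge0 ?sqr_ge0 //.
Qed.

Lemma Re_le_cnorm z : `|complex.Re z| <= cnorm z.
Proof.
have := sqr_cnorm z; have := cnorm_ge0 z; have := sqr_ge0 (complex.Im z).
by move=> *; rewrite -(ler_pXn2r (n := 2)) ?nnegrE // real_normK ?num_real //; lra.
Qed.

Lemma Im_le_cnorm z : `|complex.Im z| <= cnorm z.
Proof.
have := sqr_cnorm z; have := cnorm_ge0 z; have := sqr_ge0 (complex.Re z).
by move=> *; rewrite -(ler_pXn2r (n := 2)) ?nnegrE // real_normK ?num_real //; lra.
Qed.

Lemma cnorm_le_ReIm z : cnorm z <= `|complex.Re z| + `|complex.Im z|.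
Proof.
rewrite -(ler_pXn2r (n := 2)) ?nnegrE ?cnorm_ge0 ?addr_ge0 // sqr_cnorm.
rewrite sqrrD !real_normK ?num_real // addrAC lerDl.
by rewrite mulrn_wge0 // mulr_ge0.
Qed.

End scalar_cnorm.

Lemma complex_pos_real (R : realType) (e : R[i]) : 0 < e -> exists2 e' : R, 0 < e' & e = e'%:C.
Proof.
case: e => p q; rewrite ltcE /= => /andP[/eqP -> p0].
by exists p.
Qed.

(** Filters on a normed space over R[i] use radii in R[i]; real radii suffice
    because positive elements are real. *)
Lemma near_cnorm (R : realType) (V : normedModType R[i]) (z : V) (P : V -> Prop) :
  (\forall x \near z, P x) <->
  exists2 dl : R, 0 < dl & forall x, cnorm (x - z) < dl -> P x.
Proof.
split.
  move=> /nbhs_normP[e /= e0 H]; have [e' e'0 E] := complex_pos_real e0.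
  exists e' => // x hx; apply: H; rewrite /ball_ /= distrC E.
  by rewrite -cnorm_lt.
move=> [dl dl0 H]; apply/nbhs_normP; exists (dl%:C); first by rewrite /= ltcR.
by move=> x /=; rewrite distrC -cnorm_lt; exact: H.
Qed.

Section continuity_eps.
Variables (R : realType) (V W : normedModType R[i]) (f : V -> W) (z : V).

Lemma cont_eps : {for z, continuous f} <->
  forall e : R, 0 < e -> exists2 dl : R, 0 < dl &
   forall x, cnorm (x - z) < dl -> cnorm (f x - f z) <= e.
Proof.
split.
  move=> /cvgrPdist_le cf e e0.
  have /cf /near_cnorm[dl dl0 H] : (0 : R[i]) < e%:C by rewrite ltcR.
  by exists dl => // x /H; rewrite distrC cnorm_le.
move=> H; apply/cvgrPdist_le => e /complex_pos_real[e' e'0 ->].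
apply/near_cnorm; have [dl dl0 K] := H _ e'0.
by exists dl => // x /K; rewrite distrC cnorm_le.
Qed.

Lemma diff_eps : differentiable f z -> forall e : R, 0 < e ->
  exists2 dl : R, 0 < dl & forall x, cnorm (x - z) < dl ->
     cnorm (f x - f z - 'd f z (x - z)) <= e * cnorm (x - z).
Proof.
move=> /diff_locally /eqaddoP H e e0.
have /H /near_cnorm[dl dl0 K] : (0 : R[i]) < e%:C by rewrite ltcR.
exists dl => // x hx; have := K (x - z); rewrite subr0 => /(_ hx).
rewrite [X in `|X|](_ : _ = f x - f z - 'd f z (x - z)); last first.
  by rewrite !fctE /= subrK opprD addrA.
by rewrite !normE -rmorphM /= lecR.
Qed.

End continuity_eps.

Lemma cdiff_eps (R : realType) (g : CK R -> CK R) (z : CK R) :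
  differentiable g z -> exists be : CK R, forall e : R, 0 < e ->
  exists2 dl : R, 0 < dl & forall x, cnorm (x - z) < dl ->
     cnorm (g x - g z - be * (x - z)) <= e * cnorm (x - z).
Proof.
move=> dg; exists ('d g z 1) => e e0; have [dl dl0 H] := diff_eps dg e0.
exists dl => // x /H.
have -> : 'd g z (x - z) = 'd g z 1 * (x - z); last by [].
by rewrite -[in LHS](mulr1 (x - z)) linearZ /= mulrC.
Qed.

Lemma is_derive_eps (R : realType) (f : R -> R) (x l : R) :
  is_derive x 1 f l -> forall e : R, 0 < e ->
  exists2 dl : R, 0 < dl & forall y, `|y - x| < dl ->
     `|f y - f x - l * (y - x)| <= e * `|y - x|.
Proof.
move=> df e e0.
have /derivable1_diffP/diff_locally /eqaddoP /(_ _ e0) : derivable f x 1 by [].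
move=> /nbhs_normP[dl /= dl0 H]; exists dl => // y hy.
have := H (y - x); rewrite /ball_ /= sub0r normrN => /(_ hy).
rewrite [X in `|X|](_ : _ = f y - f x - l * (y - x)) //.
rewrite !fctE /= subrK opprD addrA; congr (_ - _).
rewrite diff1E ?derive1E; first by rewrite /= derive_val mulrC.
by apply/derivable1_diffP.
Qed.

(** The exponential of s + it. *)
Definition cexp (R : realType) (s t : R) : CK R :=
  (expR s * cos t) +i* (expR s * sin t).

Lemma cexpD (R : realType) (s t h k : R) :
  cexp (s + h) (t + k) = cexp s t * cexp h k.
Proof.
rewrite /cexp expRD cosD sinD; apply/eqP; rewrite eq_complex /=.
by apply/andP; split; apply/eqP; ring.
Qed.

Lemma cnorm_cexp (R : realType) (s t : R) : cnorm (cexp s t) = expR s.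
Proof.
apply/eqP; rewrite -(eqrXn2 (n := 2)) ?cnorm_ge0 ?expR_ge0 // sqr_cnorm /=.
by rewrite !exprMn -mulrDr cos2Dsin2 mulr1.
Qed.

Lemma cexp_2pi (R : realType) (s t : R) : cexp s (t + 2 * pi) = cexp s t.
Proof. by rewrite /cexp [2 * pi]mulrC mulr_natr cosD2pi sinD2pi. Qed.

Lemma cexp_taylor (R : realType) (e : R) : 0 < e ->
  exists2 dl : R, 0 < dl & forall h k : R, `|h| < dl -> `|k| < dl ->
   cnorm (cexp h k - 1 - (h +i* k : CK R)) <= e * (`|h| + `|k|).
Proof.
move=> e0; pose e1 := Num.min (e / 8) 1.
have e10 : 0 < e1 by rewrite lt_min divr_gt0 //= ltr01.
have e1e : e1 <= e / 8 by rewrite ge_min lexx.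
have e11 : e1 <= 1 by rewrite ge_min lexx orbT.
clearbody e1.
have [d1 d10 H1] := is_derive_eps (is_derive_expR (0 : R)) e10.
have [d2 d20 H2] := is_derive_eps (is_derive_cos (0 : R)) e10.
have [d3 d30 H3] := is_derive_eps (is_derive_sin (0 : R)) e10.
exists (Num.min (Num.min d1 d2) (Num.min d3 e1)).
  by rewrite !lt_min d10 d20 d30 e10.
move=> h k; rewrite !lt_min => /andP[/andP[h1 h2] /andP[h3 h4]].
move=> /andP[/andP[k1 k2] /andP[k3 k4]].
have {}H1 : `|expR h - 1 - h| <= e1 * `|h|.
  by have := H1 h; rewrite subr0 expR0 mul1r => /(_ h1).
have {}H2 : `|cos k - 1| <= e1 * `|k|.
  by have := H2 k; rewrite !subr0 cos0 sin0 oppr0 mul0r subr0 => /(_ k2).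
have {}H3 : `|sin k - k| <= e1 * `|k|.
  by have := H3 k; rewrite !subr0 sin0 cos0 mul1r subr0 => /(_ k3).
have eh : `|expR h - 1| <= 2 * `|h|.
  rewrite -[X in `|X|](subrK h); apply: (le_trans (ler_normD _ _)).
  have : e1 * `|h| <= `|h| by rewrite ler_piMl.
  lra.
have eh3 : `|expR h| <= 3.
  rewrite -[X in `|X|](subrK 1); apply: (le_trans (ler_normD _ _)).
  by rewrite normr1; lra.
apply: (le_trans (cnorm_le_ReIm _)) => /=.
have -> : expR h * cos k - 1 - h = (expR h - 1 - h) + expR h * (cos k - 1) by ring.
have -> : expR h * sin k - 0 - k = expR h * (sin k - k) + (expR h - 1) * k by ring.
have A1 : `|expR h * (cos k - 1)| <= 3 * (e1 * `|k|).
  by rewrite normrM; apply: ler_pM.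
have A2 : `|expR h * (sin k - k)| <= 3 * (e1 * `|k|).
  by rewrite normrM; apply: ler_pM.
have A3 : `|(expR h - 1) * k| <= 2 * (e1 * `|k|).
  rewrite normrM; apply: (le_trans (ler_wpM2r (normr_ge0 k) eh)).
  by rewrite -mulrA ler_wpM2l // ler_wpM2r // ltW.
have := ler_normD (expR h - 1 - h) (expR h * (cos k - 1)).
have := ler_normD (expR h * (sin k - k)) ((expR h - 1) * k).
have : e1 * `|k| <= e / 8 * `|k| by rewrite ler_wpM2r.
have : e1 * `|h| <= e / 8 * `|h| by rewrite ler_wpM2r.
have : 0 <= e / 8 * `|h| by rewrite mulr_ge0 //; lra.
have : 0 <= e / 8 * `|k| by rewrite mulr_ge0 //; lra.
lra.
Qed.

(** * Circle means of holomorphic functions *)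

Lemma ReD (R : realType) (z w : CK R) :
  complex.Re (z + w) = complex.Re z + complex.Re w.
Proof. by case: z; case: w. Qed.
Lemma ImD (R : realType) (z w : CK R) :
  complex.Im (z + w) = complex.Im z + complex.Im w.
Proof. by case: z; case: w. Qed.
Lemma ReN (R : realType) (z : CK R) : complex.Re (- z) = - complex.Re z.
Proof. by case: z. Qed.
Lemma ImN (R : realType) (z : CK R) : complex.Im (- z) = - complex.Im z.
Proof. by case: z. Qed.
Lemma ReM (R : realType) (z w : CK R) : complex.Re (z * w) =
  complex.Re z * complex.Re w - complex.Im z * complex.Im w.
Proof. by case: z; case: w. Qed.
Lemma ImM (R : realType) (z w : CK R) : complex.Im (z * w) =
  complex.Re z * complex.Im w + complex.Im z * complex.Re w.
Proof. by case: z => a b; case: w => c d /=. Qed.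

(** In the coordinates z = p + exp(s + it) rectangles are sectors of annuli,
    so that Goursat's theorem on rectangles applies to annuli. *)
Lemma cauchy_riemann_polar (R : realType) (g : CK R -> CK R) (p : CK R)
    (s t : R) :
  differentiable g (p + cexp s t) ->
  cauchy_riemann (fun s t => complex.Re (g (p + cexp s t)))
     (fun s t => complex.Im (g (p + cexp s t))) s t.
Proof.
move=> /cdiff_eps[be H]; pose ga := be * cexp s t.
exists (complex.Re ga), (complex.Im ga) => e e0.
pose A := expR s; have A0 : 0 < A by exact: expR_gt0.
pose b := cnorm be; have b0 : 0 <= b := cnorm_ge0 _.
have bA0 : 0 <= b * A by rewrite mulr_ge0 // ltW.
have [e2 [e20 e21 e2e]] : exists e2 : R, [/\ 0 < e2, e2 <= 1 & b * A * e2 <= e / 2].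
  exists (Num.min 1 (e / 2 / (b * A + 1))); split.
  - by rewrite lt_min ltr01 /= !divr_gt0 //; lra.
  - by rewrite ge_min lexx.
  - apply: (@le_trans _ _ (b * A * (e / 2 / (b * A + 1)))).
      by rewrite ler_wpM2l // ge_min lexx orbT.
    rewrite mulrA ler_pdivrMr ?mulrDr; last by lra.
    by rewrite mulrC mulr1 lerDl; lra.
have e10 : 0 < e / (4 * A) by rewrite divr_gt0 // mulr_gt0.
have [d1 d10 H1] := H _ e10.
have [d2 d20 H2] := cexp_taylor e20.
exists (Num.min d2 (d1 / (4 * A))).
  by rewrite lt_min d20 divr_gt0 // mulr_gt0.
move=> s' t'; rewrite !lt_min => /andP[s1 s2] /andP[t1 t2].
pose h := s' - s; pose k := t' - t; rewrite -/h -/k in s1 s2 t1 t2 *.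
have {}H2 := H2 h k s1 t1.
have Es : cexp s' t' = cexp s t * cexp h k.
  by rewrite -cexpD /h /k !subrKC.
have E1 : cnorm (cexp h k - 1) <= 2 * (`|h| + `|k|).
  rewrite -[cexp h k - 1](subrK (h +i* k : CK R)).
  apply: (le_trans (cnormD _ _)).
  have := cnorm_le_ReIm (h +i* k : CK R) => /= B.
  have : e2 * (`|h| + `|k|) <= `|h| + `|k| by rewrite ler_piMl // addr_ge0.
  lra.
have Ez : p + cexp s' t' - (p + cexp s t) = cexp s t * (cexp h k - 1).
  by rewrite Es; ring.
have Nz : cnorm (p + cexp s' t' - (p + cexp s t)) = A * cnorm (cexp h k - 1).
  by rewrite Ez cnormM cnorm_cexp.
have close : cnorm (p + cexp s' t' - (p + cexp s t)) < d1.
  rewrite Nz mulrC -ltr_pdivlMr //.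
  have : d1 / A = 4 * (d1 / (4 * A)) by field; rewrite gt_eqF.
  lra.
have {}H1 := H1 _ close.
set D := g (p + cexp s' t') - g (p + cexp s t) - ga * (h +i* k : CK R).
have ND : cnorm D <= e * (`|h| + `|k|).
  have -> : D = (g (p + cexp s' t') - g (p + cexp s t) -
       be * (p + cexp s' t' - (p + cexp s t))) +
       ga * (cexp h k - 1 - (h +i* k : CK R)).
    by rewrite /D Ez /ga; ring.
  apply: (le_trans (cnormD _ _)).
  rewrite cnormM [cnorm ga]cnormM cnorm_cexp -/A -/b.
  move: H1; rewrite Nz => H1.
  have : e / (4 * A) * (A * cnorm (cexp h k - 1)) <= e / 2 * (`|h| + `|k|).
    have -> : e / (4 * A) * (A * cnorm (cexp h k - 1)) = e / 4 * cnorm (cexp h k - 1).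
      by field; rewrite gt_eqF.
    have : e / 4 * cnorm (cexp h k - 1) <= e / 4 * (2 * (`|h| + `|k|)).
      by rewrite ler_wpM2l //; lra.
    lra.
  have : b * A * cnorm (cexp h k - 1 - (h +i* k : CK R)) <= b * A * (e2 * (`|h| + `|k|)).
    by rewrite ler_wpM2l.
  have : b * A * e2 * (`|h| + `|k|) <= e / 2 * (`|h| + `|k|).
    by rewrite ler_wpM2r // addr_ge0.
  lra.
have RD := le_trans (Re_le_cnorm D) ND.
have ID := le_trans (Im_le_cnorm D) ND.
move: RD ID; rewrite /D !ReD !ImD !ReN !ImN ReM ImM /= => RD ID.
split.
  by apply: le_trans RD; apply: eqW; congr (`|_|); ring.
by apply: le_trans ID; apply: eqW; congr (`|_|); ring.
Qed.

(** Goursat on the annulus between the two circles: the two radial sides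
    cancel by periodicity. The centre p stays outside the annulus, so g may be
    singular there. *)
Lemma circle_mean_constant (R : realType) (g : CK R -> CK R) (p : CK R)
    (s0 s1 : R) : s0 < s1 ->
  (forall z, 0 < cnorm (z - p) <= expR s1 -> differentiable g z) ->
  integ 0 (2 * pi) (fun t => complex.Re (g (p + cexp s0 t))) =
  integ 0 (2 * pi) (fun t => complex.Re (g (p + cexp s1 t))).
Proof.
move=> s01 dg.
have pi0 : (0 : R) < 2 * pi by rewrite mulr_gt0 // pi_gt0.
set u := (fun s t : R => complex.Re (g (p + cexp s t))).
set v := (fun s t : R => complex.Im (g (p + cexp s t))).
have CR s t : s <= s1 -> cauchy_riemann u v s t.
  move=> ss; apply: cauchy_riemann_polar; apply: dg.
  by rewrite addrC addKr cnorm_cexp expR_gt0 ler_expR.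
have := @goursat_rectangle R u v s0 (s1 - s0) 0 (2 * pi).
rewrite subr_gt0 s01 => /(_ isT pi0) F.
have {}F : flux u v s0 s1 0 (2 * pi) = 0.
  by rewrite -[s1 in LHS](subrKC s0) -[2 * pi]add0r; apply: F => s t h _; apply: CR; lra.
have cu s : s <= s1 -> cont_on 0 (2 * pi) (u s).
  by move=> ss t _; have [] := cauchy_riemann_continuous (CR s t ss).
move: F; rewrite /flux integB; [|exact: cu|by apply: cu; exact: ltW].
rewrite [X in _ - X = _](_ : _ = 0); first by rewrite subr0 => /eqP; rewrite subr_eq0 => /eqP ->.
under eq_fun do rewrite /v -[2 * pi]add0r cexp_2pi subrr.
by rewrite integ_cst ?mul0r // ltW.
Qed.

(** The mean of Re g over a circle around p does not depend on the radius. It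
    tends to Re g(p) for small circles, but a peak would keep it below Re g(p)
    - eta rad^2 on the outer circle. *)
Lemma no_paraboloid_peak (R : realType) (g : CK R -> CK R) (p : CK R)
    (rad eta : R) :
  0 < rad -> 0 < eta -> {for p, continuous g} ->
  (forall z, 0 < cnorm (z - p) <= rad -> differentiable g z) ->
  ~ (forall z, cnorm (z - p) <= rad ->
     complex.Re (g z) <= complex.Re (g p) - eta * cnorm (z - p) ^+ 2).
Proof.
move=> r0 eta0 cg dg peak.
have pi0 : (0 : R) < 2 * pi by rewrite mulr_gt0 // pi_gt0.
have k0 : 0 < eta * rad ^+ 2 by rewrite mulr_gt0 // exprn_gt0.
have e0 : 0 < eta * rad ^+ 2 / 2 by lra.
have [dl dl0 H] := (cont_eps _ _).1 cg _ e0.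
pose s1 := ln rad; have E1 : expR s1 = rad by rewrite lnK.
(* A circle inside the given one, so small that continuity controls g on it. *)
pose s0 := Num.min (s1 - 1) (ln dl - 1).
have s01 : s0 < s1 by rewrite gt_min; apply/orP; left; lra.
have s0d : expR s0 < dl.
  by rewrite -[ltRHS]lnK // ltr_expR gt_min; apply/orP; right; lra.
have cu s : s <= s1 -> cont_on 0 (2 * pi) (fun t => complex.Re (g (p + cexp s t))).
  move=> ss t _.
  have CR : cauchy_riemann (fun s t => complex.Re (g (p + cexp s t)))
     (fun s t => complex.Im (g (p + cexp s t))) s t.
    apply: cauchy_riemann_polar; apply: dg.
    by rewrite addrC addKr cnorm_cexp expR_gt0 -E1 ler_expR.
  by have [] := cauchy_riemann_continuous CR.
have cstE k : k * (2 * pi) = integ 0 (2 * pi) (fun=> k) :> R.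
  by rewrite integ_cst ?subr0 // ltW.
have := @circle_mean_constant R g p s0 s1 s01; rewrite E1 => /(_ dg) E.
have U : integ 0 (2 * pi) (fun t => complex.Re (g (p + cexp s1 t))) <=
   (complex.Re (g p) - eta * rad ^+ 2) * (2 * pi).
  rewrite cstE.
  apply: integ_le => [||t _]; [exact: cu|exact: cst_cont_on|].
  have := peak (p + cexp s1 t); rewrite [p + _ - p]addrC addKr cnorm_cexp E1.
  by move=> /(_ (lexx _)).
have L : (complex.Re (g p) - eta * rad ^+ 2 / 2) * (2 * pi) <=
  integ 0 (2 * pi) (fun t => complex.Re (g (p + cexp s0 t))).
  rewrite cstE.
  apply: integ_le => [||t _]; [exact: cst_cont_on|by apply: cu; exact: ltW|].
  have := H (p + cexp s0 t); rewrite [p + _ - p]addrC addKr cnorm_cexp.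
  move=> /(_ s0d) /(le_trans (Re_le_cnorm _)); rewrite ReD ReN ler_norml.
  by move=> /andP[+ _]; lra.
have := le_trans L (le_trans (eq_ind _ (fun x => _ <= x) (lexx _) _ E) U).
by rewrite ler_pM2r // lerD2l lerN2; lra.
Qed.

(** * The maximum modulus principle *)

Lemma scalar_continuousD (K : numFieldType) (f g : K -> K) (z : K) :
  {for z, continuous f} -> {for z, continuous g} ->
  {for z, continuous (fun x => f x + g x)}.
Proof. exact: continuousD. Qed.

Lemma scalar_continuousZ (K : numFieldType) (c : K) (f : K -> K) (z : K) :
  {for z, continuous f} -> {for z, continuous (fun x => c * f x)}.
Proof. by move=> cf; apply: continuousM => //; exact: cst_continuous. Qed.

Lemma scalar_differentiableD (K : numFieldType) (f g : K -> K) (z : K) :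
  differentiable f z -> differentiable g z ->
  differentiable (fun x => f x + g x) z.
Proof. exact: differentiableD. Qed.

Lemma scalar_differentiableZ (K : numFieldType) (c : K) (f : K -> K) (z : K) :
  differentiable f z -> differentiable (fun x => c * f x) z.
Proof. by move=> df; apply: differentiableM. Qed.

Lemma scalar_affine_differentiable (K : numFieldType) (c a z : K) :
  differentiable (fun x : K => c * (x - a)) z.
Proof. by apply: differentiableM => //; exact: differentiableB. Qed.

Lemma disc_max (R : realType) (L : R) (h : CK R -> R) : 0 <= L ->
  (forall z, cnorm z <= L -> forall e : R, 0 < e -> exists2 dl : R, 0 < dl &
     forall w, cnorm (w - z) < dl -> `|h w - h z| <= e) ->
  exists2 p, cnorm p <= L & forall z, cnorm z <= L -> h z <= h p.
Proof.
move=> L0 ch.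
pose emb (q : R * R) : CK R := q.1 +i* q.2.
pose A := [set q : R * R | cnorm (emb q) <= L].
have AE q : A q <-> q.1 ^+ 2 + q.2 ^+ 2 <= L ^+ 2.
  rewrite /A /= -(ler_pXn2r (n := 2)) ?nnegrE ?cnorm_ge0 //.
  by rewrite sqr_cnorm.
have cA : closed A.
  have -> : A = (fun q : R * R => q.1 ^+ 2 + q.2 ^+ 2) @^-1` [set x | x <= L ^+ 2].
    by apply/seteqP; split=> q /AE.
  apply: preimage_closed; last exact: closed_le.
  move=> q _; apply: (@cvgD _ R^o).
    by apply: (@continuous_comp _ _ _ fst (fun x : R => x ^+ 2));
      [exact: cvg_fst|exact: exprn_continuous].
  by apply: (@continuous_comp _ _ _ snd (fun x : R => x ^+ 2));
      [exact: cvg_snd|exact: exprn_continuous].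
have sA : A `<=` `[- L, L] `*` `[- L, L].
  move=> q qA; split; rewrite /= in_itv /= -ler_norml.
    exact: (le_trans (Re_le_cnorm (emb q))).
  exact: (le_trans (Im_le_cnorm (emb q))).
have kA : compact A.
  by apply: subclosed_compact cA _ sA; apply: compact_setX; exact: segment_compact.
have A0 : A !=set0.
  by exists (0, 0); apply/AE; rewrite /= !expr0n /= addr0 exprn_ge0.
have cf : {within A, continuous (h \o emb)}.
  apply: continuous_in_subspaceT => q; rewrite inE => qA.
  apply/cvgrPdist_le => e e0; have [dl dl0 H] := ch _ qA _ e0.
  have d2 : 0 < dl / 2 by rewrite divr_gt0.
  exists (ball q.1 (dl / 2), ball q.2 (dl / 2)); first by split; exact: nbhsx_ballx.
  move=> [x y] [/= hx hy]; rewrite distrC; apply: H.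
  apply: (le_lt_trans (cnorm_le_ReIm _)) => /=.
  by move: hx hy; rewrite /ball /= [`|q.1 - _|]distrC [`|q.2 - _|]distrC; lra.
have [q qA H] := compact_EVT_max A0 kA cf.
exists (emb q); first by move: qA; rewrite inE.
move=> [x y] hz; apply: (H (x, y)); by rewrite inE.
Qed.

(** If Re g exceeded B inside, the function Re g + eta |z|^2 would still have
    an interior maximum p for small eta > 0. Correcting g by the linear
    function with real part 2 eta p . (z - p) makes p a paraboloid peak. The
    points of E are isolated, and [no_paraboloid_peak] allows one of them to
    be the peak itself. *)
Lemma Re_maximum (R : realType) (L B : R) (g : CK R -> CK R) (E : seq (CK R)) :
  0 < L ->
  (forall z, cnorm z <= L -> {for z, continuous g}) ->
  (forall z, cnorm z <= L -> z \notin E -> differentiable g z) ->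
  (forall z, cnorm z = L -> complex.Re (g z) <= B) ->
  forall z, cnorm z <= L -> complex.Re (g z) <= B.
Proof.
move=> L0 cg dg bB z0 z0L; rewrite leNgt; apply/negP => Bz.
(* The paraboloid may take half of the excess of Re g(z0) over B. *)
pose eta := (complex.Re (g z0) - B) / (2 * L ^+ 2).
have L2 : 0 < L ^+ 2 by rewrite exprn_gt0.
have eta0 : 0 < eta by rewrite divr_gt0 ?mulr_gt0 //; lra.
have etaL : eta * L ^+ 2 = (complex.Re (g z0) - B) / 2.
  by rewrite /eta; field; rewrite gt_eqF.
pose h z := complex.Re (g z) + eta * cnorm z ^+ 2.
have [z zL e e0|p pL pmax] := @disc_max R L h (ltW L0).
  have e2 : 0 < e / 2 by lra.
  have [d1 d10 H1] := (cont_eps _ _).1 (cg z zL) _ e2.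
  pose d2 := e / (2 * (eta * (2 * L + 1))).
  have k0 : 0 < eta * (2 * L + 1) by rewrite mulr_gt0 //; lra.
  have d20 : 0 < d2 by rewrite divr_gt0 // mulr_gt0.
  exists (Num.min d1 (Num.min 1 d2)); first by rewrite !lt_min d10 ltr01.
  move=> w; rewrite !lt_min => /and3P[w1 w2 w3].
  have -> : h w - h z = complex.Re (g w - g z) + eta * (cnorm w ^+ 2 - cnorm z ^+ 2).
    by rewrite /h ReD ReN; ring.
  apply: (le_trans (ler_normD _ _)).
  have := le_trans (Re_le_cnorm _) (H1 w w1).
  have nwz : `|cnorm w - cnorm z| <= cnorm (w - z).
    rewrite ler_norml; have := cnormD (w - z) z; have := cnormD (z - w) w.
    by rewrite !subrK cnorm_distC => *; apply/andP; split; lra.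
  have : `|eta * (cnorm w ^+ 2 - cnorm z ^+ 2)| <= e / 2.
    rewrite normrM gtr0_norm // subr_sqr normrM.
    have wz : `|cnorm w + cnorm z| <= 2 * L + 1.
      rewrite ger0_norm ?addr_ge0 ?cnorm_ge0 //.
      by move: nwz; rewrite ler_norml => /andP[]; lra.
    have B1 : `|cnorm w - cnorm z| * `|cnorm w + cnorm z| <= d2 * (2 * L + 1).
      by apply: ler_pM => //; apply: (le_trans nwz); exact: ltW.
    apply: (le_trans (ler_wpM2l (ltW eta0) B1)).
    apply: eqW; rewrite /d2; field.
    by rewrite !gt_eqF //; lra.
  lra.
have hp : B + eta * L ^+ 2 < h p.
  apply: lt_le_trans (pmax _ z0L); rewrite /h etaL.
  by have : 0 <= eta * cnorm z0 ^+ 2 by [rewrite mulr_ge0 // ?exprn_ge0 ?cnorm_ge0 // ltW]; lra.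
have pltL : cnorm p < L.
  rewrite lt_neqAle pL andbT; apply/eqP => pE.
  have := bB _ pE; move: hp; rewrite /h pE; lra.
pose g2 (z : CK R) : CK R := g z + ((2 * eta)%:C * (p^*)%C : CK R) * (z - p).
have lin z : differentiable (fun z : CK R => ((2 * eta)%:C * (p^*)%C : CK R) * (z - p) : CK R) z.
  exact: scalar_affine_differentiable.
(* a small radius avoiding the exceptional points *)
have [r1 [r10 r1L r1E]] : exists r1 : R, [/\ 0 < r1, cnorm p + r1 <= L &
    forall z, 0 < cnorm (z - p) <= r1 -> z \notin E].
  have [r2 r20 r2E] : exists2 r2 : R, 0 < r2 &
     forall z, 0 < cnorm (z - p) <= r2 -> z \notin E.
    elim: E {dg} => [|a E [r2 r20 IH]]; first by exists 1.
    have [->|ap] := eqVneq a p.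
      exists r2 => // z hz; rewrite in_cons negb_or IH // andbT.
      by apply/eqP => zp; move: hz; rewrite zp subrr cnorm0 ltxx.
    have a0 : 0 < cnorm (a - p).
      rewrite lt_neqAle cnorm_ge0 andbT; apply/eqP => a0.
      by move: ap; rewrite -subr_eq0 (cnorm_eq0 (esym a0)) eqxx.
    exists (Num.min r2 (cnorm (a - p) / 2)); first by rewrite lt_min r20 divr_gt0.
    move=> z; rewrite le_min => /and3P[z3 z1 z2].
    rewrite in_cons negb_or IH ?z3 // andbT; apply/eqP => za.
    by move: z2; rewrite za; lra.
  exists (Num.min r2 (L - cnorm p)); split.
  - by rewrite lt_min r20; lra.
  - by rewrite -lerBrDl ge_min lexx orbT.
  - by move=> z; rewrite le_min => /and3P[z3 z1 _]; apply: r2E; rewrite z3.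
have inL z : cnorm (z - p) <= r1 -> cnorm z <= L.
  by move=> zp; have := cnormD (z - p) p; rewrite subrK; lra.
apply: (@no_paraboloid_peak R g2 p r1 eta r10 eta0).
- apply: scalar_continuousD; first exact: (cg p pL).
  exact: (differentiable_continuous (lin p)).
- move=> z /[dup] hz /andP[z1 z2]; apply: scalar_differentiableD; last exact: lin.
  by apply: dg; [exact: inL|exact: r1E].
move=> z zr; have := pmax _ (inL _ zr); rewrite /h /g2 !ReD.
rewrite subrr mulr0 -(subrK p z).
set w := z - p; rewrite addrK !sqr_cnorm.
case: (g _) => ? ?; case: (g _) => ? ?; case: w => wx wy; case: (p) => px py /=.
move=> H.
have -> : eta * (wx ^+ 2 + wy ^+ 2) = eta * ((wx + px) ^+ 2 + (wy + py) ^+ 2)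
  - eta * (px ^+ 2 + py ^+ 2) - 2 * eta * (wx * px + wy * py) by ring.
have : (2 * eta * px - 0 * - py) * wx - (2 * eta * - py + 0 * px) * wy
   = 2 * eta * (wx * px + wy * py) by ring.
lra.
Qed.

(** Multiplication by a unit turns a bound on real parts into a bound on
    moduli. *)
Lemma rotate_to_real (R : realType) (w : CK R) : cnorm w != 0 ->
  exists2 c : CK R, cnorm c = 1 & complex.Re (c * w) = cnorm w.
Proof.
move=> w0; exists ((cnorm w)^-1%:C * (w^*)%C).
  by rewrite cnormM cnorm_real ger0_norm ?invr_ge0 ?cnorm_ge0 //
     {2}/cnorm normcJ -/(cnorm w) mulVf.
transitivity ((cnorm w)^-1 * cnorm w ^+ 2); last by field.
by rewrite sqr_cnorm; case: w {w0} => x y /=; ring.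
Qed.

Lemma maximum_modulus (R : realType) (L B : R) (g : CK R -> CK R)
    (E : seq (CK R)) : 0 < L ->
  (forall z, cnorm z <= L -> {for z, continuous g}) ->
  (forall z, cnorm z <= L -> z \notin E -> differentiable g z) ->
  (forall z, cnorm z = L -> cnorm (g z) <= B) ->
  forall z, cnorm z <= L -> cnorm (g z) <= B.
Proof.
move=> L0 cg dg bB z0 z0L.
have B0 : 0 <= B.
  apply: (le_trans (cnorm_ge0 (g L%:C))); apply: bB.
  by rewrite cnorm_real gtr0_norm.
have [->//|/rotate_to_real[c c1 <-]] := eqVneq (cnorm (g z0)) 0.
apply: (@Re_maximum R L B (fun z => c * g z : CK R) E L0 _ _ _ z0 z0L).
- by move=> z zL; apply: scalar_continuousZ; exact: cg.
- by move=> z zL zE; apply: scalar_differentiableZ; exact: dg.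
- move=> z zL; apply: (le_trans (ler_norm _)); apply: (le_trans (Re_le_cnorm _)).
  by rewrite cnormM c1 mul1r bB.
Qed.

(** * Holomorphic functions with prescribed zeros *)

Definition divided (K : numFieldType) (g : K -> K) (a be x : K) : K :=
  if x == a then be else g x / (x - a).

Lemma divided_near (K : numFieldType) (g : K -> K) (a be z : K) : z != a ->
  \forall x \near z, (g x * (x - a)^-1) = divided g a be x.
Proof.
move=> za.
have c : {for z, continuous (fun x : K => x - a)}.
  by apply: differentiable_continuous; exact: differentiableB.
have z0 : z - a != 0 by rewrite subr_eq0.
near=> x; rewrite /divided ifN //.
by rewrite -subr_eq0; near: x; exact: (cvgr_neq0 (z - a)).
Unshelve. all: by end_near. Qed.

Lemma divided_continuous (K : numFieldType) (g : K -> K) (a be z : K) :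
  z != a -> {for z, continuous g} -> {for z, continuous (divided g a be)}.
Proof.
move=> za cg.
have z0 : z - a != 0 by rewrite subr_eq0.
have c : {for z, continuous (fun x : K => g x * (x - a)^-1)}.
  apply: continuousM => //.
  apply: (@continuousV _ _ (fun x : K => x - a)) => //.
  by apply: differentiable_continuous; exact: differentiableB.
have -> : {for z, continuous (divided g a be)} =
   (divided g a be x @[x --> z] --> divided g a be z) by [].
rewrite -(nbhs_singleton (divided_near g be za)).
apply: cvg_trans c.
exact: (@near_eq_cvg _ _ (nbhs z) _ _ _ (divided_near g be za)).
Qed.

Lemma divided_differentiable (K : numFieldType) (g : K -> K) (a be z : K) :
  z != a -> differentiable g z -> differentiable (divided g a be) z.
Proof.
move=> za dg.
have z0 : z - a != 0 by rewrite subr_eq0.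
apply/derivable1_diffP.
apply: (near_eq_derivable (divided_near g be za)).
apply/derivable1_diffP; apply: differentiableM => //.
by apply: differentiableV => //; exact: differentiableB.
Qed.

Lemma divided_bound (R : realType) (g : CK R -> CK R) (a be : CK R) (z : CK R) :
  g a = 0 -> cnorm (g z) = cnorm (divided g a be z) * cnorm (z - a).
Proof.
move=> ga; rewrite /divided; have [->|zna] := eqVneq z a.
  by rewrite ga subrr cnorm0 mulr0.
by rewrite -cnormM divfK // subr_eq0.
Qed.

(** The value to be given at a is the derivative of g. *)
Lemma divided_extension (R : realType) (g : CK R -> CK R) (a : CK R) :
  g a = 0 -> differentiable g a ->
  exists be, {for a, continuous (divided g a be)}.
Proof.
move=> ga /cdiff_eps[be Hbe]; exists be.
apply/cont_eps => e e0; have [dl dl0 H] := Hbe _ e0.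
exists dl => // x xa; rewrite /divided eqxx.
have [_|xna] := eqVneq x a; first by rewrite subrr cnorm0 ltW.
have x0 : x - a != 0 by rewrite subr_eq0.
have nx0 : 0 < cnorm (x - a).
  by rewrite lt_neqAle cnorm_ge0 andbT eq_sym; apply/eqP => /cnorm_eq0 /eqP; exact/negP.
have -> : g x / (x - a) - be = (g x - g a - be * (x - a)) / (x - a).
  by rewrite ga subr0 mulrBl mulfK.
by rewrite cnormM cnormV ler_pdivrMr //; exact: H.
Qed.

(** Each division by x - a removes one zero and divides the bound by the
    distance L - |a| from a to the circle. The quotient is continuous at a but
    its differentiability there is not available, so a joins the set E of
    exceptional points, which the maximum principle tolerates. *)
Lemma zeros_bound_off (R : realType) (L : R) (zs : seq (CK R)) : 0 < L ->
  forall (B : R) (g : CK R -> CK R) (E : seq (CK R)), uniq zs ->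
  (forall a, a \in zs -> [/\ cnorm a < L, a \notin E & g a = 0]) ->
  (forall z, cnorm z <= L -> {for z, continuous g}) ->
  (forall z, cnorm z <= L -> z \notin E -> differentiable g z) ->
  (forall z, cnorm z = L -> cnorm (g z) <= B) ->
  forall z, cnorm z <= L ->
  cnorm (g z) * \prod_(a <- zs) (L - cnorm a) <=
    B * \prod_(a <- zs) cnorm (z - a).
Proof.
move=> L0; elim: zs => [|a zs IH] B g E.
  move=> _ _ cg dg bB z zL; rewrite !big_nil !mulr1.
  exact: (maximum_modulus L0 cg dg bB).
move=> /= /andP[azs uzs] hz cg dg bB z zL.
have [aL aE ga] := hz a (mem_head _ _).
have [be cbe] := divided_extension ga (dg a (ltW aL) aE).
set q := divided g a be in cbe.
have La : 0 < L - cnorm a by rewrite subr_gt0.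
have zE b : b \in zs -> b != a by move=> bz; apply: contraNneq azs => <-.
have H : cnorm (q z) * \prod_(b <- zs) (L - cnorm b) <=
    B / (L - cnorm a) * \prod_(b <- zs) cnorm (z - b : CK R).
  apply: (IH _ q (a :: E) uzs _ _ _ _ z zL).
  - move=> b bz; have [bL bE gb] := hz b (mem_behead (s := a :: zs) bz).
    rewrite in_cons negb_or zE // bE /q /divided (negbTE (zE _ bz)) gb mul0r.
    by split.
  - move=> w wL; have [->|wa] := eqVneq w a; first exact: cbe.
    exact: divided_continuous (cg w wL).
  - move=> w wL; rewrite in_cons negb_or => /andP[wa wE].
    exact: (@divided_differentiable (CK R) g a be w wa (dg w wL wE)).
  - move=> w wL; have wa : L - cnorm a <= cnorm (w - a : CK R).
      by have := cnormD (w - a : CK R) a; rewrite subrK wL; lra.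
    rewrite ler_pdivlMr //; apply: le_trans (bB w wL).
    by rewrite (divided_bound be w ga) ler_wpM2l // cnorm_ge0.
rewrite !big_cons (divided_bound be z ga) -/q.
have := ler_wpM2l (mulr_ge0 (ltW La) (cnorm_ge0 (z - a : CK R))) H.
have -> : (L - cnorm a) * cnorm (z - a : CK R) * (B / (L - cnorm a) * \prod_(j <- zs) cnorm (z - j : CK R))
  = B * (cnorm (z - a : CK R) * \prod_(j <- zs) cnorm (z - j : CK R)).
  by field; rewrite gt_eqF.
by apply: le_trans; apply: eqW; ring.
Qed.

Lemma zeros_bound (R : realType) (L B : R) (zs : seq (CK R)) (g : CK R -> CK R) :
  0 < L -> uniq zs ->
  (forall a, a \in zs -> cnorm a < L /\ g a = 0) ->
  (forall z, cnorm z <= L -> differentiable g z) ->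
  (forall z, cnorm z <= L -> cnorm (g z) <= B) ->
  forall z, cnorm z <= L ->
  cnorm (g z) * \prod_(a <- zs) (L - cnorm a) <=
    B * \prod_(a <- zs) cnorm (z - a).
Proof.
move=> L0 uzs hz dg bB; apply: (zeros_bound_off L0 (E := [::]) uzs).
- by move=> a /hz[].
- by move=> z zL; apply: differentiable_continuous; exact: dg.
- by move=> z zL _; exact: dg.
- by move=> z zL; apply: bB; rewrite zL.
Qed.

Lemma cst_sub_differentiable (K : numFieldType) (W : normedModType K) (g : K -> W)
   (c : W) (t : K) : differentiable g t -> differentiable (fun t => g t - c) t.
Proof. by move=> dg; exact: differentiableB. Qed.

(** The function g - g(0) has one zero, at the origin. *)
Lemma schwarz_scalar (R : realType) (L B : R) (g : CK R -> CK R) :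
  0 < L -> (forall z, cnorm z <= L -> differentiable g z) ->
  (forall z, cnorm z <= L -> cnorm (g z) <= B) ->
  forall z, cnorm z <= L -> cnorm (g z - g 0) <= 2 * B / L * cnorm z.
Proof.
move=> L0 dg bB z zL.
have c0 : cnorm (0 : CK R) <= L by rewrite cnorm0 ltW.
have := @zeros_bound R L (2 * B) [:: 0] (fun z => g z - g 0) L0 isT _ _ _ z zL.
rewrite !big_cons !big_nil !mulr1 cnorm0 !subr0 => H.
rewrite mulrAC ler_pdivlMr //; apply: H.
- by move=> a; rewrite inE => /eqP ->; rewrite cnorm0 subrr.
- by move=> w wL; apply: (@cst_sub_differentiable (CK R) (CK R)); exact: dg.
- move=> w wL; apply: (le_trans (cnormB _ _)); have := bB w wL; have := bB 0 c0; lra.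
Qed.

(** * The Schwarz lemma for vector-valued maps *)

Lemma line_comp_differentiable (K : numFieldType) (V W : normedModType K)
    (u : V -> W) (l : W -> K) (x h : V) (z : K) :
  differentiable u (x + z *: h) -> (forall w, differentiable l w) ->
  differentiable (fun z : K => l (u (x + z *: h))) z.
Proof.
move=> du dl.
apply: (@differentiable_comp _ _ _ _ (fun z : K => u (x + z *: h)) l) => //.
apply: (@differentiable_comp _ _ _ _ (fun z : K => x + z *: h) u) => //.
Qed.

Lemma fst_differentiable (K : numFieldType) (V W : normedModType K) (x : V * W) :
  differentiable (fst : V * W -> V) x.
Proof. apply: linear_differentiable => y; exact: cvg_fst. Qed.

Lemma snd_differentiable (K : numFieldType) (V W : normedModType K) (x : V * W) :
  differentiable (snd : V * W -> W) x.
Proof. apply: linear_differentiable => y; exact: cvg_snd. Qed.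

(** Coordinate functionals that are holomorphic and compute the norm. They
    reduce statements on vector-valued maps to scalar ones, for vectors and
    for pairs of vectors at once. *)
Record coordinates (R : realType) (W : normedModType R[i]) (I : Type)
    (l : I -> W -> CK R) : Prop := Coordinates {
  coord_differentiable : forall i w, differentiable (l i) w;
  coordB : forall i x y, l i (x - y) = l i x - l i y;
  coord_le : forall i w, cnorm (l i w) <= cnorm w;
  coord_norming : forall w (B : R), 0 <= B -> (forall i, cnorm (l i w) <= B) ->
     cnorm w <= B }.

Definition rv_coord (R : realType) (d : nat) (i : 'I_d) (w : 'rV[R[i]]_d) : CK R :=
  w 0 i.

Definition pair_coord (R : realType) (d : nat) (i : bool * 'I_d)
  (w : 'rV[R[i]]_d * 'rV[R[i]]_d) : CK R :=
  if i.1 then w.1 0 i.2 else w.2 0 i.2.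

Lemma rv_coord_differentiable (K : numFieldType) (d : nat) (i : 'I_d) (w : 'rV[K]_d) :
  differentiable (fun w : 'rV[K]_d => w 0 i : K) w.
Proof. exact: differentiable_coord. Qed.

Lemma rv_norm_coord (K : numFieldType) (d : nat) (i : 'I_d) (w : 'rV[K]_d) :
  `|w 0 i| <= `|w|.
Proof.
rewrite [leRHS]/Num.norm /= mx_normE -[leLHS]nngE num_le.
exact: (le_bigmax _ (fun ij : 'I_1 * 'I_d => `|w ij.1 ij.2|%:nng) (0, i)).
Qed.

Lemma rv_norm_attained (K : numFieldType) (d : nat) (w : 'rV[K]_d) :
  `|w| = 0 \/ exists i, `|w| = `|w 0 i|.
Proof.
have [->|w0] := eqVneq `|w| 0; first by left.
by have [[i j] /= E] := mx_norm_neq0 w0; right; exists j; rewrite -(ord1 i).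
Qed.

Lemma rv_coordinates (R : realType) (d : nat) : coordinates (@rv_coord R d).
Proof.
split.
- by move=> i w; exact: rv_coord_differentiable.
- by move=> i x y; rewrite /rv_coord !mxE.
- by move=> i w; rewrite cnorm_le -normE; exact: rv_norm_coord.
- move=> w B B0 H; have [E|[i E]] := rv_norm_attained w.
    by rewrite /cnorm E.
  by apply: le_trans (H i); rewrite /cnorm E.
Qed.

Lemma cnorm_pair (R : realType) (V W : normedModType R[i]) (x : V * W) :
  cnorm x = Num.max (cnorm x.1) (cnorm x.2).
Proof.
apply: complexI; rewrite -normE prod_normE !normE /Num.max ltcR.
by case: ltP.
Qed.

Lemma pair_coord_differentiable (K : numFieldType) (d : nat) (i : bool * 'I_d)
    (w : 'rV[K]_d * 'rV[K]_d) :
  differentiable (fun w : 'rV[K]_d * 'rV[K]_d =>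
    (if i.1 then w.1 0 i.2 else w.2 0 i.2) : K) w.
Proof.
case: i => [[] i] /=.
  apply: (@differentiable_comp _ _ _ _ fst (fun w : 'rV[K]_d => w 0 i : K)).
    exact: fst_differentiable.
  exact: rv_coord_differentiable.
apply: (@differentiable_comp _ _ _ _ snd (fun w : 'rV[K]_d => w 0 i : K)).
  exact: snd_differentiable.
exact: rv_coord_differentiable.
Qed.

Lemma pair_coordinates (R : realType) (d : nat) :
  coordinates (@pair_coord R d).
Proof.
have [_ _ cl cn] := rv_coordinates R d.
split.
- by move=> i w; exact: pair_coord_differentiable.
- by move=> [[] i] x y; rewrite /pair_coord /= !mxE.
- move=> [b i] w; rewrite cnorm_pair le_max /pair_coord /=.
  by case: b; [rewrite (cl i w.1)|rewrite (cl i w.2) orbT].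
- move=> w B B0 H; rewrite cnorm_pair ge_max; apply/andP; split; apply: cn => //.
    by move=> i; exact: (H (true, i)).
  by move=> i; exact: (H (false, i)).
Qed.

(** Restriction to the complex line through x and y, parametrized so that y -
    x has parameter 1, gives a scalar function on the disc of radius dl / |y -
    x|. *)
Lemma schwarz (R : realType) (V W : normedModType R[i]) (I : Type)
    (l : I -> W -> CK R) (u : V -> W) (x : V) (dl B : R) :
  coordinates l -> 0 < dl ->
  (forall z, cnorm (z - x) <= dl -> differentiable u z) ->
  (forall z, cnorm (z - x) <= dl -> cnorm (u z) <= B) ->
  forall y, cnorm (y - x) <= dl ->
  cnorm (u y - u x) <= 2 * B / dl * cnorm (y - x).
Proof.
move=> [ld lB ll ln] dl0 du uB y yx.
have B0 : 0 <= B.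
  apply: (le_trans (cnorm_ge0 (u x))); apply: uB.
  by rewrite subrr cnorm0 ltW.
have C0 : 0 <= 2 * B / dl by rewrite divr_ge0 ?mulr_ge0 // ltW.
apply: ln => [|i]; first by rewrite mulr_ge0 // cnorm_ge0.
have [E|n0] := eqVneq (cnorm (y - x)) 0.
  have -> : y = x by apply/eqP; rewrite -subr_eq0; apply/eqP; exact: cnorm_eq0.
  by rewrite lB !subrr !cnorm0 mulr0.
have {}n0 : 0 < cnorm (y - x) by rewrite lt_neqAle cnorm_ge0 eq_sym n0.
pose h := y - x; pose L := dl / cnorm h.
have L0 : 0 < L by rewrite divr_gt0.
have inb (z : CK R) : cnorm z <= L -> cnorm (x + z *: h - x) <= dl.
  by move=> zL; rewrite addrC addKr cnormZ -ler_pdivlMr.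
have := @schwarz_scalar R L B (fun z : CK R => l i (u (x + z *: h))) L0 _ _ 1.
rewrite cnorm1 scale1r scale0r addr0 /h subrKC lB mulr1.
have -> : 2 * B / L = 2 * B / dl * cnorm (y - x).
  by rewrite /L /h; field; rewrite !gt_eqF.
apply.
- move=> z zL; apply: (@line_comp_differentiable (CK R) V W u (l i) x h z).
    by apply: du; exact: inb.
  by move=> w; exact: ld.
- by move=> z zL; apply: (le_trans (ll i _)); apply: uB; exact: inb.
- by rewrite ler_pdivlMr // mul1r.
Qed.

(** * Finite differences and interpolation of orbits *)

(** The k-th forward difference at 0 of the orbit n |-> f^n x. *)
Fixpoint fdiff (V : zmodType) (f : V -> V) (k : nat) (x : V) : V :=
  if k is k'.+1 then fdiff f k' (f x) - fdiff f k' x else x.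

(** The polynomial t (t - 1) ... (t - k + 1) / k!. *)
Fixpoint binom (K : numFieldType) (k : nat) (t : K) : K :=
  if k is k'.+1 then binom k' t * (t - k'%:R) / k%:R else 1.

(** The polynomial in t of degree m through x, f x, ..., f^m x at t = 0, 1,
    ..., m. *)
Definition newton (K : numFieldType) (V : lmodType K) (f : V -> V) (m : nat)
  (x : V) (t : K) : V := \sum_(k < m.+1) binom k t *: fdiff f k x.

Lemma binom_nat (K : numFieldType) (k n : nat) :
  binom k (n%:R : K) = ('C(n, k))%:R.
Proof.
elim: k => [|k IH] /=; first by rewrite bin0.
rewrite IH; have k0 : (k.+1%:R : K) != 0 by rewrite pnatr_eq0.
apply: (mulIf k0); rewrite mulfVK // -natrM mulnC mul_bin_left.
have [kn|nk] := leqP k n; first by rewrite natrM natrB // mulrC.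
by rewrite bin_small // muln0 mul0r.
Qed.

Lemma iter_fdiff (V : zmodType) (f : V -> V) (n : nat) (x : V) :
  iter n f x = \sum_(k < n.+1) fdiff f k x *+ 'C(n, k).
Proof.
elim: n x => [|n IH] x; first by rewrite big_ord1 bin0 mulr1n.
rewrite iterSr IH.
under eq_bigr => k _ do
  rewrite -[fdiff f k (f x)](subrK (fdiff f k x)) mulrnDl -/(fdiff f k.+1 x).
rewrite big_split /= [RHS]big_ord_recl /= bin0 mulr1n.
under [in RHS]eq_bigr => k _ do rewrite /bump /= add1n binS mulrnDr.
rewrite big_split /= [in RHS]addrA [RHS]addrC; congr (_ + _).
rewrite big_ord_recl /= bin0 mulr1n; congr (_ + _).
rewrite [RHS]big_ord_recr /= bin_small // mulr0n addr0.
by apply: eq_bigr => k _; rewrite /bump /= add1n.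
Qed.

Lemma newton_interpolates (K : numFieldType) (V : lmodType K) (f : V -> V)
    (m n : nat) (x : V) : (n <= m)%N -> newton f m x n%:R = iter n f x.
Proof.
move=> nm; rewrite iter_fdiff /newton.
under eq_bigr => k _ do rewrite binom_nat scaler_nat.
rewrite -!(big_mkord xpredT (fun k => fdiff f k x *+ 'C(n, k))).
rewrite [LHS](@big_cat_nat _ _ _ n.+1) //= -[RHS]addr0; congr (_ + _).
rewrite big_nat_cond big1 // => k; rewrite andbT => /andP[nk _].
by rewrite bin_small ?mulr0n.
Qed.

Lemma binom_differentiable (K : numFieldType) (k : nat) (t : K) :
  differentiable (fun t : K => binom k t) t.
Proof.
elim: k => [|k IH] /=; first exact: differentiable_cst.
apply: differentiableM; last exact: differentiable_cst.
by apply: differentiableM => //; exact: differentiableB.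
Qed.

Lemma newton_differentiable (K : numFieldType) (V : normedModType K)
    (f : V -> V) (m : nat) (x : V) (t : K) :
  differentiable (fun t : K => newton f m x t) t.
Proof.
have -> : (fun t : K => newton f m x t) =
   \sum_(k < m.+1) (fun t : K => binom k t *: fdiff f k x).
  by apply/funext => s; rewrite fct_sumE.
apply: differentiable_sum => k; apply: differentiableZl.
exact: binom_differentiable.
Qed.

Lemma newton0 (K : numFieldType) (V : lmodType K) (f : V -> V) (m : nat) (x : V) :
  newton f m x 0 = x.
Proof. exact: (@newton_interpolates K V f m 0 x). Qed.

Section near_identity.
Variables (R : realType) (V : normedModType R[i]) (I : Type) (l : I -> V -> CK R).
Hypothesis (cl : coordinates l).
Variables (f : V -> V) (x0 : V) (dl eta : R).
Hypotheses (dl0 : 0 < dl) (eta0 : 0 < eta).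
Hypothesis (fd : forall z, cnorm (z - x0) <= dl ->
  differentiable f z /\ cnorm (f z - z) <= eta).

(** One more difference is the increment of the previous one over a
    displacement of size eta. On balls whose radii decrease by dl / (k + 1) at
    each order, the Schwarz lemma turns it into a factor 2 eta (k + 1) / dl. *)
Lemma fdiff_ball_bound (k : nat) : k.+1%:R * eta <= dl ->
  forall j, (j <= k)%N -> forall x, cnorm (x - x0) <= dl * (1 - j%:R / k.+1%:R) ->
    differentiable (fdiff f j.+1) x /\
    cnorm (fdiff f j.+1 x) <= eta * (2 * eta * k.+1%:R / dl) ^+ j.
Proof.
move=> keta.
have K0 : 0 < k.+1%:R :> R by rewrite ltr0n.
pose del := dl / k.+1%:R.
have del0 : 0 < del by rewrite divr_gt0.
have etadel : eta <= del by rewrite ler_pdivlMr // mulrC.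
elim=> [|j IH] jk x xb.
  have [fx nx] := fd (le_trans xb (ltac:(by rewrite mul0r subr0 mulr1))).
  split; last by rewrite expr0 mulr1.
  exact: differentiableB.
have E : dl * (1 - j%:R / k.+1%:R) = dl * (1 - j.+1%:R / k.+1%:R) + del.
  by rewrite /del -[j.+1]addn1 natrD; field; rewrite gt_eqF.
have near z : cnorm (z - x) <= del -> cnorm (z - x0) <= dl * (1 - j%:R / k.+1%:R).
  move=> zx; rewrite E; apply: (le_trans (cnorm_tri x _ _)).
  by rewrite addrC lerD.
have xx : cnorm (x - x) <= del by rewrite subrr cnorm0 ltW.
have xd : cnorm (x - x0) <= dl.
  apply: (le_trans (near x xx)); apply: ler_piMr; first exact: ltW.
  by rewrite gerBl divr_ge0.
have [dfx nfx] := fd xd.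
have fxd := le_trans nfx etadel.
have IHj := IH (ltnW jk).
split.
  apply: differentiableB; last exact: (IHj x (near x xx)).1.
  apply: (@differentiable_comp _ _ _ _ f (fdiff f j.+1)) => //.
  exact: (IHj _ (near _ fxd)).1.
have := @schwarz R V V I l (fdiff f j.+1) x del
   (eta * (2 * eta * k.+1%:R / dl) ^+ j) cl del0
   (fun z hz => (IHj z (near z hz)).1) (fun z hz => (IHj z (near z hz)).2) (f x) fxd.
move=> /le_trans; apply.
have B0 : 0 <= 2 * (eta * (2 * eta * k.+1%:R / dl) ^+ j) / del.
  rewrite divr_ge0 ?(ltW del0) // mulr_ge0 // mulr_ge0 ?(ltW eta0) //.
  by rewrite exprn_ge0 // divr_ge0 ?(ltW dl0) // !mulr_ge0 // ltW.
apply: (le_trans (ler_wpM2l B0 nfx)).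
rewrite exprS; apply: eqW.
by rewrite /del; field; rewrite !gt_eqF.
Qed.

Lemma fdiff_bound (k : nat) : k.+1%:R * eta <= dl ->
  cnorm (fdiff f k.+1 x0) <= eta * (2 * eta * k.+1%:R / dl) ^+ k.
Proof.
move=> keta; apply: (fdiff_ball_bound keta (leqnn k) _).2.
rewrite subrr cnorm0 mulr_ge0 ?(ltW dl0) // subr_ge0 ler_pdivrMr ?ltr0n //.
by rewrite mul1r ler_nat.
Qed.

End near_identity.

(** The term of order k + 1 in the series of exp(k + 1). *)
Lemma nat_pow_le_fact (R : realType) (k : nat) :
  k.+1%:R ^+ k.+1 <= expR 1 ^+ k.+1 * (k.+1)`!%:R :> R.
Proof.
have := @expR_ge1Dxn R k.+1%:R k (ler0n _ _).
rewrite -[expR k.+1%:R](_ : expR 1 ^+ k.+1 = _); last by rewrite -expRM_natl mulr1.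
have F0 : 0 < (k.+1)`!%:R :> R by rewrite ltr0n fact_gt0.
move=> h; rewrite -ler_pdivrMr //; apply: le_trans h.
by rewrite lerDr.
Qed.

Lemma cnorm_nat (R : realType) (n : nat) : cnorm (n%:R : CK R) = n%:R.
Proof. by rewrite -(rmorph_nat (real_complex R)) cnorm_real ger0_norm. Qed.

Lemma binom_bound (R : realType) (k m : nat) (t : CK R) :
  (k <= m)%N -> cnorm t <= 4 * m%:R ->
  cnorm (binom k t) <= (5 * m%:R) ^+ k / k`!%:R.
Proof.
move=> km tm; elim: k km => [|k IH] km /=.
  by rewrite cnorm1 expr0 fact0 divr1.
rewrite !cnormM cnormV cnorm_nat exprS factS natrM invfM.
have -> : 5 * m%:R * (5 * m%:R) ^+ k * (k.+1%:R^-1 * k`!%:R^-1) =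
   (5 * m%:R) ^+ k / k`!%:R * (5 * m%:R) * k.+1%:R^-1 :> R by ring.
rewrite ler_wpM2r ?invr_ge0 // ler_pM ?cnorm_ge0 ?IH ?(ltnW km) //.
apply: (le_trans (cnormB _ _)); rewrite cnorm_nat.
have : k%:R <= m%:R :> R by rewrite ler_nat ltnW.
lra.
Qed.

(** * Interpolation of a map close to the identity *)

Lemma cnorm_sum (R : realType) (V : normedModType R[i]) (n : nat) (F : 'I_n -> V) :
  cnorm (\sum_i F i) <= \sum_i cnorm (F i).
Proof.
elim/big_ind2: _ => // [|x a y b xa yb]; first by rewrite cnorm0.
exact: (le_trans (cnormD _ _) (lerD xa yb)).
Qed.

Lemma geometric_half (R : realType) (n : nat) :
  \sum_(j < n) (2 : R)^-1 ^+ j <= 2.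
Proof.
suff -> : \sum_(j < n) (2 : R)^-1 ^+ j = 2 - 2 * 2^-1 ^+ n.
  by rewrite gerBl mulr_ge0 // exprn_ge0 // invr_ge0.
elim: n => [|n IH]; first by rewrite big_ord0 expr0; ring.
by rewrite big_ord_recr /= IH exprS; field.
Qed.

Lemma prod_const_size (R : realType) (T : Type) (s : seq T) (c : R) :
  \prod_(a <- s) c = c ^+ size s.
Proof. by elim: s => [|a s IH]; rewrite ?big_nil ?expr0 // big_cons IH exprS. Qed.

Lemma expR1_ge1 (R : realType) : 1 <= expR 1 :> R.
Proof. by rewrite -expR0 ler_expR. Qed.

Lemma newton_recl (K : numFieldType) (V : lmodType K) (f : V -> V) (m : nat)
    (x : V) (t : K) :
  newton f m x t = x + \sum_(j < m) binom j.+1 t *: fdiff f j.+1 x.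
Proof. by rewrite /newton big_ord_recl scale1r. Qed.

Section near_identity.
Variables (R : realType) (V : normedModType R[i]) (I : Type) (l : I -> V -> CK R).
Hypothesis (cl : coordinates l).
Variables (f : V -> V) (m : nat) (dl eta : R).
Hypotheses (dl0 : 0 < dl) (eta0 : 0 < eta) (m1 : (4 <= m)%N).
Hypothesis (small : 20 * expR 1 * m%:R * eta <= dl).

Let e := expR 1 : R.
Let e1 : 1 <= e := expR1_ge1 R.
Let m4 : 4 <= m%:R :> R. Proof. by rewrite ler_nat. Qed.

Lemma step_le_radius : 20 * eta <= dl.
Proof.
apply: le_trans small; rewrite ler_pM2r //.
have : 1 * 1 <= expR 1 * m%:R :> R.
  by apply: ler_pM => //; have := m4; lra.
lra.
Qed.

(** The growth k^k of the differences is absorbed by the factorials in the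
    binomials, at the price of e^k. The assumption 20 e m eta <= dl makes the
    ratio of consecutive terms at most 1/2 on the whole disc of radius 4m. *)
Lemma newton_bound (x0 : V) (t : CK R) :
  (forall z, cnorm (z - x0) <= dl -> differentiable f z /\ cnorm (f z - z) <= eta) ->
  cnorm t <= 4 * m%:R ->
  cnorm (newton f m x0 t - x0) <= 10 * expR 1 * m%:R * eta.
Proof.
move=> fd tm; rewrite newton_recl addrC addKr.
have A0 : 0 <= 5 * e * m%:R * eta by rewrite !mulr_ge0 ?(ltW eta0) // expR_ge0.
apply: (le_trans (cnorm_sum _)).
apply: (@le_trans _ _ (\sum_(j < m) 5 * e * m%:R * eta * 2^-1 ^+ j)); last first.
  rewrite -mulr_sumr; have := ler_wpM2l A0 (geometric_half R m); rewrite /e; lra.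
apply: ler_sum => j _; rewrite cnormZ.
have jm : (j.+1 <= m)%N by exact: ltn_ord.
have keta : j.+1%:R * eta <= dl.
  apply: le_trans small; rewrite ler_pM2r //.
  have : j.+1%:R <= m%:R :> R by rewrite ler_nat.
  have : 1 * m%:R <= e * m%:R by rewrite ler_wpM2r.
  by have := m4; rewrite /e; lra.
have F0 : 0 < j.+1`!%:R :> R by rewrite ltr0n fact_gt0.
have C0 : 0 <= (5 * m%:R) ^+ j.+1 / j.+1`!%:R :> R.
  by rewrite divr_ge0 ?(ltW F0) // exprn_ge0 // mulr_ge0.
have D0 : 0 <= eta * (2 * eta * j.+1%:R / dl) ^+ j.
  by rewrite mulr_ge0 ?(ltW eta0) // exprn_ge0 // divr_ge0 ?(ltW dl0) // !mulr_ge0 // ltW.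
apply: (le_trans (ler_pM (cnorm_ge0 _) (cnorm_ge0 _)
  (binom_bound jm tm) (fdiff_bound cl dl0 eta0 fd keta))).
have P : j.+1%:R ^+ j <= e ^+ j.+1 * j.+1`!%:R :> R.
  apply: le_trans (nat_pow_le_fact R j).
  by rewrite exprSr ler_peMr ?exprn_ge0 // ler1n.
have Q0 : 0 <= (5 * m%:R) ^+ j.+1 / j.+1`!%:R * eta * (2 * eta / dl) ^+ j.
  by rewrite mulr_ge0 ?mulr_ge0 ?(ltW eta0) // exprn_ge0 // divr_ge0 ?(ltW dl0) // mulr_ge0 // ltW.
have -> : (5 * m%:R) ^+ j.+1 / j.+1`!%:R * (eta * (2 * eta * j.+1%:R / dl) ^+ j) =
   (5 * m%:R) ^+ j.+1 / j.+1`!%:R * eta * (2 * eta / dl) ^+ j * j.+1%:R ^+ j.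
  have -> : 2 * eta * j.+1%:R / dl = (2 * eta / dl) * j.+1%:R by ring.
  by rewrite [(_ * j.+1%:R) ^+ j]exprMn !mulrA.
apply: (le_trans (ler_wpM2l Q0 P)).
have -> : (5 * m%:R) ^+ j.+1 / j.+1`!%:R * eta * (2 * eta / dl) ^+ j *
    (e ^+ j.+1 * j.+1`!%:R) =
  5 * e * m%:R * eta * ((5 * m%:R) * e * (2 * eta / dl)) ^+ j.
  set a := 5 * m%:R; set b := 2 * eta / dl; set F := j.+1`!%:R.
  have -> : 5 * e * m%:R * eta = a * e * eta by rewrite /a; ring.
  rewrite [(a * e * b) ^+ j]exprMn [(a * e) ^+ j]exprMn !exprS; field.
  by rewrite gt_eqF.
rewrite ler_wpM2l // lerXn2r ?nnegrE ?invr_ge0 //.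
  by rewrite !mulr_ge0 ?expR_ge0 ?invr_ge0 ?(ltW eta0) ?(ltW dl0).
rewrite -(ler_pM2r dl0).
have -> : 5 * m%:R * e * (2 * eta / dl) * dl = 10 * e * m%:R * eta.
  by field; rewrite gt_eqF.
by move: small; rewrite -/e; lra.
Qed.

Lemma newton_bound_half (x0 : V) (t : CK R) :
  (forall z, cnorm (z - x0) <= dl -> differentiable f z /\ cnorm (f z - z) <= eta) ->
  cnorm t <= 4 * m%:R -> cnorm (newton f m x0 t - x0) <= dl / 2.
Proof. by move=> fd tm; apply: (le_trans (newton_bound fd tm)); have := small; lra. Qed.

(** The Schwarz lemma on the disc of radius 4m replaces the factor m by |t|. *)
Lemma newton_small (x0 : V) (t : CK R) :
  (forall z, cnorm (z - x0) <= dl -> differentiable f z /\ cnorm (f z - z) <= eta) ->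
  cnorm t <= 4 * m%:R ->
  cnorm (newton f m x0 t - x0) <= 5 * expR 1 * eta * cnorm t.
Proof.
move=> fd tm.
have L0 : 0 < 4 * m%:R :> R by have := m4; lra.
have := @schwarz R _ V I l (fun t : CK R => newton f m x0 t - x0 : V) 0 (4 * m%:R)
  (10 * expR 1 * m%:R * eta) cl L0 _ _ t.
rewrite subr0 newton0 subrr subr0 => H.
have -> : 5 * expR 1 * eta = 2 * (10 * expR 1 * m%:R * eta) / (4 * m%:R).
  by field; rewrite gt_eqF //; lra.
apply: H => // z.
  by move=> _; apply: (@cst_sub_differentiable (CK R)); exact: newton_differentiable.
by rewrite subr0; exact: newton_bound.
Qed.

Lemma newton_lipschitz (x0 : V) (t s : CK R) :
  (forall z, cnorm (z - x0) <= dl -> differentiable f z /\ cnorm (f z - z) <= eta) ->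
  cnorm t <= 1 -> cnorm (s - t) <= 1 ->
  cnorm (newton f m x0 s - newton f m x0 t) <= 20 * expR 1 * eta * cnorm (s - t).
Proof.
move=> fd t1 st.
have := @schwarz R _ V I l (fun t : CK R => newton f m x0 t - x0 : V) t 1
  (10 * expR 1 * eta) cl ltr01 _ _ s st.
rewrite opprB addrA subrK divr1 => H.
have -> : 20 * expR 1 * eta = 2 * (10 * expR 1 * eta) by ring.
apply: H => // z.
  by move=> _; apply: (@cst_sub_differentiable (CK R)); exact: newton_differentiable.
move=> zt; have z2 : cnorm z <= 2.
  by rewrite -[z](subrK t); apply: (le_trans (cnormD _ _)); lra.
apply: (le_trans (newton_small fd _)); first by have := m4; lra.
have -> : 10 * expR 1 * eta = 5 * expR 1 * eta * 2 by ring.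
by rewrite ler_wpM2l // !mulr_ge0 ?expR_ge0 ?ltW.
Qed.

Section defect.
Variable x0 : V.
Hypothesis (fd : forall z, cnorm (z - x0) <= 2 * dl ->
  differentiable f z /\ cnorm (f z - z) <= eta).

Let fd0 z : cnorm (z - x0) <= dl -> differentiable f z /\ cnorm (f z - z) <= eta.
Proof. by move=> h; apply: fd; have := dl0; lra. Qed.

Let fd1 z : cnorm (z - f x0) <= dl -> differentiable f z /\ cnorm (f z - z) <= eta.
Proof.
move=> h; apply: fd; apply: (le_trans (cnorm_tri (f x0) _ _)).
have := (fd0 (z := x0)); rewrite subrr cnorm0 => /(_ (ltW dl0)) [_].
have := step_le_radius; have := dl0; have := eta0; lra.
Qed.

(** How far the interpolation is from commuting with f. *)
Definition defect (t : CK R) : V := f (newton f m x0 t) - newton f m (f x0) t.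

Lemma defect_differentiable (t : CK R) : cnorm t <= 4 * m%:R ->
  differentiable defect t.
Proof.
move=> tm; apply: differentiableB; last exact: newton_differentiable.
apply: (@differentiable_comp _ _ _ _ (fun t : CK R => newton f m x0 t) f).
  exact: newton_differentiable.
by apply: (fd0 _).1; apply: (le_trans (newton_bound_half fd0 tm)); have := dl0; lra.
Qed.

Lemma defect_bound (t : CK R) : cnorm t <= 4 * m%:R -> cnorm (defect t) <= 2 * dl.
Proof.
move=> tm; have P := newton_bound_half fd0 tm; have Q := newton_bound_half fd1 tm.
have := (fd0 (z := x0)); rewrite subrr cnorm0 => /(_ (ltW dl0)) [_ h0].
have [|_ h1] := fd0 (z := newton f m x0 t); first by have := dl0; lra.
have h2 := step_le_radius; have h3 := dl0; have h4 := eta0.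
rewrite /defect; apply: (le_trans (cnorm_tri (newton f m x0 t) _ _)).
have := cnorm_tri x0 (newton f m x0 t) (newton f m (f x0) t).
have := cnorm_tri (f x0) x0 (newton f m (f x0) t).
rewrite [cnorm (f x0 - newton _ _ _ _)]cnorm_distC [cnorm (x0 - f x0)]cnorm_distC.
lra.
Qed.

Lemma defect_zero (j : nat) : (j <= m)%N -> defect j%:R = 0.
Proof.
by move=> jm; rewrite /defect !newton_interpolates // -iterSr iterS subrr.
Qed.

(** The defect vanishes at the m + 1 points 0, ..., m because both curves
    interpolate the same orbit there. Seen from the disc of radius 2, each
    zero contributes a factor at most (m + 2) / (3m) <= 1/2 to the bound on
    the disc of radius 4m. *)
Lemma defect_small (t : CK R) : cnorm t <= 2 ->
  cnorm (defect t) <= 2 * dl * 2^-1 ^+ m.+1.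
Proof.
move=> t2; have [ld lB ll ln] := cl.
apply: ln => [|i]; first by rewrite !mulr_ge0 ?(ltW dl0) // exprn_ge0 // invr_ge0.
have L0 : 0 < 4 * m%:R :> R by have := m4; lra.
(* The interpolation nodes, as zeros of each coordinate of the defect. *)
pose zs := [seq j%:R : CK R | j <- iota 0 m.+1].
have := @zeros_bound R (4 * m%:R) (2 * dl) zs (fun t => l i (defect t)) L0 _ _ _ _ t _.
have uzs : uniq zs.
  by rewrite map_inj_uniq ?iota_uniq // => a b /eqP; rewrite eqr_nat => /eqP.
have hz a : a \in zs -> cnorm a < 4 * m%:R /\ l i (defect a) = 0.
  move=> /mapP[j]; rewrite mem_iota add0n ltnS => /andP[_ jm] ->.
  rewrite cnorm_nat; split.
    by have : j%:R <= m%:R :> R; [rewrite ler_nat|have := m4; lra].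
  by rewrite defect_zero // -(subrr 0) lB subrr.
have dg z : cnorm z <= 4 * m%:R -> differentiable (fun t => l i (defect t) : CK R) z.
  move=> zL; apply: (@differentiable_comp _ _ _ _ defect (l i)); last exact: ld.
  exact: defect_differentiable.
have bg z : cnorm z <= 4 * m%:R -> cnorm (l i (defect z) : CK R) <= 2 * dl.
  by move=> zL; apply: (le_trans (ll _ _)); exact: defect_bound.
have t4 : cnorm t <= 4 * m%:R by have := m4; lra.
move=> /(_ uzs hz dg bg t4) H.
have size_zs : size zs = m.+1 by rewrite size_map size_iota.
have low : (3 * m%:R) ^+ m.+1 <= \prod_(a <- zs) (4 * m%:R - cnorm a).
  rewrite -{1}size_zs -prod_const_size big_seq [leRHS]big_seq.
  apply: ler_prod => a /mapP[j]; rewrite mem_iota add0n ltnS => /andP[_ jm] ->.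
  rewrite cnorm_nat; have : j%:R <= m%:R :> R by rewrite ler_nat.
  by have := m4; lra.
have up : \prod_(a <- zs) cnorm (t - a) <= (m%:R + 2) ^+ m.+1.
  rewrite -{1}size_zs -prod_const_size big_seq [leRHS]big_seq.
  apply: ler_prod => a /mapP[j]; rewrite mem_iota add0n ltnS => /andP[_ jm] ->.
  rewrite cnorm_ge0 /=; apply: (le_trans (cnormB _ _)); rewrite cnorm_nat.
  have : j%:R <= m%:R :> R by rewrite ler_nat.
  by have := m4; lra.
have T0 : 0 < (3 * m%:R) ^+ m.+1 :> R by rewrite exprn_gt0 //; have := m4; lra.
rewrite -(ler_pM2r T0).
apply: (le_trans (ler_wpM2l (cnorm_ge0 _) low)); apply: (le_trans H).
apply: (@le_trans _ _ (2 * dl * (m%:R + 2) ^+ m.+1)).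
  by rewrite ler_wpM2l // mulr_ge0 // ltW.
have -> : 2 * dl * 2^-1 ^+ m.+1 * (3 * m%:R) ^+ m.+1 =
   2 * dl * (2^-1 * (3 * m%:R)) ^+ m.+1 by rewrite [(2^-1 * _) ^+ _]exprMn mulrA.
rewrite ler_wpM2l ?mulr_ge0 ?(ltW dl0) //.
by rewrite lerXn2r ?nnegrE; have := m4; lra.
Qed.

Lemma defect_lipschitz (t s : CK R) : cnorm t <= 1 -> cnorm (s - t) <= 1 ->
  cnorm (defect s - defect t) <= 2 * dl * 2^-1 ^+ m * cnorm (s - t).
Proof.
move=> t1 st.
have b z : cnorm (z - t) <= 1 -> cnorm z <= 2.
  by move=> zt; rewrite -[z](subrK t); apply: (le_trans (cnormD _ _)); lra.
have := @schwarz R _ V I l defect t 1 (2 * dl * 2^-1 ^+ m.+1) cl ltr01 _ _ s st.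
have -> : 2 * (2 * dl * 2^-1 ^+ m.+1) / 1 = 2 * dl * 2^-1 ^+ m :> R.
  by rewrite exprS; field.
apply=> z /b z2; [apply: defect_differentiable; have := m4; lra|exact: defect_small].
Qed.

End defect.

End near_identity.

(** * Curves of class C1 and a step function *)

Definition C1 (R : realType) (V : normedModType R) (c : R -> V) : Prop :=
  (forall t, derivable c t 1) /\ continuous (derive1 c).

Lemma derivable_continuous (R : realType) (V : normedModType R) (c : R -> V) (t : R) :
  derivable c t 1 -> {for t, continuous c}.
Proof. by move=> /derivable1_diffP; exact: differentiable_continuous. Qed.

Lemma is_derive_linear (R : realType) (V W : normedModType R)
    (L : {linear V -> W}) (c : R -> V) (t : R) : continuous L ->
  derivable c t 1 -> is_derive t 1 (fun s => L (c s)) (L (derive1 c t)).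
Proof.
move=> cL /derivable1_diffP dc.
have dL : differentiable L (c t) by exact: linear_differentiable.
have d : differentiable (L \o c) t by exact: differentiable_comp.
apply: DeriveDef; first exact: diff_derivable.
by rewrite -derive1E derive1E' // diff_comp //= diff_lin // derive1E'.
Qed.

Lemma is_derive_comp (R : realType) (V : normedModType R) (c : R -> V)
    (th : R -> R) (t th' : R) :
  is_derive t 1 th th' -> derivable c (th t) 1 ->
  is_derive t 1 (fun s => c (th s)) (th' *: derive1 c (th t)).
Proof.
move=> dth /derivable1_diffP dc.
have dt : differentiable th t by apply/derivable1_diffP.
have d : differentiable (c \o th) t by exact: differentiable_comp.
apply: DeriveDef; first exact: diff_derivable.
rewrite -derive1E derive1E' // diff_comp //=.
rewrite [RHS](_ : _ = 'd c (th t) (th' *: 1)); last by rewrite linearZ /= -derive1E'.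
congr ('d c (th t) _).
by rewrite -derive1E' // derive1E derive_val /GRing.scale /= mulr1.
Qed.

Lemma C1_is_derive (R : realType) (V : normedModType R) (c c' : R -> V) :
  (forall t : R, is_derive t 1 c (c' t)) -> continuous c' -> C1 c /\ derive1 c = c'.
Proof.
move=> dc cc; have E : derive1 c = c'.
  by apply/funext => t; rewrite derive1E derive_val.
by split=> //; split; [move=> t; exact: ex_derive|rewrite E].
Qed.

Lemma is_derive_C1 (R : realType) (V : normedModType R) (c : R -> V) (t : R) :
  C1 c -> is_derive t 1 c (derive1 c t).
Proof. by move=> [dc _]; rewrite derive1E; exact: derivableP. Qed.

Lemma C1_comp (R : realType) (V : normedModType R) (c : R -> V) (th th' : R -> R) :
  (forall t : R, is_derive t 1 th (th' t)) -> continuous th' -> C1 c ->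
  C1 (fun t => c (th t)) /\
  derive1 (fun t => c (th t)) = fun t => th' t *: derive1 c (th t).
Proof.
move=> dth cth [dc cc]; apply: C1_is_derive => [t|t].
  exact: is_derive_comp.
apply: cvgZ; first exact: cth.
apply: (@continuous_comp _ _ _ th (derive1 c)); last exact: cc.
by apply: derivable_continuous; exact: ex_derive.
Qed.

Lemma C1D (R : realType) (V : normedModType R) (c e : R -> V) :
  C1 c -> C1 e -> C1 (fun t => c t + e t) /\
  derive1 (fun t => c t + e t) = fun t => derive1 c t + derive1 e t.
Proof.
move=> hc he; apply: C1_is_derive => [t|t].
  by apply: is_deriveD; exact: is_derive_C1.
by apply: cvgD; [exact: hc.2|exact: he.2].
Qed.

Lemma C1N (R : realType) (V : normedModType R) (u : R -> V) : C1 u ->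
  C1 (fun t => - u t) /\ derive1 (fun t => - u t) = fun t => - derive1 u t.
Proof.
move=> hu; apply: C1_is_derive => s; last by apply: cvgN; exact: hu.2.
by apply: is_deriveN; exact: is_derive_C1.
Qed.

Lemma C1_cst (R : realType) (V : normedModType R) (v : V) :
  C1 (fun _ : R => v) /\ derive1 (fun _ : R => v) = fun=> 0.
Proof.
by apply: C1_is_derive => t; first [exact: is_derive_cst | exact: cvg_cst].
Qed.

(** The square makes the derivative of the positive part continuous. *)
Definition ramp (R : realType) (t : R) : R := Num.max t 0 ^+ 2.

Lemma eps_is_derive (R : realType) (f : R -> R) (x l : R) :
  (forall e : R, 0 < e -> exists2 dl : R, 0 < dl & forall y, `|y - x| < dl ->
     `|f y - f x - l * (y - x)| <= e * `|y - x|) -> is_derive x 1 f l.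
Proof.
move=> H.
have lim : h^-1 *: (f (h *: 1 + x) - f x) @[h --> 0^'] --> l.
  apply/cvgrPdist_le => e /H[dl dl0 K].
  apply/nbhs_normP; exists dl => // h /=; rewrite sub0r normrN => hd h0.
  have := K (h + x); rewrite addrK => /(_ hd) {}K.
  rewrite [h *: 1]mulr1 distrC -(ler_pM2r (x := `|h|)) ?normr_gt0 // -normrM.
  rewrite (_ : (_ - l) * h = f (h + x) - f x - l * h) //.
  by rewrite /GRing.scale /=; field.
apply: DeriveDef; first by apply/cvg_ex; exists l.
exact: cvg_lim.
Qed.

Lemma ramp_is_derive (R : realType) (x : R) :
  is_derive x 1 (@ramp R) (2 * Num.max x 0).
Proof.
apply: eps_is_derive => e e0; exists e => // y hy.
apply: (@le_trans _ _ (`|y - x| * `|y - x|)); last by rewrite ler_wpM2r // ltW.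
rewrite -normrM -expr2 [leRHS]ger0_norm ?sqr_ge0 // /ramp ler_norml.
have sy := sqr_ge0 y; have sx := sqr_ge0 x; have syx := sqr_ge0 (y - x).
have E : (y - x) ^+ 2 = y ^+ 2 - 2 * (x * y) + x ^+ 2 by ring.
case: (leP y 0) => y0; case: (leP x 0) => x0.
- by rewrite expr0n /=; lra.
- have : x * y <= 0 by rewrite mulr_ge0_le0 // ltW.
  by rewrite expr0n /=; nra.
- have : x * y <= 0 by rewrite mulr_le0_ge0 // ltW.
  by rewrite expr0n /=; nra.
- by apply/andP; split; nra.
Qed.

(** A C1 step from 0 to 1, constant outside [0, 1]. Curves reparametrized by
    it stand still at both ends, so that they can be concatenated within class
    C1, and they stay in the prescribed region for all real times. *)
Definition step (R : realType) (t : R) : R :=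
  2 * ramp t - 4 * ramp (t - 2^-1) + 2 * ramp (t - 1).

Definition step' (R : realType) (t : R) : R :=
  4 * Num.max t 0 - 8 * Num.max (t - 2^-1) 0 + 4 * Num.max (t - 1) 0.

Lemma step_is_derive (R : realType) (t : R) : is_derive t 1 (@step R) (step' t).
Proof.
have sh (a : R) : is_derive t 1 (fun s => ramp (s - a)) (2 * Num.max (t - a) 0).
  have da : is_derive t 1 (fun s : R => s - a) 1.
    by apply: is_derive_eq; rewrite subr0.
  have dr := ramp_is_derive (t - a).
  have dd : derivable (@ramp R) (t - a) 1 by exact: ex_derive.
  have := @is_derive_comp R R^o (@ramp R) (fun s => s - a) t 1 da dd.
  by rewrite scale1r derive1E derive_val.
have s0 := ramp_is_derive t.
have s1 := sh 2^-1; have s2 := sh 1.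
rewrite /step.
apply: is_derive_eq; rewrite /step' /GRing.scale /=; ring.
Qed.

Lemma step'_continuous (R : realType) : continuous (@step' R).
Proof.
have cm (a : R) : continuous (fun t : R => Num.max (t - a) 0).
  move=> t; apply: continuousP_eps => e e0; exists e => // y hy.
  apply: (le_trans _ (ltW hy)).
  have h1 := ler_norm (y - t); have := ler_norm (t - y); rewrite distrC => h2.
  by rewrite ler_norml; case: (leP (y - a) 0) => ya; case: (leP (t - a) 0) => ta; lra.
have c0 : continuous (fun t : R => Num.max t 0).
  by under eq_fun do rewrite -[X in Num.max X _]subr0; exact: cm.
move=> t; apply: cvgD; first apply: cvgB.
- by apply: cvgM; [exact: cvg_cst|exact: c0].
- by apply: cvgM; [exact: cvg_cst|exact: cm].
- by apply: cvgM; [exact: cvg_cst|exact: cm].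
Qed.

Lemma step_le0 (R : realType) (t : R) : t <= 0 -> step t = 0 /\ step' t = 0.
Proof.
move=> t0; rewrite /step /step' /ramp !max_r; [split; ring|lra..].
Qed.

Lemma step_ge1 (R : realType) (t : R) : 1 <= t -> step t = 1 /\ step' t = 0.
Proof.
move=> t0; rewrite /step /step' /ramp !max_l; [|lra..].
by split; field.
Qed.

Lemma step_bound (R : realType) (t : R) :
  0 <= step t <= 1 /\ 0 <= step' t <= 2.
Proof.
have [t0|t0] := leP t 0; first by have [-> ->] := step_le0 t0; lra.
have [t1|t1] := leP 1 t; first by have [-> ->] := step_ge1 t1; lra.
rewrite /step /step' /ramp (max_l (ltW t0)) (max_r (x := t - 1)); last by lra.
by case: (leP (t - 2^-1) 0) => h; split; apply/andP; split; nra.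
Qed.

(** * The action of a curve *)

Notation phase R d := ('rV[R]_d * 'rV[R]_d)%type.

Lemma dotDl (R : realType) (d : nat) (u v w : 'rV[R]_d) :
  dot (u + v) w = dot u w + dot v w.
Proof. by rewrite /dot -big_split; apply: eq_bigr => i _; rewrite mxE mulrDl. Qed.

Lemma dotC (R : realType) (d : nat) (u v : 'rV[R]_d) : dot u v = dot v u.
Proof. by apply: eq_bigr => i _; rewrite mulrC. Qed.

Lemma dotDr (R : realType) (d : nat) (u v w : 'rV[R]_d) :
  dot w (u + v) = dot w u + dot w v.
Proof. by rewrite dotC dotDl !(dotC w). Qed.

Lemma dotZl (R : realType) (d : nat) (a : R) (u v : 'rV[R]_d) :
  dot (a *: u) v = a * dot u v.
Proof. by rewrite /dot mulr_sumr; apply: eq_bigr => i _; rewrite mxE mulrA. Qed.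

Lemma dotZr (R : realType) (d : nat) (a : R) (u v : 'rV[R]_d) :
  dot u (a *: v) = a * dot u v.
Proof. by rewrite dotC dotZl dotC. Qed.

Lemma dotNl (R : realType) (d : nat) (u v : 'rV[R]_d) : dot (- u) v = - dot u v.
Proof. by rewrite -scaleN1r dotZl mulN1r. Qed.

Lemma dotNr (R : realType) (d : nat) (u v : 'rV[R]_d) : dot u (- v) = - dot u v.
Proof. by rewrite dotC dotNl dotC. Qed.

Lemma dot0r (R : realType) (d : nat) (u : 'rV[R]_d) : dot u 0 = 0.
Proof. by rewrite -(scale0r 0) dotZr mul0r. Qed.

Lemma dot0l (R : realType) (d : nat) (u : 'rV[R]_d) : dot 0 u = 0.
Proof. by rewrite dotC dot0r. Qed.

Lemma rv_norm_le (R : realType) (d : nat) (i : 'I_d) (w : 'rV[R]_d) : `|w 0 i| <= `|w|.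
Proof. by rewrite [leRHS]/Num.norm /= mx_normrE; apply: (le_bigmax _ _ (0, i)). Qed.

(** The factor d appears because the norm is the maximum norm. *)
Lemma dot_bound (R : realType) (d : nat) (u v : 'rV[R]_d) :
  `|dot u v| <= d%:R * (`|u| * `|v|).
Proof.
apply: (le_trans (ler_norm_sum _ _ _)).
apply: (@le_trans _ _ (\sum_(i < d) `|u| * `|v|)).
  by apply: ler_sum => i _; rewrite normrM ler_pM // rv_norm_le.
by rewrite sumr_const card_ord mulr_natl.
Qed.

Lemma dot_continuous (R : realType) (T : topologicalType) (d : nat)
    (u v : T -> 'rV[R]_d) (t : T) :
  {for t, continuous u} -> {for t, continuous v} ->
  {for t, continuous (fun s => dot (u s) (v s))}.
Proof.
move=> cu cv; rewrite /dot.
have -> : (fun s => \sum_(l < d) u s 0 l * v s 0 l) =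
    \sum_(l < d) (fun s => u s 0 l * v s 0 l).
  by apply/funext => s; rewrite fct_sumE.
apply: (big_ind (fun f : T -> R => {for t, continuous f})).
- exact: cvg_cst.
- by move=> f g cf cg; exact: continuousD.
move=> i _; apply: continuousM.
  by apply: (@continuous_comp _ _ _ u (fun w : 'rV[R]_d => w 0 i)) => //; exact: coord_continuous.
by apply: (@continuous_comp _ _ _ v (fun w : 'rV[R]_d => w 0 i)) => //; exact: coord_continuous.
Qed.

Lemma C1_fst (R : realType) (V W : normedModType R) (c : R -> V * W) :
  C1 c -> C1 (fun t => (c t).1) /\ derive1 (fun t => (c t).1) = fun t => (derive1 c t).1.
Proof.
move=> [dc cc]; apply: C1_is_derive => [t|t].
  by apply: (is_derive_linear (L := fst)) => // y; exact: cvg_fst.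
by apply: (@continuous_comp _ _ _ (derive1 c) fst); [exact: cc|exact: cvg_fst].
Qed.

Lemma C1_snd (R : realType) (V W : normedModType R) (c : R -> V * W) :
  C1 c -> C1 (fun t => (c t).2) /\ derive1 (fun t => (c t).2) = fun t => (derive1 c t).2.
Proof.
move=> [dc cc]; apply: C1_is_derive => [t|t].
  by apply: (is_derive_linear (L := snd)) => // y; exact: cvg_snd.
by apply: (@continuous_comp _ _ _ (derive1 c) snd); [exact: cc|exact: cvg_snd].
Qed.

Definition action_density (R : realType) (d : nat) (c : R -> phase R d) (t : R) : R :=
  dot (c t).1 (derive1 c t).2.

Lemma C1_continuous (R : realType) (V : normedModType R) (c : R -> V) :
  C1 c -> continuous c.
Proof. by move=> [dc _] t; exact: derivable_continuous. Qed.

Lemma action_density_continuous (R : realType) (d : nat) (c : R -> phase R d) :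
  C1 c -> continuous (action_density c).
Proof.
move=> hc t; apply: (@dot_continuous R R d (fun s => (c s).1) (fun s => (derive1 c s).2) t).
  exact: (C1_continuous (C1_fst hc).1).
by have [[_ h] E] := C1_snd hc; rewrite -E; exact: h.
Qed.

Lemma loop_actionE (R : realType) (d : nat) (c : R -> phase R d) : C1 c ->
  loop_action c = integ 0 1 (action_density c).
Proof.
move=> hc; rewrite /loop_action /integ; congr Rintegral.
by apply/funext => t; rewrite /action_density (C1_snd hc).2.
Qed.

(** A primitive of the density is what can be reparametrized without a change
    of variables in integrals. *)
Lemma action_primitive (R : realType) (d : nat) (c : R -> phase R d) : C1 c ->
  exists K : R -> R, (forall t : R, 0 <= t <= 1 -> is_derive t 1 K (action_density c t))
    /\ loop_action c = K 1 - K 0.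
Proof.
move=> hc; have cd := action_density_continuous hc.
have [K HK] := primitive_exists (@ltr01 R) cd.
exists K; split=> //; rewrite loop_actionE //; apply: integ_FTC => // t _; exact: cd.
Qed.

Definition arc (R : realType) (i : nat) (t : R) : R := step (3 * t - i%:R).
Definition arc' (R : realType) (i : nat) (t : R) : R := 3 * step' (3 * t - i%:R).

Lemma arc_is_derive (R : realType) i (t : R) : is_derive t 1 (@arc R i) (arc' i t).
Proof.
have da : is_derive t 1 (fun s : R => 3 * s - i%:R) 3.
  by apply: is_derive_eq; rewrite subr0 /GRing.scale /= mulr1.
have dr := step_is_derive (3 * t - i%:R).
have dd : derivable (@step R) (3 * t - i%:R) 1 by exact: ex_derive.
have := @is_derive_comp R R^o (@step R) (fun s => 3 * s - i%:R) t 3 da dd.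
by rewrite derive1E derive_val.
Qed.

Lemma arc'_continuous (R : realType) i : continuous (@arc' R i).
Proof.
move=> t; apply: cvgM; first exact: cvg_cst.
apply: (@continuous_comp _ _ _ (fun s : R => 3 * s - i%:R) (@step' R));
  last exact: step'_continuous.
by apply: cvgB; [apply: cvgM; [exact: cvg_cst|exact: cvg_id]|exact: cvg_cst].
Qed.

Lemma arc_start (R : realType) i : arc i 0 = 0 :> R.
Proof.
by rewrite /arc mulr0 sub0r; have [|-> _] := @step_le0 R (- i%:R); rewrite ?oppr_le0.
Qed.

Lemma arc_end (R : realType) i : (i <= 2)%N -> arc i 1 = 1 :> R.
Proof.
move=> i2; have : i%:R <= 2%:R :> R by rewrite ler_nat.
by rewrite /arc mulr1 => h; have [|-> _] := @step_ge1 R (3 - i%:R); first by lra.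
Qed.

(** Increments are added instead of gluing values: the arcs need to join only
    modulo the lattice, and the result is a continuous lift of the
    concatenation. *)
Definition concat3 (R : realType) (V : normedModType R) (c0 c1 c2 : R -> V) (t : R) : V :=
  c0 (arc 0 t) + (c1 (arc 1 t) - c1 0) + (c2 (arc 2 t) - c2 0).

Lemma concat3_C1 (R : realType) (V : normedModType R) (c0 c1 c2 : R -> V) :
  C1 c0 -> C1 c1 -> C1 c2 -> C1 (concat3 c0 c1 c2) /\
  derive1 (concat3 c0 c1 c2) = fun t => arc' 0 t *: derive1 c0 (arc 0 t) +
    arc' 1 t *: derive1 c1 (arc 1 t) + arc' 2 t *: derive1 c2 (arc 2 t).
Proof.
move=> h0 h1 h2.
have [k0 E0] := C1_comp (@arc_is_derive R 0) (@arc'_continuous R 0) h0.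
have [k1 E1] := C1_comp (@arc_is_derive R 1) (@arc'_continuous R 1) h1.
have [k2 E2] := C1_comp (@arc_is_derive R 2) (@arc'_continuous R 2) h2.
have [m1 F1] := C1D k1 (C1_cst (- c1 0)).1.
have [m2 F2] := C1D k2 (C1_cst (- c2 0)).1.
have [m3 F3] := C1D k0 m1.
have [m4 F4] := C1D m3 m2.
split=> //; rewrite [LHS]F4 F3 F2 F1 E0 E1 E2.
by apply/funext => t; rewrite !(C1_cst _).2 !addr0.
Qed.

Lemma arc_cases (R : realType) (t : R) :
  [\/ [/\ arc 1 t = 0, arc 2 t = 0, arc' 1 t = 0 & arc' 2 t = 0],
      [/\ arc 0 t = 1, arc 2 t = 0, arc' 0 t = 0 & arc' 2 t = 0] |
      [/\ arc 0 t = 1, arc 1 t = 1, arc' 0 t = 0 & arc' 1 t = 0]].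
Proof.
rewrite /arc /arc'.
have [t1|t1] := leP (3 * t) 1.
  have [|-> ->] := @step_le0 R (3 * t - 1%:R); first by lra.
  have [|-> ->] := @step_le0 R (3 * t - 2%:R); first by lra.
  by constructor 1; rewrite mulr0.
have [|-> ->] := @step_ge1 R (3 * t - 0%:R); first by lra.
have [t2|t2] := leP (3 * t) 2.
  have [|-> ->] := @step_le0 R (3 * t - 2%:R); first by lra.
  by constructor 2; rewrite mulr0.
have [|-> ->] := @step_ge1 R (3 * t - 1%:R); first by lra.
by constructor 3; rewrite mulr0.
Qed.

(** Only one arc moves at any time, and the actions agree at the joints. *)
Lemma concat3_fst (R : realType) (d : nat) (c0 c1 c2 : R -> phase R d) (t : R) :
  (c0 1).1 = (c1 0).1 -> (c1 1).1 = (c2 0).1 ->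
  [\/ [/\ (concat3 c0 c1 c2 t).1 = (c0 (arc 0 t)).1, arc' 1 t = 0 & arc' 2 t = 0],
      [/\ (concat3 c0 c1 c2 t).1 = (c1 (arc 1 t)).1, arc' 0 t = 0 & arc' 2 t = 0] |
      [/\ (concat3 c0 c1 c2 t).1 = (c2 (arc 2 t)).1, arc' 0 t = 0 & arc' 1 t = 0]].
Proof.
move=> e01 e12; rewrite /concat3 /=.
case: (arc_cases t) => [] [-> -> -> ->].
- by constructor 1; rewrite !subrr !addr0.
- by constructor 2; rewrite e01 subrr addr0 subrKC.
- by constructor 3; rewrite e01 e12 subrKC subrKC.
Qed.

Lemma dot_active (R : realType) (d : nat) (x J0 J1 J2 v0 v1 v2 : 'rV[R]_d)
    (a0 a1 a2 : R) :
  [\/ [/\ x = J0, a1 = 0 & a2 = 0], [/\ x = J1, a0 = 0 & a2 = 0] |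
      [/\ x = J2, a0 = 0 & a1 = 0]] ->
  dot x (a0 *: v0 + a1 *: v1 + a2 *: v2) =
  a0 * dot J0 v0 + a1 * dot J1 v1 + a2 * dot J2 v2.
Proof.
rewrite 2!dotDr 3!dotZr.
by case=> -[-> -> ->]; rewrite !mul0r ?addr0 ?add0r.
Qed.

(** The density of the concatenation is that of the moving arc, since a
    lattice translation of the angles changes neither the actions nor the
    velocities. *)
Lemma loop_action_concat3 (R : realType) (d : nat) (c0 c1 c2 : R -> phase R d) :
  C1 c0 -> C1 c1 -> C1 c2 -> (c0 1).1 = (c1 0).1 -> (c1 1).1 = (c2 0).1 ->
  loop_action (concat3 c0 c1 c2) = loop_action c0 + loop_action c1 + loop_action c2.
Proof.
move=> h0 h1 h2 e01 e12.
have [K0 [D0 ->]] := action_primitive h0.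
have [K1 [D1 ->]] := action_primitive h1.
have [K2 [D2 ->]] := action_primitive h2.
have [hc Ec] := concat3_C1 h0 h1 h2.
have a01 i (t : R) : 0 <= arc i t <= 1 by have [] := step_bound (3 * t - i%:R).
pose K t := K0 (arc 0 t) + K1 (arc 1 t) + K2 (arc 2 t).
have dKi i (Ki : R -> R) (c : R -> phase R d) (t : R) :
    (forall t : R, 0 <= t <= 1 -> is_derive t 1 Ki (action_density c t)) ->
    is_derive t 1 (fun s => Ki (arc i s)) (arc' i t * action_density c (arc i t)).
  move=> Di; have di := Di _ (a01 i t).
  have dd : derivable Ki (arc i t) 1 by exact: ex_derive.
  have := @is_derive_comp R R^o Ki (arc i) t _ (arc_is_derive i t) dd.
  by rewrite derive1E derive_val.
have dK (t : R) : is_derive t 1 K (action_density (concat3 c0 c1 c2) t).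
  have d0 := dKi 0%N _ _ t D0; have d1 := dKi 1%N _ _ t D1; have d2 := dKi 2 _ _ t D2.
  have -> : action_density (concat3 c0 c1 c2) t =
      arc' 0 t * action_density c0 (arc 0 t) + arc' 1 t * action_density c1 (arc 1 t)
      + arc' 2 t * action_density c2 (arc 2 t); last first.
    exact: (is_deriveD (is_deriveD d0 d1) d2).
  apply: etrans (congr1 (fun g => dot (concat3 c0 c1 c2 t).1 (g t).2) Ec) _.
  exact: dot_active (concat3_fst t e01 e12).
rewrite (loop_actionE hc) (@integ_FTC R 0 1 K _ ltr01
  (fun t _ => action_density_continuous hc (x := t)) (fun t _ => dK t)).
have -> : K 1 = K0 1 + K1 1 + K2 1.
  by rewrite {1}/K (arc_end R (i := 0)) // (arc_end R (i := 1)) // (arc_end R (i := 2)).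
have -> : K 0 = K0 0 + K1 0 + K2 0.
  by rewrite {1}/K (arc_start R 0) (arc_start R 1) (arc_start R 2).
ring.
Qed.

Lemma loop_action_rev (R : realType) (d : nat) (c : R -> phase R d) : C1 c ->
  C1 (fun t => c (1 - t)) /\ loop_action (fun t => c (1 - t)) = - loop_action c.
Proof.
move=> hc.
have da (t : R) : is_derive t 1 (fun s : R => 1 - s) (-1).
  by apply: is_derive_eq; ring.
have [hr Er] := @C1_comp R _ c (fun s : R => 1 - s) (fun=> -1) da (fun t => cvg_cst _) hc.
split=> //.
have [K [D ->]] := action_primitive hc.
pose Kr (t : R) := K (1 - t).
have dr (t : R) : 0 <= t <= 1 -> is_derive t 1 Kr (action_density (fun t => c (1 - t)) t).
  move=> t01.
  have dK : is_derive (1 - t) 1 K (action_density c (1 - t)) by apply: D; lra.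
  have dd : derivable K (1 - t) 1 by exact: ex_derive.
  have := @is_derive_comp R R^o K (fun s : R => 1 - s) t _ (da t) dd.
  rewrite derive1E derive_val => dc.
  have -> : action_density (fun t => c (1 - t)) t = -1 *: action_density c (1 - t).
    apply: etrans (congr1 (fun g => dot (c (1 - t)).1 (g t).2) Er) _.
    by rewrite /action_density /= dotZr.
  exact: dc.
have := @integ_FTC R 0 1 Kr _ ltr01
  (fun t _ => @action_density_continuous R d _ hr t) dr.
rewrite -(loop_actionE hr) => ->.
by rewrite /Kr subrr subr0 opprB.
Qed.

(** * Images of C1 curves *)

(** Local Lipschitz bounds pass to derivatives. *)
Lemma derive1_norm_bound (R : realType) (V : normedModType R) (c : R -> V) (t B dl : R) :
  0 < dl -> derivable c t 1 ->
  (forall s, `|s - t| <= dl -> `|c s - c t| <= B * `|s - t|) ->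
  `|derive1 c t| <= B.
Proof.
move=> dl0 dc H; rewrite derive1E.
have L : `|h^-1 *: (c (h *: 1 + t) - c t)| @[h --> 0^'] --> `|'D_1 c t|.
  exact: cvg_norm.
apply: (cvgr_to_le L).
apply/nbhs_normP; exists dl => // h /=; rewrite sub0r normrN => hd h0.
rewrite [h *: 1]mulr1 normrZ normfV ler_pdivrMl ?normr_gt0 // mulrC.
by have := H (h + t); rewrite addrK => /(_ (ltW hd)).
Qed.

Lemma derivable_diff (R : realType) (V W : normedModType R) (F : V -> W) (x v : V) :
  differentiable F x ->
  h^-1 *: (F (h *: v + x) - F x) @[h --> 0^'] --> 'd F x v.
Proof.
by move=> dF; rewrite -deriveE //; exact: diff_derivable.
Qed.

(** Second differences bound the variation of the differential. *)
Lemma diff_lipschitz (R : realType) (V W : normedModType R) (F : V -> W) (x y : V)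
    (C rad : R) : 0 < rad -> differentiable F x -> differentiable F y ->
  (forall v, `|v| <= rad ->
     `|(F (x + v) - F x) - (F (y + v) - F y)| <= C * `|x - y| * `|v|) ->
  forall v, `|'d F x v - 'd F y v| <= C * `|x - y| * `|v|.
Proof.
move=> rad0 dx dy H v.
have L : `|h^-1 *: (F (h *: v + x) - F x) - h^-1 *: (F (h *: v + y) - F y)|
    @[h --> 0^'] --> `|'d F x v - 'd F y v|.
  by apply: cvg_norm; apply: cvgB; exact: derivable_diff.
apply: (cvgr_to_le L).
have v1 : 0 < `|v| + 1 by rewrite ltr_wpDl.
apply/nbhs_normP; exists (rad / (`|v| + 1)); first by rewrite /= divr_gt0.
move=> h /=; rewrite sub0r normrN ltr_pdivlMr // => hd h0.
rewrite -scalerBr normrZ normfV ler_pdivrMl ?normr_gt0 //.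
rewrite ![h *: v + _]addrC; apply: (le_trans (H (h *: v) _)).
  rewrite normrZ; apply: le_trans (ltW hd); rewrite ler_wpM2l //.
  by rewrite lerDl.
by rewrite normrZ; apply: eqW; ring.
Qed.

(** The continuity of the derivative of F along the curve comes from the
    second difference bound: together with differentiability at each point, it
    makes the differential of F vary continuously along c. *)
Lemma C1_image (R : realType) (V W : normedModType R) (F : V -> W) (O : set V)
    (c : R -> V) :
  (forall x, O x -> differentiable F x) ->
  (forall x, O x -> exists rad C : R, 0 < rad /\ forall y v, `|y - x| <= rad ->
     `|v| <= rad -> `|(F (y + v) - F y) - (F (x + v) - F x)| <= C * `|y - x| * `|v|) ->
  C1 c -> (forall t, O (c t)) -> C1 (fun t => F (c t)).
Proof.
move=> dF sF hc Oc.
have [dc cc] := hc.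
apply: (@C1_is_derive R W _ (fun t => 'd F (c t) (derive1 c t)) _ _).1 => [t|t].
  have dct : differentiable c t by apply/derivable1_diffP; exact: dc.
  have dFt : differentiable F (c t) by apply: dF.
  have d : differentiable (F \o c) t by exact: differentiable_comp.
  apply: DeriveDef; first exact: diff_derivable.
  by rewrite -derive1E derive1E' // diff_comp //= derive1E'.
have [rad [C [rad0 H]]] := sF _ (Oc t).
rewrite /continuous_at.
have -> : (fun s => 'd F (c s) (derive1 c s)) =
   (fun s => 'd F (c t) (derive1 c s) +
       ('d F (c s) (derive1 c s) - 'd F (c t) (derive1 c s))).
  by apply/funext => s; rewrite subrKC.
rewrite -[X in _ --> X](addr0); apply: cvgD.
  apply: (@continuous_comp _ _ _ (derive1 c) ('d F (c t))); first exact: cc.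
  by apply: diff_continuous; exact: dF.
have cct := C1_continuous hc (x := t).
have B0 : `|derive1 c s| @[s --> t] --> `|derive1 c t| by apply: cvg_norm; exact: cc.
have z0 : (`|C| * `|c s - c t| * (`|derive1 c t| + 1)) @[s --> t] --> (0 : R).
  rewrite -[X in _ --> X](mul0r (`|derive1 c t| + 1)).
  apply: cvgM; last exact: cvg_cst.
  rewrite -[X in _ --> X](mulr0 `|C|); apply: cvgM; first exact: cvg_cst.
  have cB : (fun s => c s - c t) s @[s --> t] --> c t - c t.
    by apply: (cvgB (f := c) (g := fun=> c t)); [exact: cct|exact: cvg_cst].
  by have := cvg_norm (FF := nbhs_filter t) cB; rewrite subrr normr0.
apply: norm_cvg0; apply: (@squeeze_cvgr _ _ _ _ (fun=> 0) _ _ _ _ (cvg_cst _) z0).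
near=> s; rewrite normr_ge0 /=.
apply: (@le_trans _ _ (C * `|c s - c t| * `|derive1 c s|)).
  apply: (@diff_lipschitz _ _ _ _ _ _ _ rad rad0); [exact: dF|exact: dF|].
  move=> v hv; apply: H => //.
  by near: s; apply: cvgr_distC_le.
apply: (@le_trans _ _ (`|C| * `|c s - c t| * `|derive1 c s|)).
  by rewrite ler_wpM2r // ler_wpM2r // ler_norm.
apply: ler_wpM2l; first by rewrite mulr_ge0.
by near: s; apply: (cvgr_le _ B0); rewrite ltrDl.
Unshelve. all: end_near. Qed.

(** * Real points of the complex phase space *)

Notation cphase R d := ('rV[R[i]]_d * 'rV[R[i]]_d)%type.

Section embedding.
Variables (R : realType) (d : nat).
Implicit Types (u v : 'rV[R]_d) (x y : phase R d).

Lemma cvecD u v : cvec (u + v) = cvec u + cvec v.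
Proof. exact: (map_mxD (real_complex R)). Qed.
Lemma cvecN u : cvec (- u) = - cvec u.
Proof. exact: (map_mxN (real_complex R)). Qed.
Lemma cvecB u v : cvec (u - v) = cvec u - cvec v.
Proof. by rewrite cvecD cvecN. Qed.
Lemma cvecZ (a : R) u : cvec (a *: u) = a%:C *: cvec u.
Proof. exact: (map_mxZ (real_complex R)). Qed.
Lemma cvec0 : cvec (0 : 'rV[R]_d) = 0.
Proof. exact: (map_mx0 (real_complex R)). Qed.

Lemma rv_norm_lub (w : 'rV[R]_d) (B : R) :
  0 <= B -> (forall i, `|w 0 i| <= B) -> `|w| <= B.
Proof.
move=> B0 H; rewrite [leLHS]/Num.norm /= mx_normrE.
by apply: bigmax_le => // -[i j] _ /=; rewrite ord1.
Qed.

Lemma cnorm_cvec u : cnorm (cvec u) = `|u|.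
Proof.
apply/eqP; rewrite eq_le; apply/andP; split.
  apply: (coord_norming (rv_coordinates R d)) => // i.
  by rewrite /rv_coord mxE cnorm_real; exact: rv_norm_le.
apply: rv_norm_lub => [|i]; first exact: cnorm_ge0.
have := coord_le (rv_coordinates R d) i (cvec u).
by rewrite /rv_coord mxE cnorm_real.
Qed.

Lemma cnorm_cpair x : cnorm (cpair x) = `|x|.
Proof. by rewrite cnorm_pair prod_normE !cnorm_cvec. Qed.

Lemma cpairD x y : cpair (x + y) = cpair x + cpair y.
Proof. by rewrite /cpair !cvecD. Qed.
Lemma cpairB x y : cpair (x - y) = cpair x - cpair y.
Proof. by rewrite /cpair !cvecB. Qed.
Lemma cpairZ (a : R) x : cpair (a *: x) = (a%:C : CK R) *: cpair x.
Proof. by rewrite /cpair !cvecZ. Qed.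
Lemma cpair0 : cpair (0 : phase R d) = 0.
Proof. by rewrite /cpair !cvec0. Qed.

Lemma phase_fst_norm x : `|x.1| <= `|x|.
Proof. by rewrite prod_normE le_max lexx. Qed.
Lemma phase_snd_norm x : `|x.2| <= `|x|.
Proof. by rewrite prod_normE le_max lexx orbT. Qed.

Lemma imvec_cvec u : imvec (cvec u) = 0.
Proof. by apply/rowP => i; rewrite !mxE. Qed.

End embedding.

Lemma binom_real (R : realType) (k : nat) (t : R) :
  binom k (t%:C : CK R) = (binom k t)%:C.
Proof.
elim: k => [|k IH] //=.
by rewrite IH !rmorphM rmorphB fmorphV !rmorph_nat.
Qed.

Lemma C1M (R : realType) (f g : R -> R) : C1 (f : R -> R^o) -> C1 (g : R -> R^o) ->
  C1 (fun t => f t * g t : R^o).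
Proof.
move=> hf hg.
apply: (@C1_is_derive R R^o _ (fun t => f t * derive1 g t + g t * derive1 f t) _ _).1.
  move=> t; have df := is_derive_C1 t hf; have dg := is_derive_C1 t hg.
  exact: is_deriveM.
move=> t; apply: cvgD; apply: cvgM.
- exact: (C1_continuous hf).
- exact: hg.2.
- exact: (C1_continuous hg).
- exact: hf.2.
Qed.

Lemma binom_C1 (R : realType) (k : nat) : C1 (fun t : R => binom k t : R^o).
Proof.
elim: k => [|k IH] /=; first exact: (C1_cst (1 : R^o)).1.
apply: (@C1M R (fun t => binom k t * (t - k%:R)) (fun=> k.+1%:R^-1)); last first.
  exact: (C1_cst _).1.
apply: (@C1M R (fun t => binom k t) (fun t => t - k%:R)); first exact: IH.
apply: (@C1_is_derive R R^o _ (fun=> 1) _ _).1 => [t|t]; last exact: cvg_cst.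
by apply: is_derive_eq; rewrite subr0.
Qed.

Lemma C1Zl (R : realType) (V : normedModType R) (f : R -> R) (v : V) :
  C1 (f : R -> R^o) -> C1 (fun t => f t *: v).
Proof.
move=> hf.
apply: (@C1_is_derive R V _ (fun t => derive1 f t *: v) _ _).1 => [t|t]; last first.
  by apply: cvgZr_tmp; exact: hf.2.
have lim : h^-1 *: (f (h *: 1 + t) *: v - f t *: v) @[h --> 0^'] --> derive1 f t *: v.
  have -> : (fun h => h^-1 *: (f (h *: 1 + t) *: v - f t *: v)) =
      (fun h => (h^-1 *: (f (h *: 1 + t) - f t)) *: v).
    by apply/funext => h; rewrite -scalerBl scalerA.
  by apply: cvgZr_tmp; rewrite derive1E; exact: (hf.1 t).
by apply: DeriveDef; [apply/cvg_ex; exists (derive1 f t *: v)|exact: cvg_lim].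
Qed.

Lemma newton_C1 (R : realType) (V : normedModType R) (f : V -> V) (m : nat) (x : V) :
  C1 (fun t : R => newton f m x t).
Proof.
rewrite /newton; elim: m.+1 => [|n IH].
  have -> : (fun t : R => \sum_(k < 0) binom k t *: fdiff f k x) = fun=> 0.
    by apply/funext => t; rewrite big_ord0.
  exact: (C1_cst _).1.
have -> : (fun t : R => \sum_(k < n.+1) binom k t *: fdiff f k x) =
   fun t => \sum_(k < n) binom k t *: fdiff f k x + binom n t *: fdiff f n x.
  by apply/funext => t; rewrite big_ord_recr.
by apply: (C1D IH _).1; apply: C1Zl; exact: binom_C1.
Qed.

(** * Curves and points on the torus *)

Lemma is_derive_coord (R : realType) (d : nat) (u : R -> 'rV[R]_d) (t : R) (i : 'I_d) :
  C1 u -> is_derive t 1 (fun s => u s 0 i) (derive1 u t 0 i).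
Proof.
move=> [du _]; have H := (derivable_mxP u t 1).1 (du t).
apply: DeriveDef; first exact: H.
by rewrite derive1E derive_mx ?mxE //; exact: du.
Qed.

Lemma is_derive_dot (R : realType) (d : nat) (u v : R -> 'rV[R]_d) (t : R) :
  C1 u -> C1 v ->
  is_derive t 1 (fun s => dot (u s) (v s)) (dot (derive1 u t) (v t) + dot (u t) (derive1 v t)).
Proof.
move=> hu hv; rewrite /dot.
have -> : (fun s => \sum_(l < d) u s 0 l * v s 0 l) =
    \sum_(l < d) (fun s => u s 0 l * v s 0 l).
  by apply/funext => s; rewrite fct_sumE.
rewrite -big_split /=.
apply: is_derive_sum => i.
have du := is_derive_coord t i hu; have dv := is_derive_coord t i hv.
have := is_deriveM du dv.
rewrite /GRing.scale /= [X in is_derive _ _ _ X -> _]addrC [_ * derive1 u t 0 i]mulrC.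
exact.
Qed.

Lemma step_lipschitz (R : realType) (s t : R) : `|step s - step t| <= 2 * `|s - t|.
Proof.
wlog st : s t / s < t.
  move=> H; have [st|ts|->] := ltgtP s t; first exact: H.
    by rewrite distrC [`|s - t|]distrC; exact: H.
  by rewrite !subrr normr0 mulr0.
have cs : cont_on s t (@step' R) by move=> x _; exact: step'_continuous.
rewrite distrC -(integ_FTC st cs (fun x _ => step_is_derive x)).
rewrite [`|s - t|]distrC [`|t - s|]gtr0_norm ?subr_gt0 //.
apply: integ_bound => //; first exact: ltW.
move=> x _; have [_ /andP[a b]] := step_bound x; rewrite ger0_norm //.
Qed.

(** Angles matter modulo the lattice only; representatives of norm at most 1
    keep the segments from the origin in a bounded region. *)
Definition fracv (R : realType) (d : nat) (u : 'rV[R]_d) : 'rV[R]_d :=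
  \row_i (u 0 i - (Num.floor (u 0 i))%:~R).

Lemma fracv_bound (R : realType) (d : nat) (u : 'rV[R]_d) : `|fracv u| <= 1.
Proof.
apply: rv_norm_lub => // i; rewrite mxE ler_norml.
have := floor_itv (u 0 i); rewrite rmorphD /=; lra.
Qed.

Lemma fracv_Zvec (R : realType) (d : nat) (u : 'rV[R]_d) : Zvec (u - fracv u).
Proof.
exists (\row_i Num.floor (u 0 i)) => //.
by apply/rowP => i; rewrite !mxE subKr.
Qed.

Lemma ZvecN (R : realType) (d : nat) (u : 'rV[R]_d) : Zvec u -> Zvec (- u).
Proof.
move=> [k _ <-]; exists (- k) => //.
by apply/rowP => i; rewrite !mxE rmorphN.
Qed.

Lemma ZvecD (R : realType) (d : nat) (u v : 'rV[R]_d) : Zvec u -> Zvec v -> Zvec (u + v).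
Proof.
move=> [k _ <-] [k' _ <-]; exists (k + k') => //.
by apply/rowP => i; rewrite !mxE rmorphD.
Qed.

Lemma Zvec0 (R : realType) (d : nat) : Zvec (0 : 'rV[R]_d).
Proof. by exists 0 => //; apply/rowP => i; rewrite !mxE. Qed.

(** Equality of points of R^d x T^d. *)
Definition same_point (R : realType) (d : nat) (x y : phase R d) : Prop :=
  x.1 = y.1 /\ Zvec (x.2 - y.2).

(** * Interpolating curves *)

Lemma dot_diff (R : realType) (d : nat) (u v u' v' : 'rV[R]_d) :
  dot u u' - dot v v' = dot (u - v) u' - dot v (v' - u').
Proof. by rewrite dotDl dotDr dotNl dotNr; ring. Qed.

Section interpolation.
Variables (R : realType) (d : nat) (f : phase R d -> phase R d)
  (fC : cphase R d -> cphase R d) (dl eta : R) (m : nat).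
Hypotheses (dl0 : 0 < dl) (dl4 : dl <= 1 / 4) (eta0 : 0 < eta) (m4 : (4 <= m)%N)
  (small : 20 * expR 1 * m%:R * eta <= dl).
Hypothesis nearid : forall (x : phase R d) (z : (cphase R d : normedModType R[i])), `|x.1| <= 1 -> cnorm (z - cpair x) <= 2 * dl ->
  differentiable fC z /\ cnorm (fC z - z) <= eta.
Hypothesis compat : forall x : phase R d, `|x.1| < 2 -> fC (cpair x) = cpair (f x).

Let cl := pair_coordinates R d.
Implicit Types (x y : phase R d).

Lemma eta_small : [/\ 20 * eta <= dl, 20 * expR 1 * eta <= dl / 4 & 4 * eta <= m%:R * eta].
Proof.
have h0 := step_le_radius eta0 m4 small.
have m4' : 4 <= m%:R :> R by rewrite ler_nat.
split=> //; last by rewrite ler_pM2r.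
have := small; have : 20 * expR 1 * eta * 4 <= 20 * expR 1 * eta * m%:R.
  by rewrite ler_wpM2l // !mulr_ge0 ?expR_ge0 // ltW.
lra.
Qed.

Lemma near_core x y : `|x.1| <= 1 -> `|y - x| <= 2 * dl -> `|y.1| < 2.
Proof.
move=> x1 yx; have := le_trans (phase_fst_norm (y - x)) yx => /= h.
have := ler_normD (y.1 - x.1) x.1; rewrite subrK; have := dl4; lra.
Qed.

Lemma displacement x y : `|x.1| <= 1 -> `|y - x| <= 2 * dl -> `|f y - y| <= eta.
Proof.
move=> x1 yx; have y2 := near_core x1 yx.
have := (nearid (z := cpair y) x1); rewrite -cpairB cnorm_cpair => /(_ yx)[_].
by rewrite compat // -cpairB cnorm_cpair.
Qed.

Lemma fdiff_compat x : `|x.1| <= 1 -> forall k y, `|y - x| + k%:R * eta <= 2 * dl ->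
  fdiff fC k (cpair y) = cpair (fdiff f k y).
Proof.
move=> x1; elim=> [//|k IH] y yx /=.
have e0 := eta0.
have [yx0 yxk] : `|y - x| <= 2 * dl /\ `|y - x| + k%:R * eta <= 2 * dl.
  have k0 : 0 <= k%:R * eta by rewrite mulr_ge0 // ltW.
  by move: yx; rewrite -[k.+1]addn1 natrD mulrDl mul1r; split; lra.
have y2 := near_core x1 yx0.
have fy := displacement x1 yx0.
rewrite cpairB IH // compat // IH //.
have := ler_normD (f y - y) (y - x); rewrite subrKA.
move: yx; rewrite -[k.+1]addn1 natrD mulrDl mul1r; lra.
Qed.

(** The polynomial of the complex map at a real point is real, which makes the
    estimates for fC available for f. *)
Lemma newton_compat x (t : R) : `|x.1| <= 1 ->
  newton fC m (cpair x) (t%:C : CK R) = cpair (newton f m x t).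
Proof.
move=> x1; rewrite /newton (big_morph (@cpair R d) (@cpairD R d) (@cpair0 R d)).
apply: eq_bigr => k _; rewrite binom_real cpairZ (fdiff_compat x1) // subrr normr0 add0r.
have km : (k <= m)%N by rewrite -ltnS.
have := small; have e1 := expR1_ge1 R; have e0 := eta0.
have : k%:R * eta <= m%:R * eta by rewrite ler_pM2r // ler_nat.
have me : 0 <= m%:R * eta by rewrite mulr_ge0 // ltW.
have : 1 * (m%:R * eta) <= expR 1 * (m%:R * eta) by rewrite ler_wpM2r.
have := dl0; lra.
Qed.

Let fd x (x1 : `|x.1| <= 1) (z : (cphase R d : normedModType R[i])) (h : cnorm (z - cpair x) <= dl) :
  differentiable fC z /\ cnorm (fC z - z) <= eta.
Proof. by apply: (nearid x1); have := dl0; lra. Qed.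

(** The orbit polynomial restricted to t in [0, 1], that is, a curve from x to
    f x. *)
Definition interp (x : phase R d) (t : R) : phase R d := newton f m x (step t).

Lemma cnorm_step (t : R) : cnorm ((step t)%:C : CK R) <= 1.
Proof.
by have [/andP[a b] _] := step_bound t; rewrite cnorm_real ger0_norm.
Qed.

Let step4 (t : R) : cnorm ((step t)%:C : CK R) <= 4 * m%:R.
Proof.
apply: (le_trans (cnorm_step t)); have : 4 <= m%:R :> R by rewrite ler_nat.
lra.
Qed.

Lemma interp_near x (t : R) : `|x.1| <= 1 -> `|interp x t - x| <= 5 * expR 1 * eta.
Proof.
move=> x1; rewrite -cnorm_cpair cpairB /interp -newton_compat //.
apply: (le_trans (newton_small cl dl0 eta0 m4 small (fd x1) (step4 t))).
have e0 : 0 <= 5 * expR 1 * eta by rewrite !mulr_ge0 ?expR_ge0 // ltW.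
by rewrite -[leRHS]mulr1 ler_wpM2l // cnorm_step.
Qed.

Lemma interp_core x (t : R) : `|x.1| <= 1 -> `|interp x t - x| <= 2 * dl.
Proof.
move=> x1; have := interp_near t x1; have [_ h _] := eta_small.
have := dl0; lra.
Qed.

Lemma interp_region x (t : R) : `|x.1| <= 1 -> `|(interp x t).1| < 2.
Proof. by move=> x1; exact: near_core (interp_core t x1). Qed.

Lemma interp_C1 x : C1 (interp x).
Proof.
exact: (C1_comp (@step_is_derive R) (@step'_continuous R) (newton_C1 f m x)).1.
Qed.

Lemma interp0 x : interp x 0 = x.
Proof.
by rewrite /interp (step_le0 (lexx 0)).1 newton0.
Qed.

Lemma interp1 x : interp x 1 = f x.
Proof.
rewrite /interp (step_ge1 (lexx 1)).1.
have -> : 1 = 1%:R :> R by [].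
by rewrite newton_interpolates //; exact: leq_trans m4.
Qed.

Lemma step_diff1 (s t : R) : `|step s - step t| <= 1.
Proof.
have [/andP[a b] _] := step_bound s; have [/andP[a' b'] _] := step_bound t.
by rewrite ler_norml; lra.
Qed.

Lemma derive1_interp x (t : R) : `|x.1| <= 1 ->
  `|derive1 (interp x) t| <= 40 * expR 1 * eta.
Proof.
move=> x1; apply: (@derive1_norm_bound _ _ _ _ _ 1 ltr01); first exact: (interp_C1 x).1.
move=> s _; rewrite -cnorm_cpair cpairB /interp -!newton_compat //.
have D : (step s)%:C - (step t)%:C = (step s - step t)%:C :> CK R by rewrite rmorphB.
apply: (le_trans (newton_lipschitz cl dl0 eta0 m4 small (fd x1) (cnorm_step t) _)).
  by rewrite D cnorm_real step_diff1.
rewrite D cnorm_real.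
have -> : 40 * expR 1 * eta * `|s - t| = 20 * expR 1 * eta * (2 * `|s - t|) by ring.
by rewrite ler_wpM2l ?step_lipschitz // !mulr_ge0 ?expR_ge0 // ltW.
Qed.

(** Interpolating curves are mapped to interpolating curves, up to an
    exponentially small error. *)
Lemma interp_defect x (t : R) : `|x.1| <= 1 -> `|(f x).1| <= 1 ->
  `|f (interp x t) - interp (f x) t| <= 2 * dl * 2^-1 ^+ m.+1.
Proof.
move=> x1 y1; rewrite -cnorm_cpair cpairB -compat; last exact: interp_region.
rewrite /interp -!newton_compat // -compat; last by have := x1; lra.
apply: (defect_small cl dl0 eta0 m4 small (fun z => nearid x1 (z := z))).
by apply: (le_trans (cnorm_step t)); lra.
Qed.

Hypothesis fC1 : forall c : R -> phase R d, C1 c -> (forall t : R, `|(c t).1| < 2) -> C1 (fun t => f (c t)).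

Lemma f_interp_C1 x : `|x.1| <= 1 -> C1 (fun t => f (interp x t)).
Proof. by move=> x1; apply: fC1; [exact: interp_C1|move=> t; exact: interp_region]. Qed.

(** The defect is holomorphic, so its derivative is as small as the defect
    itself. *)
Lemma derive1_interp_defect x (t : R) : `|x.1| <= 1 -> `|(f x).1| <= 1 ->
  `|derive1 (fun t => f (interp x t)) t - derive1 (interp (f x)) t| <=
  4 * dl * 2^-1 ^+ m.
Proof.
move=> x1 y1.
have hN := C1N (interp_C1 (f x)).
have [hD ED] := C1D (f_interp_C1 x1) hN.1.
have <- : derive1 (fun t => f (interp x t) + - interp (f x) t) t =
  derive1 (fun t => f (interp x t)) t - derive1 (interp (f x)) t.
  by rewrite ED hN.2.
apply: (@derive1_norm_bound _ _ _ _ _ 1 ltr01); first exact: hD.1.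
move=> s _.
have E r : cpair (f (interp x r) - interp (f x) r) = defect fC m (cpair x) (step r)%:C.
  rewrite cpairB -compat; last exact: interp_region.
  have x2 : `|x.1| < 2 by have := x1; lra.
  by rewrite /defect /interp -(newton_compat (step r) x1) -(newton_compat (step r) y1)
    -(compat x2).
rewrite -cnorm_cpair cpairB (f_equal2 (fun u v : cphase R d => cnorm (u - v)) (E s) (E t)).
have D : (step s)%:C - (step t)%:C = (step s - step t)%:C :> CK R by rewrite rmorphB.
apply: (le_trans (defect_lipschitz cl dl0 eta0 m4 small (fun z => nearid x1 (z := z)) (cnorm_step t) _)).
  by rewrite D cnorm_real step_diff1.
rewrite D cnorm_real.
have -> : 4 * dl * 2^-1 ^+ m * `|s - t| = 2 * dl * 2^-1 ^+ m * (2 * `|s - t|) by ring.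
by rewrite ler_wpM2l ?step_lipschitz // !mulr_ge0 ?exprn_ge0 ?invr_ge0 // ltW.
Qed.

(** Closeness of two curves together with their velocities gives closeness of
    their actions; the loss is the constant 9 d. *)
Lemma action_interp_defect x : `|x.1| <= 1 -> `|(f x).1| <= 1 ->
  `|loop_action (interp (f x)) - loop_action (fun t => f (interp x t))| <=
  9 * d%:R * 2^-1 ^+ m.
Proof.
move=> x1 y1; have hq := interp_C1 (f x); have hg := f_interp_C1 x1.
rewrite (loop_actionE hq) (loop_actionE hg).
have cq : cont_on 0 1 (action_density (interp (f x))).
  by move=> t _; exact: action_density_continuous.
have cg : cont_on 0 1 (action_density (fun t => f (interp x t))).
  by move=> t _; exact: action_density_continuous.
rewrite -(integB cq cg).
rewrite -[9 * d%:R * 2^-1 ^+ m]mulr1 -[X in _ * X](subr0 1).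
apply: integ_bound => // [t ht|t _].
  by apply: contB; [exact: cq|exact: cg].
have p0 : 0 <= 2^-1 ^+ m :> R by rewrite exprn_ge0 // invr_ge0.
rewrite /action_density; set q := interp (f x) t; set g := f (interp x t).
set q' := derive1 _ t; set g' := derive1 _ t.
rewrite (dot_diff q.1 g.1 q'.2 g'.2).
apply: (le_trans (ler_normB _ _)).
have b1 : `|q.1 - g.1| <= dl * 2^-1 ^+ m.
  rewrite distrC; apply: (le_trans (phase_fst_norm (g - q))).
  apply: (le_trans (interp_defect t x1 y1)).
  by rewrite exprS; apply: eqW; field.
have b2 : `|q'.2| <= 1 / 2.
  apply: (le_trans (phase_snd_norm q')); apply: (le_trans (derive1_interp t y1)).
  by have [_ h _] := eta_small; have := dl4; lra.
have b3 : `|g.1| <= 2.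
  have := displacement x1 (interp_core t x1); rewrite -/g => h.
  have h' := le_trans (phase_fst_norm (g - interp x t)) h.
  have h2 := le_trans (phase_fst_norm (interp x t - x)) (interp_near t x1).
  have := ler_normD (g.1 - (interp x t).1) ((interp x t).1 - x.1 + x.1).
  have := ler_normD ((interp x t).1 - x.1) x.1.
  rewrite subrK subrK; have [k1 k2 _] := eta_small; have := dl4; move: h' h2 => /=; lra.
have b4 : `|g'.2 - q'.2| <= 4 * dl * 2^-1 ^+ m.
  by apply: (le_trans (phase_snd_norm (g' - q'))); exact: derive1_interp_defect.
have d0 : 0 <= d%:R :> R by [].
have m1 : `|dot (q.1 - g.1) q'.2| <= d%:R * (dl * 2^-1 ^+ m * (1 / 2)).
  by apply: (le_trans (dot_bound _ _)); rewrite ler_wpM2l // ler_pM.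
have m2 : `|dot g.1 (g'.2 - q'.2)| <= d%:R * (2 * (4 * dl * 2^-1 ^+ m)).
  by apply: (le_trans (dot_bound _ _)); rewrite ler_wpM2l // ler_pM.
apply: (le_trans (lerD m1 m2)).
have dp : 0 <= d%:R * 2^-1 ^+ m :> R by rewrite mulr_ge0.
have : dl * (d%:R * 2^-1 ^+ m) <= 1 / 4 * (d%:R * 2^-1 ^+ m) by rewrite ler_wpM2r.
lra.
Qed.

End interpolation.

(** * The almost invariant energy *)

Definition ray (R : realType) (d : nat) (x : phase R d) (t : R) : phase R d :=
  step t *: ((x.1, fracv x.2) : phase R d).

Lemma C1Zstep (R : realType) (V : normedModType R) (v : V) :
  C1 (fun t : R => step t *: v) /\
  derive1 (fun t : R => step t *: v) = fun t => step' t *: v.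
Proof.
have hs : C1 (@step R : R -> R^o) /\ derive1 (@step R : R -> R^o) = @step' R.
  by apply: C1_is_derive; [exact: step_is_derive|exact: step'_continuous].
have cZ : continuous (fun t : R => step' t *: v).
  by move=> t; apply: cvgZr_tmp; exact: step'_continuous.
have hC := C1Zl v hs.1.
split=> //; apply/funext => t.
have lim : h^-1 *: (step (h *: 1 + t) *: v - step t *: v) @[h --> 0^'] --> step' t *: v.
  have -> : (fun h => h^-1 *: (step (h *: 1 + t) *: v - step t *: v)) =
      (fun h => (h^-1 *: (step (h *: 1 + t) - step t)) *: v).
    by apply/funext => h; rewrite -scalerBl scalerA.
  apply: cvgZr_tmp; have ds := step_is_derive t.
  by rewrite -(derive_val (is_derive := ds)); exact: (hs.1.1 t).
by rewrite derive1E; exact: cvg_lim.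
Qed.

Lemma drift_arith (R : realType) (a b s a' b' t q : R) :
  a + b + - s = a' + b' + - t -> q - (s - t) - (b' - (a - a')) = q - b.
Proof. by move=> E; lra. Qed.

Lemma sub_via (V : zmodType) (a b p q : V) : a - b = (a - p - (b - q)) + (p - q).
Proof. by rewrite opprB -addrA [q - b + _]addrC !subrKA. Qed.

Lemma balance_arith (R : realType) (p g c x : R) :
  p - (g - c) = p - g + (c - x) + x.
Proof. by ring. Qed.

Lemma density_arith (R : realType) (d : nat) (u u' w w' x x' s s2 J : 'rV[R]_d) :
  dot u u' - dot w w' + (dot x x' - dot J u') + (dot s s2 + dot x (w' + - x')) =
  dot (u - J) u' - dot (w - x) w' + dot s s2.
Proof. by rewrite !dotDl dotDr !dotNl dotNr; ring. Qed.

(** Two integrations by parts with equal boundary terms: those of J . P.2 and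
    of c.1 . (g.2 - c.2). In the combination of actions they leave the main
    term c.1' . (g.2 - c.2) and two products of small factors. Here P goes
    from the end of c to the end of g, modulo the lattice. *)
Lemma action_balance (R : realType) (d : nat) (P g c : R -> phase R d) (J : 'rV[R]_d) :
  C1 P -> C1 g -> C1 c -> (c 0).1 = 0 -> (c 1).1 = J ->
  (P 1).2 - (P 0).2 = (g 1).2 - (c 1).2 ->
  exists Psi : R -> R, [/\ cont_on 0 1 Psi,
    loop_action P - (loop_action g - loop_action c) = integ 0 1 Psi &
    forall t, Psi t = dot ((P t).1 - J) (derive1 P t).2
      - dot ((g t).1 - (c t).1) (derive1 g t).2
      + dot (derive1 c t).1 ((g t).2 - (c t).2)].
Proof.
move=> PC gC cC c01 c11 shift.
have [c1C c1E] := C1_fst cC; have [c2C c2E] := C1_snd cC.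
have [g2C g2E] := C1_snd gC; have [P2C P2E] := C1_snd PC.
have [JC JE] := C1_cst J.
have [nC nE] := C1N c2C.
have [ZC ZE] := C1D g2C nC.
pose E1 (t : R) := dot (derive1 (fun _ : R => J) t) (P t).2 +
    dot J (derive1 (fun t => (P t).2) t).
pose E2 (t : R) := dot (derive1 (fun t => (c t).1) t) ((g t).2 + - (c t).2) +
    dot (c t).1 (derive1 (fun t => (g t).2 + - (c t).2) t).
have cP : cont_on 0 1 (action_density P) by move=> t _; exact: action_density_continuous.
have cg : cont_on 0 1 (action_density g) by move=> t _; exact: action_density_continuous.
have cc : cont_on 0 1 (action_density c) by move=> t _; exact: action_density_continuous.
have cE1 : cont_on 0 1 E1.
  move=> t _; apply: continuousD.
    by apply: dot_continuous; [exact: JC.2|exact: (C1_continuous P2C)].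
  by apply: dot_continuous; [exact: cvg_cst|exact: P2C.2].
have cE2 : cont_on 0 1 E2.
  move=> t _; apply: continuousD.
    by apply: dot_continuous; [exact: c1C.2|exact: (C1_continuous ZC)].
  by apply: dot_continuous; [exact: (C1_continuous c1C)|exact: ZC.2].
have I1 : integ 0 1 E1 = dot J (P 1).2 - dot J (P 0).2.
  exact: (integ_FTC ltr01 cE1 (fun t _ => is_derive_dot t JC P2C)).
have I2 : integ 0 1 E2 = dot (c 1).1 ((g 1).2 + - (c 1).2) -
    dot (c 0).1 ((g 0).2 + - (c 0).2).
  exact: (integ_FTC ltr01 cE2 (fun t _ => is_derive_dot t c1C ZC)).
have II : integ 0 1 E1 = integ 0 1 E2.
  by rewrite I1 I2 c01 c11 dot0l subr0 -dotNr -dotDr shift.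
have k1 : cont_on 0 1 (fun t => action_density P t - action_density g t).
  by move=> t h; apply: contB; [exact: cP|exact: cg].
have k2 : cont_on 0 1 (fun t => action_density c t - E1 t).
  by move=> t h; apply: contB; [exact: cc|exact: cE1].
have k3 : cont_on 0 1 (fun t => (action_density P t - action_density g t) +
   (action_density c t - E1 t)).
  by move=> t h; apply: continuousD; [exact: k1|exact: k2].
exists (fun t => (action_density P t - action_density g t) +
   (action_density c t - E1 t) + E2 t); split.
- by move=> t h; apply: continuousD; [exact: k3|exact: cE2].
- rewrite (integD k3 cE2) (integD k1 k2) (integB cP cg) (integB cc cE1) II.
  rewrite (loop_actionE PC) (loop_actionE gC) (loop_actionE cC).
  exact: balance_arith.
move=> t; rewrite /E1 /E2 ZE nE g2E c2E c1E P2E JE /action_density dot0l add0r.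
exact: density_arith.
Qed.

Lemma sub_swap (V : zmodType) (a b p q : V) : a - b = p - q -> a - p = b - q.
Proof. by move=> h; rewrite -[a - p](subrKA b) h addrC subrKA. Qed.

Lemma step_continuous (R : realType) : continuous (@step R).
Proof.
by move=> t; have [ds _] := step_is_derive t; exact: (@derivable_continuous R R^o).
Qed.

Lemma step_moment_continuous (R : realType) (lo q e : R) :
  cont_on 0 1 (fun t : R => step' t * (lo * step t - q) - e).
Proof.
move=> t _; apply: contB; last exact: cvg_cst.
apply: continuousM; first exact: step'_continuous.
apply: contB; last exact: cvg_cst.
by apply: continuousM; [exact: cvg_cst|exact: step_continuous].
Qed.

(** The substitution s = step t in the integral of lo s - q over [0, 1]. *)
Lemma step_moment (R : realType) (lo q e : R) :
  integ 0 1 (fun t => step' t * (lo * step t - q) - e) = lo / 2 - q - e.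
Proof.
pose K (t : R) := lo / 2 * (step t * step t) - q * step t - e * t.
have dK (t : R) : is_derive t 1 K (step' t * (lo * step t - q) - e).
  have ds := step_is_derive t; have dsq := is_deriveM ds ds.
  have := is_deriveB (is_deriveB (is_deriveZ (lo / 2) dsq) (is_deriveZ q ds))
    (is_deriveZ e (is_derive_id t (1 : R))).
  move/is_derive_eq; apply; rewrite /GRing.scale /=.
  by generalize (step t) (step' t) => a b; field.
rewrite (integ_FTC ltr01 (@step_moment_continuous R lo q e) (fun t _ => dK t)) /K.
have [-> _] := step_ge1 (lexx (1 : R)).
by have [-> _] := step_le0 (lexx (0 : R)); ring.
Qed.

Lemma moment_arith (R : realType) (p a b e : R) : a <= b -> - e <= p - b -> a - e <= p.
Proof. by move=> *; lra. Qed.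

Lemma moment_arith' (R : realType) (p a b e : R) : b <= a -> p - b <= e -> p <= a + e.
Proof. by move=> *; lra. Qed.

Section energy.
Variables (R : realType) (d : nat) (f : phase R d -> phase R d)
  (fC : cphase R d -> cphase R d) (dl eta : R) (m : nat).
Hypotheses (dl0 : 0 < dl) (dl4 : dl <= 1 / 4) (eta0 : 0 < eta) (m4 : (4 <= m)%N)
  (small : 20 * expR 1 * m%:R * eta <= dl).
Hypothesis nearid : forall (x : phase R d) (z : (cphase R d : normedModType R[i])),
  `|x.1| <= 1 -> cnorm (z - cpair x) <= 2 * dl ->
  differentiable fC z /\ cnorm (fC z - z) <= eta.
Hypothesis compat : forall x : phase R d, `|x.1| < 2 -> fC (cpair x) = cpair (f x).
Hypothesis fC1 : forall c : R -> phase R d,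
  C1 c -> (forall t : R, `|(c t).1| < 2) -> C1 (fun t => f (c t)).
Hypothesis fper : forall (x y : phase R d), `|x.1| < 2 -> same_point x y ->
  (f x).1 = (f y).1 /\ (f x).2 - (f y).2 = x.2 - y.2.
Hypothesis fexact : forall c0 c1 c2 : R -> phase R d,
  [/\ C1 c0, C1 c1 & C1 c2] ->
  (forall t : R, [/\ `|(c0 t).1| < 2, `|(c1 t).1| < 2 & `|(c2 t).1| < 2]) ->
  [/\ same_point (c0 1) (c1 0), same_point (c1 1) (c2 0) & same_point (c2 1) (c0 0)] ->
  loop_action (fun t => f (c0 t)) + loop_action (fun t => f (c1 t)) +
    loop_action (fun t => f (c2 t)) =
  loop_action c0 + loop_action c1 + loop_action c2.
Implicit Types (x y : phase R d).

Let interp := interp f m.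

(** The action of the arc from x to f x, corrected by the change of action
    that f produces on the segment from the origin to x. When f is the time
    one map of a Hamiltonian flow, this is the Hamiltonian up to a constant. *)
Definition energy x : R := loop_action (interp x) -
  (loop_action (fun t => f (ray x t)) - loop_action (ray x)).

Lemma ray_C1 x : C1 (ray x).
Proof. exact: (C1Zstep _).1. Qed.

Lemma ray_core x (t : R) : `|x.1| <= 1 -> `|(ray x t).1| <= 1.
Proof.
move=> x1; have [/andP[a b] _] := step_bound t.
by rewrite /ray /= normrZ ger0_norm // -[leRHS]mulr1 ler_pM.
Qed.

Lemma ray_region x (t : R) : `|x.1| <= 1 -> `|(ray x t).1| < 2.
Proof. by move=> x1; have := ray_core t x1; lra. Qed.

Lemma f_ray_C1 x : `|x.1| <= 1 -> C1 (fun t => f (ray x t)).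
Proof. by move=> x1; apply: fC1; [exact: ray_C1|move=> t; exact: ray_region]. Qed.

Lemma ray0 x : ray x 0 = 0.
Proof. by rewrite /ray (step_le0 (lexx 0)).1 scale0r. Qed.

Lemma ray1 x : ray x 1 = (x.1, fracv x.2).
Proof. by rewrite /ray (step_ge1 (lexx 1)).1 scale1r. Qed.

(** The segment to x, the arc from x to f x and the reversed segment from f x
    form a loop on the torus. Exactness on this loop rewrites the difference
    of energies as the difference between the actions of the interpolating arc
    of f x and of the image of the interpolating arc of x. *)
Lemma energy_drift x : `|x.1| <= 1 -> `|(f x).1| <= 1 ->
  `|energy (f x) - energy x| <= 9 * d%:R * 2^-1 ^+ m.
Proof.
move=> x1 y1.
have [rC rE] := loop_action_rev (ray_C1 (f x)).
have [sC sE] := loop_action_rev (f_ray_C1 y1).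
have E : loop_action (fun t => f (ray x t)) + loop_action (fun t => f (interp x t)) +
    loop_action (fun t => f (ray (f x) (1 - t))) =
  loop_action (ray x) + loop_action (interp x) + loop_action (fun t => ray (f x) (1 - t)).
  apply: fexact.
  - by split; [exact: ray_C1|exact: interp_C1|exact: rC].
  - move=> t; split; [exact: ray_region| |exact: ray_region].
    exact: (interp_region dl0 dl4 eta0 m4 small nearid compat).
  - rewrite subrr subr0 !ray0 !ray1 /interp interp0 (interp1 _ m4); split; split=> //=.
    + by rewrite -opprB; apply: ZvecN; exact: fracv_Zvec.
    + exact: fracv_Zvec.
    + by rewrite subrr; exact: Zvec0.
have EE : energy (f x) - energy x = loop_action (interp (f x)) -
    loop_action (fun t => f (interp x t)).
  apply: drift_arith.
  exact: etrans (etrans (congr1 (fun w => loop_action (fun t => f (ray x t)) +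
    loop_action (fun t => f (interp x t)) + w) (esym sE)) E)
    (congr1 (fun w => loop_action (ray x) + loop_action (interp x) + w) rE).
rewrite EE.
exact: (action_interp_defect dl0 dl4 eta0 m4 small nearid compat fC1 x1 y1).
Qed.

(** The displacement f - id is holomorphic and bounded by eta on a ball of
    radius 2 dl, hence Lipschitz with a constant at most 1. *)
Lemma f_ray_lipschitz x (s t : R) : `|x.1| <= 1 -> `|s - t| <= dl ->
  `|f (ray x s) - f (ray x t)| <= 4 * `|s - t|.
Proof.
move=> x1 st.
have cst : `|ray x s - ray x t| <= 2 * `|s - t|.
  rewrite /ray -scalerBl normrZ; apply: le_trans (step_lipschitz s t).
  rewrite -[leRHS]mulr1 ler_wpM2l // prod_normE /= ge_max x1.
  exact: fracv_bound.
have cdl : `|ray x s - ray x t| <= 2 * dl by lra.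
have d20 : 0 < 2 * dl by have := dl0; lra.
have := @schwarz R _ _ _ _ (fun z => fC z - z) (cpair (ray x t)) (2 * dl) eta
  (pair_coordinates R d) d20 _ _ (cpair (ray x s)).
rewrite -cpairB cnorm_cpair !compat ?ray_region // -!cpairB cnorm_cpair.
move=> H.
have {}H : `|f (ray x s) - ray x s - (f (ray x t) - ray x t)| <=
    2 * eta / (2 * dl) * `|ray x s - ray x t|.
  apply: H; last exact: cdl.
    move=> z hz; have [dz _] := nearid (ray_core t x1) hz.
    exact: differentiableB.
  by move=> z hz; exact: (nearid (ray_core t x1) hz).2.
rewrite (sub_via (f (ray x s)) (f (ray x t)) (ray x s) (ray x t)).
apply: (le_trans (ler_normD _ _)).
have : 2 * eta / (2 * dl) * `|ray x s - ray x t| <= 1 * `|ray x s - ray x t|.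
  rewrite ler_wpM2r // ler_pdivrMr //.
  by have := step_le_radius eta0 m4 small; have := eta0; lra.
lra.
Qed.

Definition angle_shift x (s : R) : 'rV[R]_d :=
  (f (s *: ((x.1, fracv x.2) : phase R d))).2 - s *: fracv x.2.

(** The main term is the work of the angle shift along the segment. The first
    error is the product of the length and of the speed of the arc from x to f
    x; the second one comes from the change p0 of the actions along the
    segment. *)
Lemma energy_integral x (p0 : R) : `|x.1| <= 1 ->
  (forall s, 0 <= s <= 1 ->
    `|(f (s *: ((x.1, fracv x.2) : phase R d))).1 - s *: x.1| <= p0) ->
  exists Psi : R -> R, [/\ cont_on 0 1 Psi, energy x = integ 0 1 Psi &
    forall t : R, `|Psi t - step' t * dot x.1 (angle_shift x (step t))| <=
      d%:R * (5 * expR 1 * eta * (40 * expR 1 * eta)) + d%:R * (p0 * 4)].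
Proof.
move=> x1 Hp.
have [|||Psi [cPsi E HPsi]] := @action_balance R d (interp x) (fun t => f (ray x t))
  (ray x) x.1 (interp_C1 f m x) (f_ray_C1 x1) (ray_C1 x).
- by rewrite ray0.
- by rewrite ray1.
- rewrite ray1 /interp interp0 (interp1 _ m4) /=.
  have x2 : `|x.1| < 2 by lra.
  have xx : same_point x (x.1, fracv x.2) by split=> //=; exact: fracv_Zvec.
  have [_ /= h] := fper x2 xx.
  exact: sub_swap.
exists Psi; split=> // t.
have -> : step' t * dot x.1 (angle_shift x (step t)) =
    dot (derive1 (ray x) t).1 ((f (ray x t)).2 - (ray x t).2).
  by rewrite /ray (C1Zstep _).2 /= dotZl.
rewrite HPsi addrK.
have d0 : 0 <= d%:R :> R by [].
apply: (le_trans (ler_normB _ _)); apply: lerD.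
  apply: (le_trans (dot_bound _ _)); rewrite ler_wpM2l // ler_pM //.
    apply: (le_trans (phase_fst_norm (interp x t - x))).
    exact: (interp_near dl0 dl4 eta0 m4 small nearid compat).
  apply: (le_trans (phase_snd_norm (derive1 (interp x) t))).
  exact: (derive1_interp dl0 dl4 eta0 m4 small nearid compat).
apply: (le_trans (dot_bound _ _)); rewrite ler_wpM2l // ler_pM //.
  by apply: Hp; have [] := step_bound t.
apply: (le_trans (phase_snd_norm (derive1 (fun t => f (ray x t)) t))).
apply: (@derive1_norm_bound _ _ _ _ _ dl dl0); first exact: (f_ray_C1 x1).1.
by move=> s st; apply: f_ray_lipschitz.
Qed.

Let err p0 := d%:R * (5 * expR 1 * eta * (40 * expR 1 * eta)) + d%:R * (p0 * 4).

Lemma energy_ge x (p0 lo q0 : R) : `|x.1| <= 1 ->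
  (forall s, 0 <= s <= 1 ->
    `|(f (s *: ((x.1, fracv x.2) : phase R d))).1 - s *: x.1| <= p0) ->
  (forall s, 0 <= s <= 1 -> lo * s - q0 <= dot x.1 (angle_shift x s)) ->
  lo / 2 - q0 - err p0 <= energy x.
Proof.
move=> x1 Hp Hq; have [Psi [cPsi -> HPsi]] := energy_integral x1 Hp.
rewrite -step_moment.
apply: integ_le; [exact: step_moment_continuous|exact: cPsi|move=> t _].
have [sb /andP[s0 _]] := step_bound t.
have := HPsi t; rewrite -/(err p0) ler_norml => /andP[h _].
exact: (moment_arith (ler_wpM2l s0 (Hq _ sb)) h).
Qed.

Lemma energy_le x (p0 hi : R) : `|x.1| <= 1 ->
  (forall s, 0 <= s <= 1 ->
    `|(f (s *: ((x.1, fracv x.2) : phase R d))).1 - s *: x.1| <= p0) ->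
  (forall s, 0 <= s <= 1 -> dot x.1 (angle_shift x s) <= hi) ->
  energy x <= hi + err p0.
Proof.
move=> x1 Hp Hq; have [Psi [cPsi -> HPsi]] := energy_integral x1 Hp.
have -> : hi + err p0 = 0 / 2 - (- hi) - (- err p0) by rewrite mul0r sub0r !opprK.
rewrite -step_moment.
apply: integ_le; [exact: cPsi|exact: step_moment_continuous|move=> t _].
have [sb /andP[s0 _]] := step_bound t.
have := HPsi t; rewrite -/(err p0) ler_norml => /andP[_ h].
rewrite mul0r sub0r !opprK.
exact: (moment_arith' (ler_wpM2l s0 (Hq _ sb)) h).
Qed.

End energy.

(** * Confinement of the action *)

Lemma dot_self_ge (R : realType) (d : nat) (u : 'rV[R]_d) : `|u| ^+ 2 <= dot u u.
Proof.
have [E|[i E]] := rv_norm_attained u.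
  by rewrite E expr0n /=; apply: sumr_ge0 => i _; rewrite -expr2 sqr_ge0.
rewrite E real_normK ?num_real // expr2 /dot (bigD1 i) //= lerDl.
by apply: sumr_ge0 => j _; rewrite -expr2 sqr_ge0.
Qed.

Lemma next_le (R : realType) (h h' B c D : R) : `|h' - h| <= D -> h <= B + c -> h' <= B + (c + D).
Proof. by rewrite ler_norml => /andP[_]; lra. Qed.

Lemma confinement_arith (R : realType) (a b q0 err r0 N D v v0 h h0 jj : R) :
  0 < a -> 0 <= v ->
  h <= h0 + jj * D -> a / 2 * v ^+ 2 - q0 - err <= h ->
  h0 <= b * v0 ^+ 2 + q0 + err -> b * v0 ^+ 2 <= b * r0 ^+ 2 ->
  jj <= N -> 0 <= D ->
  b * r0 ^+ 2 + 2 * q0 + 2 * err + N * D < a / 8 -> v < 1 / 2.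
Proof.
move=> a0 v0' Hy Hl H0 hr jN D0 budget.
have jd : jj * D <= N * D by rewrite ler_wpM2r.
rewrite ltNge; apply/negP => big.
have : (1 / 2) ^+ 2 <= v ^+ 2 by rewrite lerXn2r ?nnegrE.
rewrite -(ler_pM2l (x := a / 2)); last by lra.
have : a / 2 * (1 / 2) ^+ 2 = a / 8 by field.
lra.
Qed.

Lemma half_le1 (R : realType) (v : R) : v < 1 / 2 -> v <= 1.
Proof. by move=> h; lra. Qed.

Lemma next_region (R : realType) (v w dl eta h : R) : h <= eta -> v < 1 / 2 ->
  20 * eta <= dl -> dl <= 1 / 4 -> 0 < eta -> w <= h + v -> w <= 1.
Proof. by move=> *; lra. Qed.

Section stability.
Variables (R : realType) (d : nat) (f : phase R d -> phase R d)
  (fC : cphase R d -> cphase R d) (dl eta : R) (m : nat).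
Hypotheses (dl0 : 0 < dl) (dl4 : dl <= 1 / 4) (eta0 : 0 < eta) (m4 : (4 <= m)%N)
  (small : 20 * expR 1 * m%:R * eta <= dl).
Hypothesis nearid : forall (x : phase R d) (z : (cphase R d : normedModType R[i])),
  `|x.1| <= 1 -> cnorm (z - cpair x) <= 2 * dl ->
  differentiable fC z /\ cnorm (fC z - z) <= eta.
Hypothesis compat : forall x : phase R d, `|x.1| < 2 -> fC (cpair x) = cpair (f x).
Hypothesis fC1 : forall c : R -> phase R d,
  C1 c -> (forall t : R, `|(c t).1| < 2) -> C1 (fun t => f (c t)).
Hypothesis fper : forall (x y : phase R d), `|x.1| < 2 -> same_point x y ->
  (f x).1 = (f y).1 /\ (f x).2 - (f y).2 = x.2 - y.2.
Hypothesis fexact : forall c0 c1 c2 : R -> phase R d,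
  [/\ C1 c0, C1 c1 & C1 c2] ->
  (forall t : R, [/\ `|(c0 t).1| < 2, `|(c1 t).1| < 2 & `|(c2 t).1| < 2]) ->
  [/\ same_point (c0 1) (c1 0), same_point (c1 1) (c2 0) & same_point (c2 1) (c0 0)] ->
  loop_action (fun t => f (c0 t)) + loop_action (fun t => f (c1 t)) +
    loop_action (fun t => f (c2 t)) =
  loop_action c0 + loop_action c1 + loop_action c2.
Variables (a b p0 q0 : R).
Hypothesis (a0 : 0 < a) (b0 : 0 <= b).
Hypothesis kick : forall x : phase R d, `|x.1| <= 1 -> `|(f x).1 - x.1| <= p0.
Hypothesis twist_ge : forall (x : phase R d) (s : R), `|x.1| <= 1 -> 0 <= s <= 1 ->
  a * dot x.1 x.1 * s - q0 <= dot x.1 ((f (s *: x)).2 - s *: x.2).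
Hypothesis twist_le : forall (x : phase R d) (s : R), `|x.1| <= 1 -> 0 <= s <= 1 ->
  dot x.1 ((f (s *: x)).2 - s *: x.2) <= b * `|x.1| ^+ 2 + q0.

Let err := d%:R * (5 * expR 1 * eta * (40 * expR 1 * eta)) + d%:R * (p0 * 4).
Let H := energy f m.

Let kick_ray (x : phase R d) (x1 : `|x.1| <= 1) (s : R) : 0 <= s <= 1 ->
  `|(f (s *: ((x.1, fracv x.2) : phase R d))).1 - s *: x.1| <= p0.
Proof.
move=> /andP[s0 s1]; apply: (kick (x := s *: ((x.1, fracv x.2) : phase R d))).
by rewrite /= normrZ ger0_norm // -[leRHS]mulr1 ler_pM.
Qed.

Lemma H_ge (x : phase R d) : `|x.1| <= 1 -> a / 2 * `|x.1| ^+ 2 - q0 - err <= H x.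
Proof.
move=> x1.
have := energy_ge dl0 dl4 eta0 m4 small nearid compat fC1 fper x1 (kick_ray x1)
  (fun s hs => twist_ge (x := (x.1, fracv x.2)) x1 hs).
apply: le_trans; rewrite lerD2r lerD2r mulrAC ler_pM2r ?invr_gt0 //.
by rewrite ler_pM2l // dot_self_ge.
Qed.

Lemma H_le (x : phase R d) : `|x.1| <= 1 -> H x <= b * `|x.1| ^+ 2 + q0 + err.
Proof.
move=> x1.
exact: (energy_le dl0 dl4 eta0 m4 small nearid compat fC1 fper x1 (kick_ray x1)
  (fun s hs => twist_le (x := (x.1, fracv x.2)) x1 hs)).
Qed.

(** The energy is at most b r0^2 at the beginning and at least a / 8 when |J|
    reaches 1/2, up to errors; between the two it changes by at most 9 d 2^-m
    at each step. The action cannot jump over the annulus 1/2 <= |J| <= 1,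
    since one step moves it by at most eta, so that the energy estimates
    remain available. *)
Lemma action_confined (x0 : phase R d) (r0 N : R) : `|x0.1| < r0 -> r0 <= 1 / 2 ->
  b * r0 ^+ 2 + 2 * q0 + 2 * err + N * (9 * d%:R * 2^-1 ^+ m) < a / 8 ->
  forall j : nat, j%:R <= N -> `|(iter j f x0).1| < 1 / 2.
Proof.
move=> x0r r0h budget.
have ds0 : 0 <= 9 * d%:R * 2^-1 ^+ m :> R.
  by rewrite mulr_ge0 ?exprn_ge0 ?invr_ge0 // mulr_ge0.
have x01 : `|x0.1| <= 1 by lra.
have H0 := H_le x01.
have hr : b * `|x0.1| ^+ 2 <= b * r0 ^+ 2.
  by rewrite ler_wpM2l // lerXn2r ?nnegrE // ?(ltW x0r) // (le_trans _ (ltW x0r)).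
suff K (j : nat) : j%:R <= N -> `|(iter j f x0).1| < 1 / 2 /\
    H (iter j f x0) <= H x0 + j%:R * (9 * d%:R * 2^-1 ^+ m).
  by move=> j /K[].
elim: j => [|j IH] jN; first by rewrite /= mul0r addr0; split=> //; lra.
have [|xj Hj] := IH; first by apply: le_trans jN; rewrite ler_nat.
set x := iter j f x0 in xj Hj; rewrite iterS -/x.
have x1 : `|x.1| <= 1 by exact: half_le1.
have dx : `|f x - x| <= eta.
  apply: (displacement dl4 nearid compat x1); rewrite subrr normr0.
  by rewrite mulr_ge0 // ltW.
have eta20 := step_le_radius eta0 m4 small.
have y1 : `|(f x).1| <= 1.
  have h := le_trans (phase_fst_norm (f x - x)) dx.
  have := ler_normD ((f x).1 - x.1) x.1; rewrite subrK.
  exact: (next_region h xj eta20 dl4 eta0).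
have drift := energy_drift dl0 dl4 eta0 m4 small nearid compat fC1 fexact x1 y1.
have Hy : H (f x) <= H x0 + j.+1%:R * (9 * d%:R * 2^-1 ^+ m).
  rewrite -addn1 natrD mulrDl mul1r.
  exact: next_le drift Hj.
split; first exact: (confinement_arith a0 (normr_ge0 _) Hy (H_ge y1) H0 hr jN ds0 budget).
exact: Hy.
Qed.

End stability.

(** * Lattice translations and second differences *)

Lemma lift_differentiable (K : numFieldType) (V : normedModType K)
    (aC bC : V * V -> V) (oC : V -> V) (e : K) (z : V * V) :
  differentiable aC z -> differentiable bC z -> differentiable oC z.1 ->
  differentiable (fun z : V * V => (z.1 + e *: aC z, z.2 + oC z.1 + e *: bC z)) z.
Proof.
move=> da db dom.
have d1 := @fst_differentiable K V V z; have d2 := @snd_differentiable K V V z.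
have d3 : differentiable (oC \o fst) z by exact: differentiable_comp.
apply: (@differentiable_pair _ _ _ _ (fun z : V * V => z.1 + e *: aC z)
   (fun z : V * V => z.2 + oC z.1 + e *: bC z)).
  by apply: differentiableD => //; exact: differentiableZ.
apply: differentiableD; last exact: differentiableZ.
by apply: differentiableD.
Qed.

Lemma same_pointC (R : realType) (d : nat) (x y : phase R d) :
  same_point x y -> same_point y x.
Proof. by move=> [e z]; split=> //; rewrite -opprB; exact: ZvecN. Qed.

Lemma same_point_trans (R : realType) (d : nat) (y x z : phase R d) :
  same_point x y -> same_point y z -> same_point x z.
Proof.
move=> [e1 z1] [e2 z2]; split; first by rewrite e1.
by rewrite -(subrKA y.2); exact: ZvecD.
Qed.

Lemma near_arith (R : realType) (u v s : R) : u <= s / 2 -> v <= s / 4 -> 0 < s -> u + v <= s.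
Proof. by move=> *; lra. Qed.

Lemma near_arith' (R : realType) (u v s : R) : u <= s / 4 -> v <= s / 4 -> u + v <= s / 2.
Proof. by move=> *; lra. Qed.

(** Translations that act trivially on the torus. *)
Definition lattice (R : realType) (d : nat) (dx : phase R d) : Prop :=
  dx.1 = 0 /\ Zvec dx.2.

Lemma lattice_sub (R : realType) (d : nat) (x y : phase R d) :
  same_point x y -> lattice (x - y).
Proof. by move=> [e z]; split=> //=; rewrite e subrr. Qed.

Lemma latticeD (R : realType) (d : nat) (x y : phase R d) :
  lattice x -> lattice y -> lattice (x + y).
Proof. by move=> [e z] [e' z']; split; [rewrite /= e e' addr0|exact: ZvecD]. Qed.

Lemma glue (V : zmodType) (u v w : V) : u + w + (v - u) = v + w.
Proof. by rewrite addrC addrA subrK. Qed.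

Lemma second_difference_id (V : zmodType) (a a' b b' y x v : V) :
  a - a' - (b - b') = a - (y + v) - (a' - y) - (b - (x + v) - (b' - x)).
Proof.
have H (p q z : V) : p - (z + v) - (q - z) = p - q - v.
  by rewrite opprB opprD -addrA addrACA addNr add0r [- v - q]addrC addrA.
by rewrite !H [in RHS]opprB [RHS]addrA subrK.
Qed.

Lemma imvec_le (R : realType) (d : nat) (w : 'rV[R[i]]_d) : `|imvec w| <= cnorm w.
Proof.
apply: rv_norm_lub => [|i]; first exact: cnorm_ge0.
rewrite mxE; apply: le_trans (coord_le (rv_coordinates R d) i w).
exact: Im_le_cnorm.
Qed.

Lemma imvecB (R : realType) (d : nat) (w w' : 'rV[R[i]]_d) :
  imvec (w - w') = imvec w - imvec w'.
Proof. by apply/rowP => i; rewrite !mxE; case: (w 0 i); case: (w' 0 i). Qed.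

Lemma inD_arith (R : realType) (u v s rad : R) : u <= 2 * rad -> rad <= s / 4 -> v <= s / 2 ->
  u + v <= s.
Proof. by move=> *; lra. Qed.

Lemma inD_arith' (R : realType) (u r rad : R) : u <= 2 * rad -> rad <= r / 2 -> u <= r.
Proof. by move=> *; lra. Qed.

Lemma double_le (R : realType) (u rad : R) : 0 <= u -> u <= rad -> u <= 2 * rad.
Proof. by move=> *; lra. Qed.

Lemma add_le (R : realType) (u v rad : R) : u <= rad -> v <= rad -> u + v <= 2 * rad.
Proof. by move=> *; lra. Qed.

Lemma half_le (R : realType) (u s : R) : 0 < s -> u < s / 2 -> u <= s.
Proof. by move=> *; lra. Qed.

Lemma add_differentiable (K : numFieldType) (V W : normedModType K) (u : V -> W) (y v : V) :
  differentiable u (y + v) -> differentiable (fun y => u (y + v)) y.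
Proof. by move=> du; apply: (@differentiable_comp _ _ _ _ (fun y : V => y + v) u). Qed.

Lemma displacement_differentiable (K : numFieldType) (V : normedModType K) (u : V -> V) (z : V) :
  differentiable u z -> differentiable (fun z => u z - z) z.
Proof. by move=> du; apply: differentiableB. Qed.

(** The increment of u by v is holomorphic in the base point, and small with v
    by the Schwarz lemma; a second use of the Schwarz lemma bounds its
    variation with the base point. *)
Lemma second_difference (R : realType) (V W : normedModType R[i]) (I : Type)
    (l : I -> W -> CK R) (u : V -> W) (x : V) (rad B : R) :
  coordinates l -> 0 < rad ->
  (forall z, cnorm (z - x) <= 2 * rad -> differentiable u z) ->
  (forall z, cnorm (z - x) <= 2 * rad -> cnorm (u z) <= B) ->
  forall y v, cnorm (y - x) <= rad -> cnorm v <= rad ->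
  cnorm (u (y + v) - u y - (u (x + v) - u x)) <=
    2 * (2 * B / rad * cnorm v) / rad * cnorm (y - x).
Proof.
move=> cl rad0 du bu y v yx vr.
have near z : cnorm (z - x) <= rad -> cnorm (z - x) <= 2 * rad.
  by move=> h; apply: double_le h; exact: cnorm_ge0.
have nearv z : cnorm (z - x) <= rad -> cnorm (z + v - x) <= 2 * rad.
  by move=> h; rewrite addrAC; apply: (le_trans (cnormD _ _)); exact: add_le.
apply: (@schwarz R V W I l (fun y => u (y + v) - u y) x rad _ cl rad0) => //.
  move=> z hz; apply: differentiableB; last by apply: du; exact: near.
  by apply: add_differentiable; apply: du; exact: nearv.
move=> z hz.
have nz w : cnorm (w - z) <= rad -> cnorm (w - x) <= 2 * rad.
  by move=> h; apply: (le_trans (cnorm_tri z _ _)); exact: add_le.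
have := @schwarz R V W I l u z rad B cl rad0 (fun w h => du w (nz w h))
  (fun w h => bu w (nz w h)) (z + v).
by rewrite addrC addKr; apply.
Qed.

(** * Iterates, trajectories and homotheties *)

Section iterates.
Variables (R : realType) (d : nat) (F : phase R d -> phase R d) (D : set (phase R d)).
Implicit Types (x y : phase R d).

Definition orbit_in (k : nat) x := forall j, (j < k)%N -> D (iter j F x).

Lemma orbit_inW k x : orbit_in k.+1 x -> orbit_in k x.
Proof. by move=> h j jk; apply: h; exact: ltnW. Qed.

Lemma orbit_in_last k x : orbit_in k.+1 x -> D (iter k F x).
Proof. by apply. Qed.

Hypothesis FC1 : forall c, C1 c -> (forall t : R, D (c t)) -> C1 (fun t => F (c t)).
Hypothesis Fper : forall x y, D x -> same_point x y ->
  (F x).1 = (F y).1 /\ (F x).2 - (F y).2 = x.2 - y.2.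
Hypothesis Fexact : forall c0 c1 c2 : R -> phase R d,
  [/\ C1 c0, C1 c1 & C1 c2] -> (forall t, [/\ D (c0 t), D (c1 t) & D (c2 t)]) ->
  [/\ same_point (c0 1) (c1 0), same_point (c1 1) (c2 0) & same_point (c2 1) (c0 0)] ->
  loop_action (fun t => F (c0 t)) + loop_action (fun t => F (c1 t)) +
    loop_action (fun t => F (c2 t)) =
  loop_action c0 + loop_action c1 + loop_action c2.

Lemma iter_C1 (k : nat) (c : R -> phase R d) : C1 c -> (forall t, orbit_in k (c t)) ->
  C1 (fun t => iter k F (c t)).
Proof.
elim: k => [|k IH] hc Dc; first exact: hc.
apply: (FC1 (c := fun t => iter k F (c t))).
  by apply: IH hc _ => t; exact: orbit_inW (Dc t).
by move=> t; exact: orbit_in_last (Dc t).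
Qed.

(** Iterates commute with the lattice translations, so the return map descends
    to the torus as long as the orbit stays in D. *)
Lemma iter_per (k : nat) x y : orbit_in k x -> same_point x y ->
  (iter k F x).1 = (iter k F y).1 /\ (iter k F x).2 - (iter k F y).2 = x.2 - y.2.
Proof.
elim: k => [|k IH] Dx sxy; first by split=> //; exact: sxy.1.
have [e1 e2] := IH (orbit_inW Dx) sxy.
have s : same_point (iter k F x) (iter k F y) by split=> //; rewrite e2; exact: sxy.2.
have [f1 f2] := Fper (orbit_in_last Dx) s.
by split; [exact: f1|exact: (etrans f2 e2)].
Qed.

Lemma iter_same (k : nat) x y : orbit_in k x -> same_point x y ->
  same_point (iter k F x) (iter k F y).
Proof.
by move=> Dx sxy; have [e1 e2] := iter_per Dx sxy; split=> //; rewrite e2; exact: sxy.2.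
Qed.

Lemma iter_exact3 (k : nat) (c0 c1 c2 : R -> phase R d) :
  [/\ C1 c0, C1 c1 & C1 c2] ->
  (forall t, [/\ orbit_in k (c0 t), orbit_in k (c1 t) & orbit_in k (c2 t)]) ->
  [/\ same_point (c0 1) (c1 0), same_point (c1 1) (c2 0) & same_point (c2 1) (c0 0)] ->
  loop_action (fun t => iter k F (c0 t)) + loop_action (fun t => iter k F (c1 t)) +
    loop_action (fun t => iter k F (c2 t)) =
  loop_action c0 + loop_action c1 + loop_action c2.
Proof.
elim: k => [|k IH] [h0 h1 h2] Dc [j01 j12 j20]; first by [].
have D0 t : orbit_in k.+1 (c0 t) by have [] := Dc t.
have D1 t : orbit_in k.+1 (c1 t) by have [] := Dc t.
have D2 t : orbit_in k.+1 (c2 t) by have [] := Dc t.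
have D0' t := orbit_inW (D0 t); have D1' t := orbit_inW (D1 t).
have D2' t := orbit_inW (D2 t).
apply: (etrans (Fexact (c0 := fun t => iter k F (c0 t)) (c1 := fun t => iter k F (c1 t))
  (c2 := fun t => iter k F (c2 t)) _ _ _)).
- by split; apply: iter_C1.
- move=> t; split; exact: orbit_in_last.
- by split; apply: iter_same.
- by apply: IH => // t.
Qed.

Variable u : nat -> phase R d.
Hypothesis tu : trajectory F u.

(** A trajectory is given by arbitrary lifts of its points; as points of the
    torus they follow the orbit of the lifted map. *)
Lemma trajectory_shadow (k i : nat) x : orbit_in i x -> same_point x (u k) ->
  same_point (iter i F x) (u (k + i)%N).
Proof.
move=> + sx; elim: i => [|i IH] Dx; first by rewrite addn0.
have s := IH (orbit_inW Dx); rewrite addnS.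
have [e1 e2] := Fper (orbit_in_last Dx) s.
have [t1 t2] := tu (k + i).
apply: (@same_point_trans _ _ (F (u (k + i)%N))); last first.
  by apply: same_pointC.
by split; [exact: e1|rewrite [X in Zvec X]e2; exact: s.2].
Qed.

End iterates.

(** Serves for the passage between the original and the rescaled phase space,
    real and complex alike, whence the general field. *)
Definition affine (K : numFieldType) (V : normedModType K) (s : K) (w v : V) (x : V * V) :
  V * V := (s *: x.1 + w, x.2 + v).

Lemma affine_differentiable (K : numFieldType) (V : normedModType K) (s : K) (w v : V)
  (x : V * V) : differentiable (affine s w v) x.
Proof.
apply: (@differentiable_pair _ _ _ _ (fun x : V * V => s *: x.1 + w)
   (fun x : V * V => x.2 + v)).
  by apply: differentiableD => //; apply: differentiableZ; exact: fst_differentiable.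
by apply: differentiableD => //; exact: snd_differentiable.
Qed.

Section affine_maps.
Variables (R : realType) (d : nat) (s : R) (w v : 'rV[R]_d).

Lemma affineB (x y : phase R d) : affine s w v x - affine s w v y = (s *: (x.1 - y.1), x.2 - y.2).
Proof.
rewrite /affine; congr pair => /=.
  by rewrite opprD addrACA subrr addr0 scalerBr.
by rewrite opprD addrACA subrr addr0.
Qed.

(** The second differences of an affine map vanish. *)
Lemma affine_C1 (c : R -> phase R d) : C1 c -> C1 (fun t => affine s w v (c t)).
Proof.
move=> hc; apply: (@C1_image R _ _ (affine s w v) setT) => //.
  by move=> x _; exact: affine_differentiable.
move=> x _; exists 1, 0; split=> // y h _ _; rewrite !mul0r.
rewrite !affineB /=.
have E (V : zmodType) (p q : V) : p + q - p = q by rewrite addrC addKr.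
by rewrite !E subrr normr0.
Qed.

Lemma affine_derive (c : R -> phase R d) (t : R) : C1 c ->
  (derive1 (fun t => affine s w v (c t)) t).2 = (derive1 c t).2.
Proof.
move=> hc.
have e1 := congr1 (fun g : R -> 'rV[R]_d => g t) (C1_snd (affine_C1 hc)).2.
have [h2 e2] := C1_snd hc.
have e3 := congr1 (fun g : R -> 'rV[R]_d => g t) (C1D h2 (C1_cst v).1).2.
apply: (etrans (esym e1)); apply: (etrans e3).
have e4 := congr1 (fun g : R -> 'rV[R]_d => g t) (C1_cst v).2.
apply: (etrans (congr1 (+%R (derive1 (fun t => (c t).2) t)) e4)).
by apply: (etrans (addr0 _)); exact: (congr1 (fun g : R -> 'rV[R]_d => g t) e2).
Qed.

(** A shift of the actions by w adds the work of w along the curve, which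
    depends on the end points only. *)
Lemma affine_action (c : R -> phase R d) : C1 c ->
  loop_action (fun t => affine s w v (c t)) =
    s * loop_action c + dot w ((c 1).2 - (c 0).2).
Proof.
move=> hc; have ha := affine_C1 hc.
have [K [dK ->]] := action_primitive hc.
pose L t := s * K t + dot w (c t).2.
have dL (t : R) : 0 <= t <= 1 ->
    is_derive t 1 L (action_density (fun t => affine s w v (c t)) t).
  move=> t01; rewrite /action_density affine_derive // /affine /= dotDl dotZl.
  have h1 := is_deriveZ (s : R) (dK t t01).
  have h2 := is_derive_dot t (C1_cst w).1 (C1_snd hc).1.
  rewrite (C1_cst w).2 dot0l add0r in h2.
  have := is_deriveD h1 h2.
  by rewrite (C1_snd hc).2.
rewrite (loop_actionE ha) (@integ_FTC R 0 1 L _ ltr01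
  (fun t _ => action_density_continuous ha (x := t)) dL).
by rewrite /L dotDr dotNr; ring.
Qed.

End affine_maps.

(** * The rescaled return map *)

(** With s the scale and w the centre of the rescaling, the displacement of
    the rescaled map is the displacement of the original one, divided by s in
    the actions. *)
Lemma affine_return (K : numFieldType) (V : normedModType K) (s : K) (w v : V) (Y z : V * V) :
  s != 0 ->
  affine s^-1 (- (s^-1 *: w)) (- v) Y - z =
    (s^-1 *: (Y.1 - (affine s w 0 z).1), Y.2 - (affine s w 0 z).2 - v).
Proof.
move=> s0; rewrite /affine /=; congr pair => /=.
  rewrite scalerBr scalerDr scalerA mulVf // scale1r opprD.
  by rewrite -!addrA; congr (_ + _); rewrite addrC.
by rewrite addr0 addrAC.
Qed.

Lemma affine_compat (R : realType) (d : nat) (s : R) (w v : 'rV[R]_d) (x : phase R d) :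
  affine (s%:C : CK R) (cvec w) (cvec v) (cpair x) = cpair (affine s w v x).
Proof. by rewrite /affine /cpair /= !cvecD cvecZ. Qed.

Lemma conj_differentiable (K : numFieldType) (V : normedModType K) (s s' : K) (w v w' v' : V)
    (G : V * V -> V * V) (z : V * V) :
  differentiable G (affine s w v z) ->
  differentiable (fun z => affine s' w' v' (G (affine s w v z))) z.
Proof.
move=> dG.
have d1 : differentiable (G \o affine s w v) z.
  by apply: differentiable_comp => //; exact: affine_differentiable.
apply: (@differentiable_comp _ _ _ _ (G \o affine s w v) (affine s' w' v')) => //.
exact: affine_differentiable.
Qed.

Lemma affine_same (R : realType) (d : nat) (s : R) (w v : 'rV[R]_d) (x y : phase R d) :
  same_point x y -> same_point (affine s w v x) (affine s w v y).
Proof.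
move=> [e z]; split; first by rewrite /= e.
by rewrite /= opprD addrACA subrr addr0.
Qed.

(** Increments along the three sides are traded for the mismatches at the
    three corners, which maps that commute with lattice translations preserve. *)
Lemma joins_sum (V : zmodType) (p0 p1 q0 q1 r0 r1 : V) :
  (p1 - p0) + (q1 - q0) + (r1 - r0) = (p1 - q0) + (q1 - r0) + (r1 - p0).
Proof.
have swap (x y z t : V) : (x - y) + (z - t) = (x - t) + (z - y).
  by rewrite addrACA [- y - t]addrC -addrACA.
rewrite [X in X + _ = _]swap -[LHS]addrA [X in _ + X = _]swap.
by rewrite addrA.
Qed.

Lemma scale_in (R : realType) (d : nat) (rho A : R) (Istar J : 'rV[R]_d) :
  0 <= rho -> `|J| <= A -> `|rho *: J + Istar - Istar| <= A * rho.
Proof.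
by move=> r0 JA; rewrite addrK normrZ ger0_norm // mulrC ler_wpM2r.
Qed.

Lemma exact_arith (R : realType) (rho A0 A1 A2 B0 B1 B2 D0 D1 D2 E0 E1 E2 : R) : rho != 0 ->
  B0 + B1 + B2 = (rho * A0 + D0) + (rho * A1 + D1) + (rho * A2 + D2) ->
  E0 + E1 + E2 = D0 + D1 + D2 ->
  (rho^-1 * B0 - rho^-1 * E0) + (rho^-1 * B1 - rho^-1 * E1) + (rho^-1 * B2 - rho^-1 * E2) =
  A0 + A1 + A2.
Proof.
move=> r0 eB eE.
transitivity (rho^-1 * ((B0 + B1 + B2) - (E0 + E1 + E2))); first by ring.
by rewrite eB eE; field.
Qed.

Lemma ge_arith (R : realType) (n nu rho s D dq e X : R) :
  - dq <= e -> n * (nu * (rho * s) * D) <= n * X ->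
  n * nu * rho * D * s - dq <= e + n * X.
Proof.
have -> : n * nu * rho * D * s = n * (nu * (rho * s) * D) by ring.
by move=> *; lra.
Qed.

Lemma half_two (R : realType) (v : R) : v < 1 / 2 -> v <= 2.
Proof. by move=> h; lra. Qed.

Lemma half_add (R : realType) (u v s : R) : u <= s / 2 -> v < s / 2 -> u + v < s.
Proof. by move=> *; lra. Qed.

Section resonance.
Variables (R : realType) (d : nat) (Istar : 'rV[R]_d) (n : nat)
  (rho r kap q nu L dl eta : R) (m : nat) (omega : 'rV[R]_d -> 'rV[R]_d)
  (F : phase R d -> phase R d) (FC : cphase R d -> cphase R d) (D : set (phase R d)).
Hypothesis FC1 : forall c, C1 c -> (forall t : R, D (c t)) -> C1 (fun t => F (c t)).
Hypothesis Fper : forall x y, D x -> same_point x y ->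
  (F x).1 = (F y).1 /\ (F x).2 - (F y).2 = x.2 - y.2.
Hypothesis Fexact : forall c0 c1 c2 : R -> phase R d,
  [/\ C1 c0, C1 c1 & C1 c2] -> (forall t, [/\ D (c0 t), D (c1 t) & D (c2 t)]) ->
  [/\ same_point (c0 1) (c1 0), same_point (c1 1) (c2 0) & same_point (c2 1) (c0 0)] ->
  loop_action (fun t => F (c0 t)) + loop_action (fun t => F (c1 t)) +
    loop_action (fun t => F (c2 t)) =
  loop_action c0 + loop_action c1 + loop_action c2.
Hypotheses (n0 : (0 < n)%N) (rho0 : 0 < rho) (kap0 : 0 <= kap) (nu0 : 0 < nu) (L0 : 0 <= L).
Hypothesis orbR : forall x : phase R d, `|x.1 - Istar| <= 2 * rho -> forall k, (k <= n)%N ->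
  [/\ iter k FC (cpair x) = cpair (iter k F x), `|(iter k F x).1 - x.1| <= k%:R * kap
    & D (iter k F x)].
Hypothesis orbC : forall z : (cphase R d : normedModType R[i]),
  cnorm (z.1 - cvec Istar) <= 2 * rho -> `|imvec z.2| <= r / 2 ->
  [/\ differentiable (iter n FC) z, cnorm ((iter n FC z).1 - z.1) <= n%:R * kap &
    cnorm ((iter n FC z).2 - z.2 - cvec (n%:R *: omega Istar)) <= eta].
Hypothesis orbT : forall x : phase R d, `|x.1 - Istar| <= 2 * rho ->
  `|(iter n F x).2 - x.2 - n%:R *: omega x.1| <= q.
Hypothesis convex : forall (J : 'rV[R]_d) (s : R), `|J| <= 1 -> 0 <= s <= 1 ->
  nu * (rho * s) * dot J J <= dot J (omega (rho *: (s *: J) + Istar) - omega Istar).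
Hypothesis omL : forall I, `|I - Istar| <= 2 * rho -> `|omega I - omega Istar| <= L * `|I - Istar|.
Hypotheses (dl0 : 0 < dl) (dl4 : dl <= 1 / 4) (dlr : dl <= r / 4) (eta0 : 0 < eta) (m4 : (4 <= m)%N)
  (small : 20 * expR 1 * m%:R * eta <= dl).
Hypotheses (kap_eta : rho^-1 * (n%:R * kap) <= eta)
  (resonant : Zvec (n%:R *: omega Istar)).

Let sc : phase R d -> phase R d := affine rho Istar 0.
Let unsc : phase R d -> phase R d :=
  affine rho^-1 (- (rho^-1 *: Istar)) (- (n%:R *: omega Istar)).
Let scC : cphase R d -> cphase R d := affine (rho%:C : CK R) (cvec Istar) 0.
Let unscC : cphase R d -> cphase R d :=
  affine (rho%:C : CK R)^-1 (- ((rho%:C : CK R)^-1 *: cvec Istar)) (- cvec (n%:R *: omega Istar)).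
(** The rescaled n-th iterate. The subtraction of n omega(Istar) makes it
    close to the identity of R^d x R^d, and not only of the torus. *)
Definition return_map (x : phase R d) : phase R d := unsc (iter n F (sc x)).
Definition return_mapC (z : cphase R d) : cphase R d := unscC (iter n FC (scC z)).
Let f := return_map.

Lemma sc_in (x : phase R d) : `|x.1| <= 2 -> `|(sc x).1 - Istar| <= 2 * rho.
Proof. by move=> x2; apply: scale_in => //; exact: ltW. Qed.

Lemma orbit_in_sc (x : phase R d) : `|x.1| <= 2 -> orbit_in F D n (sc x).
Proof. by move=> x2 j jn; have [_ _] := orbR (sc_in x2) (ltnW jn). Qed.

Lemma return_displacement (x : phase R d) :
  f x - x = (rho^-1 *: ((iter n F (sc x)).1 - (sc x).1),
     (iter n F (sc x)).2 - (sc x).2 - n%:R *: omega Istar).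
Proof. by apply: affine_return; rewrite gt_eqF. Qed.

Lemma return_mapC_near (x : phase R d) (z : (cphase R d : normedModType R[i])) :
  `|x.1| <= 1 -> cnorm (z - cpair x) <= 2 * dl ->
  differentiable return_mapC z /\ cnorm (return_mapC z - z) <= eta.
Proof.
move=> x1 zx; have := zx; rewrite [leLHS]cnorm_pair ge_max => /andP[z1 z2].
have s1 : cnorm ((scC z).1 - cvec Istar) <= 2 * rho.
  rewrite /scC /affine /= addrK (@cnormZ R _ (rho%:C : CK R)) cnorm_real gtr0_norm //.
  rewrite mulrC ler_wpM2r ?(ltW rho0) //.
  have := cnormD (z.1 - cvec x.1) (cvec x.1); rewrite subrK cnorm_cvec.
  by move: z1 => /=; have := dl4; lra.
have s2 : `|imvec (scC z).2| <= r / 2.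
  rewrite /scC /affine /= addr0.
  have := le_trans (imvec_le _) z2; rewrite imvecB imvec_cvec subr0.
  by have := dlr; lra.
have [dz b1 b2] := orbC s1 s2; split.
  exact: (@conj_differentiable (CK R) _ _ _ _ _ _ _ (iter n FC) z).
have rC0 : (rho%:C : CK R) != 0 by rewrite (inj_eq (@complexI R)) gt_eqF.
have E := affine_return (cvec Istar) (cvec (n%:R *: omega Istar)) (iter n FC (scC z)) z rC0.
rewrite /return_mapC /unscC E cnorm_pair ge_max; apply/andP; split; last exact: b2.
apply: le_trans kap_eta.
rewrite [X in X <= _](@cnormZ R _ ((rho%:C : CK R)^-1)) cnormV cnorm_real gtr0_norm //.
by rewrite ler_wpM2l // invr_ge0 ltW.
Qed.

Lemma return_map_compat (x : phase R d) : `|x.1| < 2 ->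
  return_mapC (cpair x) = cpair (f x).
Proof.
move=> /ltW x2; have [E _ _] := orbR (sc_in x2) (leqnn n).
have e1 : scC (cpair x) = cpair (sc x).
  by rewrite -affine_compat /scC cvec0.
have e2 y : unscC (cpair y) = cpair (unsc y).
  rewrite -affine_compat /unscC !cvecN [cvec (rho^-1 *: _)]cvecZ.
  by rewrite fmorphV.
by rewrite /return_mapC e1 E e2.
Qed.

Lemma return_map_C1 (c : R -> phase R d) :
  C1 c -> (forall t : R, `|(c t).1| < 2) -> C1 (fun t => f (c t)).
Proof.
move=> hc c2; apply: (@affine_C1 _ _ _ _ _ (fun t => iter n F (sc (c t)))).
apply: (@iter_C1 R d F D FC1 n (fun t => sc (c t))); first exact: affine_C1.
by move=> t; apply: orbit_in_sc; exact: ltW.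
Qed.

Lemma return_map_per (x y : phase R d) : `|x.1| < 2 -> same_point x y ->
  (f x).1 = (f y).1 /\ (f x).2 - (f y).2 = x.2 - y.2.
Proof.
move=> /ltW x2 sxy.
have [e1 e2] := iter_per Fper (orbit_in_sc x2) (affine_same rho Istar 0 sxy).
split; first by rewrite /f /return_map /unsc /affine /= e1.
rewrite /f /return_map /unsc /affine /= opprD addrACA subrr addr0.
by apply: (etrans e2); rewrite /affine /= !addr0.
Qed.

(** The homothety multiplies actions by rho and the shift by Istar adds
    boundary terms. These cancel along the closed triple because the iterate
    commutes with lattice translations, hence preserves the mismatches at the
    three corners. *)
Lemma return_map_exact (c0 c1 c2 : R -> phase R d) :
  [/\ C1 c0, C1 c1 & C1 c2] ->
  (forall t : R, [/\ `|(c0 t).1| < 2, `|(c1 t).1| < 2 & `|(c2 t).1| < 2]) ->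
  [/\ same_point (c0 1) (c1 0), same_point (c1 1) (c2 0) & same_point (c2 1) (c0 0)] ->
  loop_action (fun t => f (c0 t)) + loop_action (fun t => f (c1 t)) +
    loop_action (fun t => f (c2 t)) =
  loop_action c0 + loop_action c1 + loop_action c2.
Proof.
move=> [h0 h1 h2] reg [j01 j12 j20].
have g0 t : `|(c0 t).1| <= 2 by have [/ltW] := reg t.
have g1 t : `|(c1 t).1| <= 2 by have [_ /ltW] := reg t.
have g2 t : `|(c2 t).1| <= 2 by have [_ _ /ltW] := reg t.
pose G x := iter n F (sc x).
have act c : C1 c -> (forall t : R, `|(c t).1| <= 2) -> loop_action (fun t => f (c t)) =
    rho^-1 * loop_action (fun t => G (c t)) - rho^-1 * dot Istar ((G (c 1)).2 - (G (c 0)).2).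
  move=> hc cO.
  have hG : C1 (fun t => G (c t)).
    apply: (@iter_C1 R d F D FC1 n (fun t => sc (c t))); first exact: affine_C1.
    by move=> t; exact: orbit_in_sc.
  by apply: (etrans (affine_action _ _ _ hG)); rewrite dotNl dotZl.
have actsc c : C1 c -> loop_action (fun t => sc (c t)) =
    rho * loop_action c + dot Istar ((c 1).2 - (c 0).2) by move=> hc; exact: affine_action.
have jG x y : `|x.1| <= 2 -> same_point x y -> (G x).2 - (G y).2 = x.2 - y.2.
  move=> x2 sxy.
  have [_ e2] := iter_per Fper (orbit_in_sc x2) (affine_same rho Istar 0 sxy).
  by apply: (etrans e2); rewrite /affine /= !addr0.
have ex : loop_action (fun t => G (c0 t)) + loop_action (fun t => G (c1 t)) +
    loop_action (fun t => G (c2 t)) = loop_action (fun t => sc (c0 t)) +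
    loop_action (fun t => sc (c1 t)) + loop_action (fun t => sc (c2 t)).
  apply: (iter_exact3 FC1 Fper Fexact (k := n) (c0 := fun t => sc (c0 t))
    (c1 := fun t => sc (c1 t)) (c2 := fun t => sc (c2 t))).
  - by split; exact: affine_C1.
  - by move=> t; split; exact: orbit_in_sc.
  - by split; exact: affine_same.
rewrite (act c0 h0 g0) (act c1 h1 g1) (act c2 h2 g2).
have := jG _ _ (g0 1) j01; have := jG _ _ (g1 1) j12; have := jG _ _ (g2 1) j20.
have := joins_sum (G (c0 0)).2 (G (c0 1)).2 (G (c1 0)).2 (G (c1 1)).2 (G (c2 0)).2 (G (c2 1)).2.
have := joins_sum (c0 0).2 (c0 1).2 (c1 0).2 (c1 1).2 (c2 0).2 (c2 1).2.
rewrite (actsc c0 h0) (actsc c1 h1) (actsc c2 h2) in ex.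
move=> S1 S2 e20 e12 e01.
rewrite e20 e12 e01 -S1 in S2.
have dot3 (x y z : 'rV[R]_d) : dot Istar x + dot Istar y + dot Istar z =
    dot Istar (x + y + z) by rewrite !dotDr.
have S3 := etrans (dot3 _ _ _) (etrans (congr1 (dot Istar) S2) (esym (dot3 _ _ _))).
by apply: (exact_arith _ ex S3); rewrite gt_eqF.
Qed.

Lemma return_map_kick (x : phase R d) : `|x.1| <= 1 ->
  `|(f x).1 - x.1| <= rho^-1 * (n%:R * kap).
Proof.
move=> x1.
have [_ k1 _] := orbR (sc_in (le_trans x1 (ler1n R 2))) (leqnn n).
have E := congr1 fst (return_displacement x).
apply: (@le_trans _ _ `|rho^-1 *: ((iter n F (sc x)).1 - (sc x).1)|); first exact: eqW (congr1 Num.norm E).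
by rewrite normrZ gtr0_norm ?invr_gt0 // ler_wpM2l // invr_ge0 ltW.
Qed.

Let err (x : phase R d) (s : R) : 'rV[R]_d :=
  (iter n F (sc (s *: x))).2 - (sc (s *: x)).2 - n%:R *: omega (sc (s *: x)).1.

Lemma scaled_norm (x : phase R d) (s : R) : `|x.1| <= 1 -> 0 <= s <= 1 -> `|(s *: x).1| <= `|x.1|.
Proof. by move=> x1 /andP[s0 s1] /=; rewrite normrZ ger0_norm // ler_piMl. Qed.

Lemma scaled_in (x : phase R d) (s : R) : `|x.1| <= 1 -> 0 <= s <= 1 -> `|(s *: x).1| <= 2.
Proof.
by move=> x1 s01; apply: (le_trans (scaled_norm x1 s01)); apply: (le_trans x1); rewrite ler1n.
Qed.

Lemma return_twist (x : phase R d) (s : R) :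
  dot x.1 ((f (s *: x)).2 - s *: x.2) = dot x.1 (err x s) +
    n%:R * dot x.1 (omega (rho *: (s *: x.1) + Istar) - omega Istar).
Proof.
have E := congr1 snd (return_displacement (s *: x)).
have -> : (f (s *: x)).2 - s *: x.2 = (iter n F (sc (s *: x))).2 - (sc (s *: x)).2 -
   n%:R *: omega Istar by exact: E.
rewrite -dotZr -dotDr /err scalerBr; congr dot.
by rewrite addrA subrK.
Qed.

Lemma err_bound (x : phase R d) (s : R) : `|x.1| <= 1 -> 0 <= s <= 1 ->
  `|dot x.1 (err x s)| <= d%:R * q.
Proof.
move=> x1 s01; apply: (le_trans (dot_bound _ _)); rewrite ler_wpM2l //.
rewrite -[leRHS]mul1r ler_pM //.
by apply: orbT; apply: sc_in; exact: scaled_in.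
Qed.

Lemma return_twist_ge (x : phase R d) (s : R) : `|x.1| <= 1 -> 0 <= s <= 1 ->
  n%:R * nu * rho * dot x.1 x.1 * s - d%:R * q <= dot x.1 ((f (s *: x)).2 - s *: x.2).
Proof.
move=> x1 s01; rewrite return_twist.
have := err_bound x1 s01; rewrite ler_norml => /andP[e1 _].
have := ler_wpM2l (ler0n R n) (convex x1 s01).
exact: ge_arith.
Qed.

Lemma return_twist_le (x : phase R d) (s : R) : `|x.1| <= 1 -> 0 <= s <= 1 ->
  dot x.1 ((f (s *: x)).2 - s *: x.2) <= d%:R * (n%:R * L * rho) * `|x.1| ^+ 2 + d%:R * q.
Proof.
move=> x1 s01; rewrite return_twist.
have := err_bound x1 s01; rewrite ler_norml => /andP[_ e1].
have h := sc_in (scaled_in x1 s01).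
have oL : `|omega (rho *: (s *: x.1) + Istar) - omega Istar| <= L * (rho * `|s *: x.1|).
  by apply: (le_trans (omL h)); rewrite /sc /affine /= addrK normrZ (gtr0_norm rho0).
have sx : `|s *: x.1| <= `|x.1| := scaled_norm x1 s01.
have := le_trans (ler_norm _) (dot_bound x.1 (omega (rho *: (s *: x.1) + Istar) - omega Istar)).
move=> db; rewrite addrC; apply: lerD e1.
have o2 : `|omega (rho *: (s *: x.1) + Istar) - omega Istar| <= L * (rho * `|x.1|).
  by apply: (le_trans oL); rewrite ler_wpM2l // ler_wpM2l // ltW.
have o3 : d%:R * (`|x.1| * `|omega (rho *: (s *: x.1) + Istar) - omega Istar|) <=
    d%:R * (`|x.1| * (L * (rho * `|x.1|))).
  by apply: ler_wpM2l => //; apply: ler_wpM2l o2.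
apply: (le_trans (ler_wpM2l (ler0n R n) (le_trans db o3))).
by apply: eqW; ring.
Qed.

(** The subtracted vector n omega(Istar) is integral. *)
Lemma sc_return (x : phase R d) : same_point (sc (f x)) (iter n F (sc x)).
Proof.
split.
  rewrite /f /return_map /sc /unsc /affine /=.
  by rewrite scalerBr !scalerA mulfV ?gt_eqF // !scale1r subrK.
rewrite /f /return_map {1}/sc {1}/unsc /affine /=.
by rewrite addr0 addrAC subrr add0r; exact: ZvecN.
Qed.

(** Every time k is split as j n + i with i < n. The j iterates of the return
    map keep the rescaled action below 1/2, and the remaining i < n steps move
    the action by at most rho / 2. *)
Lemma resonance_stable (u : nat -> phase R d) (r1 N : R) : trajectory F u ->
  `|(u 0%N).1 - Istar| < r1 * rho -> r1 <= 1 / 2 -> n%:R * kap <= rho / 2 ->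
  d%:R * (n%:R * L * rho) * r1 ^+ 2 + 2 * (d%:R * q) +
    2 * (d%:R * (5 * expR 1 * eta * (40 * expR 1 * eta)) +
         d%:R * (rho^-1 * (n%:R * kap) * 4)) +
    N * (9 * d%:R * 2^-1 ^+ m) < n%:R * nu * rho / 8 ->
  forall k : nat, k%:R <= N -> `|(u k).1 - Istar| < rho.
Proof.
move=> tu u0 r1h nkap budget k kN.
pose x0 : phase R d := (rho^-1 *: ((u 0%N).1 - Istar), (u 0%N).2).
have scx0 : sc x0 = u 0%N.
  rewrite /sc /affine /= scalerA mulfV ?gt_eqF // scale1r subrK addr0.
  by rewrite -surjective_pairing.
have x0r : `|x0.1| < r1.
  by rewrite /= normrZ gtr0_norm ?invr_gt0 // mulrC ltr_pdivrMr.
have a0 : 0 < n%:R * nu * rho by rewrite !mulr_gt0 // ltr0n.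
have b0 : 0 <= d%:R * (n%:R * L * rho) by rewrite !mulr_ge0 // ltW.
have conf := action_confined dl0 dl4 eta0 m4 small return_mapC_near return_map_compat
  return_map_C1 return_map_per return_map_exact a0 b0 return_map_kick return_twist_ge
  return_twist_le x0r r1h budget.
have two j : j%:R <= N -> `|(iter j f x0).1| <= 2.
  by move=> /conf h; exact: half_two.
have shadow j : j%:R <= N -> same_point (sc (iter j f x0)) (u (j * n)%N).
  elim: j => [|j IH] jN.
    by rewrite mul0n /= scx0; split=> //; rewrite subrr; exact: Zvec0.
  have jN' : j%:R <= N by apply: le_trans jN; rewrite ler_nat.
  rewrite iterS mulSn addnC.
  apply: (same_point_trans (sc_return _)).
  exact: (trajectory_shadow Fper tu (orbit_in_sc (two _ jN')) (IH jN')).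
pose j := (k %/ n)%N; pose i := (k %% n)%N.
have jN : j%:R <= N by apply: le_trans kN; rewrite ler_nat leq_div.
have ilt : (i <= n)%N by rewrite ltnW // ltn_mod.
have xin := sc_in (two _ jN).
have [_ ki _] := orbR xin ilt.
have orb : orbit_in F D i (sc (iter j f x0)).
  by move=> l li; apply: (orbit_in_sc (two _ jN)); exact: leq_trans li ilt.
have [e _] := trajectory_shadow Fper tu orb (shadow j jN).
rewrite (divn_eq k n) -/j -/i -e.
apply: (le_lt_trans (ler_distD (sc (iter j f x0)).1 _ _)).
have h1 : i%:R * kap <= rho / 2.
  by apply: le_trans nkap; rewrite ler_wpM2r // ler_nat.
have h2 : `|(sc (iter j f x0)).1 - Istar| < rho / 2.
  rewrite {1}/sc /affine /= addrK normrZ gtr0_norm //.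
  by rewrite ltr_pM2l // -[2^-1]mul1r; exact: conf.
exact: half_add (le_trans ki h1) h2.
Qed.

End resonance.

(** * Strong convexity along a segment *)

Lemma dot_is_derive (R : realType) (d : nat) (J : 'rV[R]_d) (c : R -> 'rV[R]_d) (t : R) v :
  h^-1 *: (c (h *: 1 + t) - c t) @[h --> 0^'] --> v ->
  is_derive t 1 (fun s => dot J (c s) : R^o) (dot J v).
Proof.
move=> cv.
have lim : h^-1 *: ((dot J (c (h *: 1 + t)) : R^o) - dot J (c t)) @[h --> 0^'] --> (dot J v : R^o).
  have -> : (fun h => h^-1 *: ((dot J (c (h *: 1 + t)) : R^o) - dot J (c t))) =
      (fun h => dot J (h^-1 *: (c (h *: 1 + t) - c t))).
    by apply/funext => h; rewrite dotZr dotDr dotNr.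
  apply: continuous_cvg cv.
  apply: (@dot_continuous R 'rV[R]_d d (fun=> J) id v).
    exact: cst_continuous.
  by move=> A; exact.
by apply: DeriveDef; [apply/cvg_ex; exists (dot J v)|exact: cvg_lim].
Qed.

(** The mean value theorem for t |-> J . omega(t J + Istar). *)
Lemma convex_segment (R : realType) (d : nat) (omega : 'rV[R]_d -> 'rV[R]_d)
    (Istar J : 'rV[R]_d) (nu t0 : R) : 0 <= t0 ->
  (forall t, 0 <= t <= t0 -> differentiable omega (t *: J + Istar) /\
     nu * dot J J <= dot ('d omega (t *: J + Istar) J) J) ->
  nu * t0 * dot J J <= dot J (omega (t0 *: J + Istar) - omega Istar).
Proof.
move=> t00 H.
pose g (t : R) : R^o := dot J (omega (t *: J + Istar)).
have dg (t : R) : 0 <= t <= t0 -> is_derive t 1 g (dot J ('d omega (t *: J + Istar) J)).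
  move=> /H[dom _]; apply: dot_is_derive.
  have := (@derivable_diff _ _ _ _ _ J dom).
  apply: cvg_trans; apply: near_eq_cvg; near=> h.
  by rewrite addrA -scalerDl [h *: 1]mulr1.
have [||c c0 E] := @MVT_segment R g (fun t => dot J ('d omega (t *: J + Istar) J)) 0 t0 t00.
- by move=> x; rewrite in_itv /= => /andP[x0 x1]; apply: dg; rewrite !ltW.
- apply: derivable_within_continuous => x; rewrite in_itv /= => x01.
  by have dgx := dg x x01; exact: ex_derive.
have [_ h] := H c c0.
move: E; rewrite subr0 /g scale0r add0r -dotNr -dotDr => ->.
by rewrite dotC mulrAC ler_wpM2r.
Unshelve. all: end_near. Qed.

(** * The map near a resonance *)

Lemma budget_le (R : realType) (u v A B N S : R) (k : R) : u <= k * B -> v <= A -> k <= N -> 0 <= B ->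
  A + N * B <= S -> u + v <= S.
Proof. by move=> hu hv kN B0; have := ler_wpM2r B0 kN; lra. Qed.

Lemma quarter_le (R : realType) (u s : R) : 0 < s -> u <= s / 4 -> u <= s /\ u < s / 2.
Proof. by move=> s0 h; split; lra. Qed.

Lemma iter_differentiable (K : numFieldType) (V : normedModType K) (G : V -> V) (k : nat) (z : V) :
  differentiable (iter k G) z -> differentiable G (iter k G z) -> differentiable (iter k.+1 G) z.
Proof. exact: differentiable_comp. Qed.

Section near_resonance.
Variables (R : realType) (d : nat) (Istar : 'rV[R]_d) (eps M s0 r K : R)
  (omega : 'rV[R]_d -> 'rV[R]_d) (a b : phase R d -> 'rV[R]_d)
  (omC : 'rV[R[i]]_d -> 'rV[R[i]]_d) (aC bC : cphase R d -> 'rV[R[i]]_d).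
Hypotheses (eps_gt0 : 0 < eps) (eps_le1 : eps <= 1) (M0 : 0 <= M) (s00 : 0 < s0) (r0 : 0 < r) (K0 : 0 <= K).
Hypothesis abC : forall z : (cphase R d : normedModType R[i]),
  cnorm (z.1 - cvec Istar) <= s0 -> `|imvec z.2| <= r ->
  [/\ differentiable aC z, differentiable bC z, cnorm (aC z) <= M & cnorm (bC z) <= M].
Hypothesis oC : forall w : ('rV[R[i]]_d : normedModType R[i]), cnorm (w - cvec Istar) <= s0 ->
  differentiable omC w /\ cnorm (omC w) <= K.
Hypothesis realC : forall x : phase R d, `|x.1 - Istar| <= s0 ->
  [/\ aC (cpair x) = cvec (a x), bC (cpair x) = cvec (b x) & omC (cvec x.1) = cvec (omega x.1)].
Hypothesis per : forall (x : phase R d) (m : 'rV[R]_d), `|x.1 - Istar| <= s0 -> Zvec m ->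
  a (x.1, x.2 + m) = a x /\ b (x.1, x.2 + m) = b x.
Let F := lift_map omega a b eps.
Hypothesis Fdiff : forall x : phase R d, `|x.1 - Istar| <= s0 -> differentiable F x.
Hypothesis Floop : forall c, is_loop [set x : phase R d | `|x.1 - Istar| <= s0] c ->
  loop_action (F \o c) = loop_action c.

Definition lift_mapC (z : cphase R d) : cphase R d :=
  (z.1 + eps%:C *: aC z, z.2 + omC z.1 + eps%:C *: bC z).

Lemma lift_mapC_differentiable (z : (cphase R d : normedModType R[i])) :
  cnorm (z.1 - cvec Istar) <= s0 -> `|imvec z.2| <= r -> differentiable lift_mapC z.
Proof.
move=> z1 z2; have [da db _ _] := abC z1 z2; have [dom _] := oC z1.
exact: (@lift_differentiable (CK R) _ aC bC omC eps%:C z da db dom).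
Qed.

Lemma lift_mapC_real (x : phase R d) : `|x.1 - Istar| <= s0 ->
  lift_mapC (cpair x) = cpair (F x).
Proof.
move=> x1; have [ea eb eo] := realC x1.
rewrite /lift_mapC ea eb /F /lift_map /cpair /= eo.
by rewrite !cvecD !cvecZ.
Qed.

Lemma F_same_point (x y : phase R d) : `|x.1 - Istar| <= s0 -> same_point x y ->
  (F x).1 = (F y).1 /\ (F x).2 - (F y).2 = x.2 - y.2.
Proof.
move=> x1 [e1 z]; have y1 : `|y.1 - Istar| <= s0 by rewrite -e1.
have [] := per y1 z; rewrite subrKC -e1 -surjective_pairing => ea eb.
rewrite /F /lift_map /= ea eb e1; split=> //.
by rewrite opprD addrACA subrr addr0 opprD addrACA subrr addr0.
Qed.

Lemma F_same (x y : phase R d) : `|x.1 - Istar| <= s0 -> same_point x y ->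
  same_point (F x) (F y).
Proof.
move=> x1 sxy; have [e1 e2] := F_same_point x1 sxy; split=> //.
by rewrite e2; exact: sxy.2.
Qed.

(** The Schwarz lemma on the ball of radius s0 / 2 around w', where the
    frequency is bounded by K. *)
Lemma omC_lipschitz (w w' : ('rV[R[i]]_d : normedModType R[i])) :
  cnorm (w - cvec Istar) <= s0 / 4 -> cnorm (w' - cvec Istar) <= s0 / 4 ->
  cnorm (omC w - omC w') <= 4 * K / s0 * cnorm (w - w').
Proof.
move=> w1 w1'; have d2 : 0 < s0 / 2 by rewrite divr_gt0.
have near z : cnorm (z - w') <= s0 / 2 -> cnorm (z - cvec Istar) <= s0.
  move=> h; apply: (le_trans (cnorm_tri w' _ _)).
  by apply: (near_arith h w1' s00).
have -> : 4 * K / s0 = 2 * K / (s0 / 2) by field; rewrite gt_eqF.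
apply: (schwarz (rv_coordinates R d) d2).
- by move=> z /near /oC[].
- by move=> z /near /oC[].
- apply: (le_trans (cnorm_tri (cvec Istar) _ _)).
  by rewrite [cnorm (cvec _ - _)]cnorm_distC; apply: (near_arith' w1 w1').
Qed.

(** The displacement of the lifted map is bounded on a complex neighbourhood
    of x; subtracting the identity does not change second differences. *)
Lemma liftC_second_difference (x : phase R d) : `|x.1 - Istar| < s0 / 2 ->
  exists rad C : R, 0 < rad /\ forall y v, `|y - x| <= rad -> `|v| <= rad ->
    `|(F (y + v) - F y) - (F (x + v) - F x)| <= C * `|y - x| * `|v|.
Proof.
move=> x1; pose rad := Num.min (s0 / 4) (r / 2).
have rad0 : 0 < rad by rewrite lt_min !divr_gt0.
have rs : rad <= s0 / 4 by rewrite ge_min lexx.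
have rr : rad <= r / 2 by rewrite ge_min lexx orbT.
clearbody rad.
have inD (z : (cphase R d : normedModType R[i])) : cnorm (z - cpair x) <= 2 * rad ->
    cnorm (z.1 - cvec Istar) <= s0 /\ `|imvec z.2| <= r.
  rewrite cnorm_pair ge_max => /andP[z1 z2]; split.
    apply: (le_trans (cnorm_tri (cvec x.1) _ _)).
    rewrite -cvecB cnorm_cvec; exact: (inD_arith z1 rs (ltW x1)).
  apply: (le_trans _ (inD_arith' z2 rr)).
  by apply: (le_trans _ (imvec_le _)); rewrite imvecB imvec_cvec subr0.
have inR (y : phase R d) : `|y - x| <= 2 * rad -> `|y.1 - Istar| <= s0.
  rewrite -cnorm_cpair cpairB => /inD[+ _].
  by rewrite -cvecB cnorm_cvec.
exists rad, (2 * (2 * (K + M) / rad) / rad); split=> // y v yx vr.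
have n0 : 0 <= `|v| by [].
have b1 : `|y - x| <= 2 * rad by exact: double_le (normr_ge0 _) yx.
have b2 : `|y + v - x| <= 2 * rad.
  rewrite addrAC; apply: (le_trans (ler_normD _ _)); exact: add_le yx vr.
have b3 : `|x + v - x| <= 2 * rad by rewrite addrAC subrr add0r; exact: double_le (normr_ge0 _) vr.
have b4 : `|x - x| <= 2 * rad by rewrite subrr normr0 mulr_ge0 // ltW.
have := @second_difference R _ _ _ _ (fun z => lift_mapC z - z) (cpair x) rad (K + M)
  (pair_coordinates R d) rad0 _ _ (cpair y) (cpair v).
rewrite -!cpairB -!cpairD !cnorm_cpair => S.
have {}S := S _ _ yx vr.
rewrite (lift_mapC_real (inR _ b2)) (lift_mapC_real (inR _ b1)) (lift_mapC_real (inR _ b3))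
  (lift_mapC_real (inR _ b4)) -!cpairB cnorm_cpair in S.
have -> : F (y + v) - F y - (F (x + v) - F x) =
  F (y + v) - (y + v) - (F y - y) - (F (x + v) - (x + v) - (F x - x)).
  exact: second_difference_id.
apply: (le_trans (S _ _)).
- move=> z /inD[z1 z2]; apply: displacement_differentiable.
  exact: lift_mapC_differentiable.
- move=> z /inD[z1 z2]; have [_ _ ha hb] := abC z1 z2; have [_ ho] := oC z1.
  have eM (w : 'rV[R[i]]_d) : cnorm w <= M -> cnorm (eps%:C *: w) <= M.
    move=> wM; rewrite (@cnormZ R _ (eps%:C : CK R)) cnorm_real gtr0_norm //.
    by apply: le_trans wM; rewrite ler_piMl // cnorm_ge0.
  rewrite cnorm_pair ge_max; apply/andP; split.
    rewrite /lift_mapC /= addrAC subrr add0r; apply: (le_trans (eM _ ha)).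
    by rewrite lerDr.
  rewrite /lift_mapC /= addrC -addrA addKr.
  by apply: (le_trans (cnormD _ _)); apply: lerD => //; exact: eM.
- by apply: eqW; ring.
Qed.

Lemma F_C1 (c : R -> phase R d) : C1 c -> (forall t, `|(c t).1 - Istar| < s0 / 2) ->
  C1 (fun t => F (c t)).
Proof.
move=> hc cO.
apply: (@C1_image R _ _ F [set x : phase R d | `|x.1 - Istar| < s0 / 2]) => //.
  by move=> x /= x1; apply: Fdiff; exact: half_le s00 x1.
by move=> x; exact: liftC_second_difference.
Qed.

Lemma F_translate (x dx : phase R d) : `|x.1 - Istar| <= s0 -> lattice dx ->
  F (x + dx) = F x + dx.
Proof.
move=> x1 [l1 l2].
have sxy : same_point x (x + dx).
  split; first by rewrite /= l1 addr0.
  by rewrite /= opprD addrA subrr add0r; exact: ZvecN.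
have [e1 e2] := F_same_point x1 sxy.
move: e1 e2; case: (F (x + dx)) => u v; case: (F x) => u' v' /= <-.
rewrite opprD [in X in _ = X -> _]addrA subrr add0r => e2.
have -> : (u', v') + dx = (u' + dx.1, v' + dx.2) by [].
rewrite l1 addr0; congr pair.
by apply/eqP; rewrite addrC -subr_eq -[eqbLHS]opprB e2 opprK.
Qed.

(** The three arcs, joined modulo the lattice, lift to one C1 loop. The lifted
    map commutes with lattice translations, so it maps the concatenation to
    the concatenation of the images. *)
Lemma F_exact3 (c0 c1 c2 : R -> phase R d) :
  [/\ C1 c0, C1 c1 & C1 c2] ->
  (forall t : R, [/\ `|(c0 t).1 - Istar| < s0 / 2, `|(c1 t).1 - Istar| < s0 / 2 &
      `|(c2 t).1 - Istar| < s0 / 2]) ->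
  [/\ same_point (c0 1) (c1 0), same_point (c1 1) (c2 0) & same_point (c2 1) (c0 0)] ->
  loop_action (fun t => F (c0 t)) + loop_action (fun t => F (c1 t)) +
    loop_action (fun t => F (c2 t)) =
  loop_action c0 + loop_action c1 + loop_action c2.
Proof.
move=> [h0 h1 h2] reg [j01 j12 j20].
have k0 : C1 (fun t => F (c0 t)) by apply: F_C1 => // t; have [] := reg t.
have k1 : C1 (fun t => F (c1 t)) by apply: F_C1 => // t; have [] := reg t.
have k2 : C1 (fun t => F (c2 t)) by apply: F_C1 => // t; have [] := reg t.
have r0' t : `|(c0 t).1 - Istar| <= s0 by have [h _ _] := reg t; exact: half_le s00 h.
have r1' t : `|(c1 t).1 - Istar| <= s0 by have [_ h _] := reg t; exact: half_le s00 h.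
have r2' t : `|(c2 t).1 - Istar| <= s0 by have [_ _ h] := reg t; exact: half_le s00 h.
have f01 := F_same (r0' 1) j01; have f12 := F_same (r1' 1) j12.
pose d01 := c0 1 - c1 0; pose d12 := c1 1 - c2 0.
have l01 : lattice d01 := lattice_sub j01; have l12 : lattice d12 := lattice_sub j12.
have l := latticeD l12 l01.
have e01 : c0 1 = c1 0 + d01 by rewrite /d01 subrKC.
have e12 : c1 1 = c2 0 + d12 by rewrite /d12 subrKC.
have E : concat3 (fun t => F (c0 t)) (fun t => F (c1 t)) (fun t => F (c2 t)) =
   F \o concat3 c0 c1 c2.
  apply/funext => t; rewrite /concat3 /=.
  case: (arc_cases t) => [] [-> -> _ _].
  - by rewrite !subrr !addr0.
  - rewrite !subrr !addr0 e01 (F_translate (r1' 0) l01) !glue.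
    by rewrite (F_translate (r1' _) l01).
  - rewrite e01 (F_translate (r1' 0) l01) !glue e12 (F_translate (r2' 0) l12).
    rewrite -(addrA (F (c2 0)) d12 d01) -(addrA (c2 0) d12 d01) !glue.
    by rewrite (F_translate (r2' _) l).
apply: (etrans (esym (loop_action_concat3 k0 k1 k2 f01.1 f12.1))).
apply: (etrans _ (loop_action_concat3 h0 h1 h2 j01.1 j12.1)).
rewrite [concat3 (fun t => F (c0 t)) _ _]E; apply: Floop.
have ends : concat3 c0 c1 c2 1 - concat3 c0 c1 c2 0 = (c2 1 - c0 0) + (d12 + d01).
  rewrite /concat3 !arc_start (arc_end R (i := 0) isT) (arc_end R (i := 1) isT)
    (arc_end R (i := 2) isT) !subrr !addr0.
  by rewrite e01 glue e12 -(addrA (c2 0) d12 d01) glue [LHS]addrAC.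
have le := latticeD (lattice_sub j20) l; rewrite -ends in le.
split.
- exact: (concat3_C1 h0 h1 h2).1.
- move=> t _; change (`|(concat3 c0 c1 c2 t).1 - Istar| <= s0).
  by case: (concat3_fst t j01.1 j12.1) => [] [-> _ _].
- by apply/eqP; rewrite -subr_eq0; apply/eqP; exact: le.1.
- exact: le.2.
Qed.

Let L := 4 * K / s0.
Variables (nu : R) (n : nat) (rho q dl eta : R) (m : nat).
Let B := L * (2 * rho + n%:R * (eps * M)) + eps * M.
Let FC := lift_mapC.
Hypotheses (n0 : (0 < n)%N) (rho0 : 0 < rho).
Hypotheses (action_budget : 2 * rho + n%:R * (eps * M) <= s0 / 4)
  (angle_budget : n%:R * B <= r / 2).

Let L0 : 0 <= L.
Proof. by rewrite divr_ge0 ?mulr_ge0 // ltW. Qed.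

Let A0 : 0 <= 2 * rho.
Proof. by rewrite mulr_ge0 // ltW. Qed.

Let eM0 : 0 <= eps * M.
Proof. by rewrite mulr_ge0 // ltW. Qed.

Let B0 : 0 <= B.
Proof. by rewrite addr_ge0 // mulr_ge0 // addr_ge0 // mulr_ge0. Qed.

Lemma kick_le (w : ('rV[R[i]]_d : normedModType R[i])) : cnorm w <= M ->
  cnorm (eps%:C *: w) <= eps * M.
Proof.
by move=> wM; rewrite (@cnormZ R _ (eps%:C : CK R)) cnorm_real gtr0_norm // ler_pM2l.
Qed.

(** The reference frequency omC w0 is arbitrary: with w0 = Istar it bounds the
    displacement of the return map, with w0 the starting action it isolates
    the twist. *)
Lemma lift_step (y : (cphase R d : normedModType R[i])) (w0 : ('rV[R[i]]_d : normedModType R[i])) (De : R) :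
  cnorm (y.1 - cvec Istar) <= s0 / 4 -> `|imvec y.2| <= r ->
  cnorm (w0 - cvec Istar) <= s0 / 4 -> cnorm (y.1 - w0) <= De ->
  [/\ differentiable FC y, cnorm ((FC y).1 - y.1) <= eps * M &
   cnorm ((FC y).2 - y.2 - omC w0) <= L * De + eps * M].
Proof.
move=> y1 y2 w1 yw; have [y1' _] := quarter_le s00 y1.
have [da db ha hb] := abC y1' y2; have [dom _] := oC y1'.
have e1 (V : zmodType) (x v : V) : x + v - x = v by rewrite addrC addKr.
have e2 (V : zmodType) (x v h o : V) : x + v + h - x - o = (v - o) + h.
  by rewrite -(addrA x) e1 addrAC.
split.
- exact: (@lift_differentiable (CK R) _ aC bC omC eps%:C y da db dom).
- by rewrite /FC /lift_mapC /= e1; exact: kick_le.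
- rewrite /FC /lift_mapC /= e2; apply: (le_trans (cnormD _ _)); apply: lerD.
    by apply: (le_trans (omC_lipschitz y1 w1)); rewrite ler_wpM2l.
  exact: kick_le.
Qed.

Let om0 := cvec (omega Istar).

Lemma omC_Istar : omC (cvec Istar) = om0.
Proof. by have [] := @realC (Istar, 0) _; rewrite /= ?subrr ?normr0 // ltW. Qed.

Lemma center_in : cnorm (cvec Istar - cvec Istar) <= s0 / 4.
Proof. by rewrite subrr cnorm0 divr_ge0 // ltW. Qed.

Lemma succ_scale (V : lmodType R[i]) (y' y z o : V) (k : nat) :
  y' - z - k.+1%:R *: o = (y' - y - o) + (y - z - k%:R *: o).
Proof.
rewrite -[k.+1]addn1 natrD scalerDl scale1r opprD.
rewrite [RHS]addrACA [X in _ = X + _]subrKA.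
by rewrite [- (_ *: _) - o]addrC.
Qed.

(** Actions drift by eps M at each step, so that along n steps the frequency
    stays close to omega(Istar), which is real: imaginary parts of angles grow
    by at most B at each step. The domain conditions and the estimates are
    proved together by induction. *)
Lemma orbit_bounds (z : (cphase R d : normedModType R[i])) :
  cnorm (z.1 - cvec Istar) <= 2 * rho -> `|imvec z.2| <= r / 2 ->
  forall k, (k <= n)%N ->
  [/\ differentiable (iter k FC) z,
    cnorm ((iter k FC z).1 - z.1) <= k%:R * (eps * M) &
    cnorm ((iter k FC z).2 - z.2 - k%:R *: om0) <= k%:R * B] /\
  (cnorm ((iter k FC z).1 - cvec Istar) <= 2 * rho + n%:R * (eps * M) /\ `|imvec (iter k FC z).2| <= r).
Proof.
move=> z1 z2.
suff H k : (k <= n)%N -> [/\ differentiable (iter k FC) z,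
    cnorm ((iter k FC z).1 - z.1) <= k%:R * (eps * M) &
    cnorm ((iter k FC z).2 - z.2 - k%:R *: om0) <= k%:R * B] ->
    (cnorm ((iter k FC z).1 - cvec Istar) <= 2 * rho + n%:R * (eps * M) /\
    `|imvec (iter k FC z).2| <= r).
  elim=> [|k IH] kn.
    have P0 : [/\ differentiable (iter 0 FC) z, cnorm ((iter 0 FC z).1 - z.1) <= 0%:R * (eps * M) &
      cnorm ((iter 0 FC z).2 - z.2 - 0%:R *: om0) <= 0%:R * B].
      split; first by [].
  
        by rewrite subrr cnorm0 mul0r.
      by rewrite subrr scale0r subrr cnorm0 mul0r.
    by split=> //; exact: H kn P0.
  have [[dk k1 k2] [y1 y2]] := IH (ltnW kn).
  have [dF f1 f2] := lift_step (le_trans y1 action_budget) y2 center_in y1.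
  rewrite omC_Istar in f2.
  have P : [/\ differentiable (iter k.+1 FC) z,
    cnorm ((iter k.+1 FC z).1 - z.1) <= k.+1%:R * (eps * M) &
    cnorm ((iter k.+1 FC z).2 - z.2 - k.+1%:R *: om0) <= k.+1%:R * B].
    have S (x : R) : k.+1%:R * x = x + k%:R * x by rewrite -[k.+1]add1n natrD mulrDl mul1r.
    split.
    - exact: (@iter_differentiable (CK R) _ FC k z dk dF).
    - apply: (le_trans (cnorm_tri (iter k FC z).1 _ _)).
      by rewrite S; apply: lerD.
    - rewrite (succ_scale _ (iter k FC z).2); apply: (le_trans (cnormD _ _)).
      by rewrite S; apply: lerD.
  by split=> //; exact: H kn P.
move=> kn [_ k1 k2].
have kN : k%:R <= n%:R :> R by rewrite ler_nat.
split.
  apply: (le_trans (cnorm_tri z.1 _ _)).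
  exact: (budget_le k1 z1 kN eM0).
have : imvec (iter k FC z).2 = imvec ((iter k FC z).2 - z.2 - k%:R *: om0) + imvec z.2.
  have E : k%:R *: om0 = cvec (k%:R *: omega Istar) by rewrite cvecZ rmorph_nat.
  by rewrite !imvecB E imvec_cvec subr0 subrK.
move=> ->; apply: (le_trans (ler_normD _ _)).
have h := le_trans (imvec_le _) k2.
apply: (budget_le h z2 kN B0).
by move: angle_budget; lra.
Qed.

Lemma orbit_twist (z : (cphase R d : normedModType R[i])) :
  cnorm (z.1 - cvec Istar) <= 2 * rho -> `|imvec z.2| <= r / 2 ->
  forall k, (k <= n)%N ->
  cnorm ((iter k FC z).2 - z.2 - k%:R *: omC z.1) <=
    k%:R * (L * (n%:R * (eps * M)) + eps * M).
Proof.
move=> z1 z2; have P := orbit_bounds z1 z2.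
elim=> [|k IH] kn; first by rewrite subrr scale0r subrr cnorm0 mul0r.
have [[_ k1 _] [y1 y2]] := P k (ltnW kn).
have w1 : cnorm (z.1 - cvec Istar) <= s0 / 4.
  apply: (le_trans z1); apply: le_trans action_budget.
  by rewrite lerDl mulr_ge0.
have k1' : cnorm ((iter k FC z).1 - z.1) <= n%:R * (eps * M).
  by apply: (le_trans k1); rewrite ler_wpM2r // ler_nat ltnW.
have [_ _ f] := lift_step (le_trans y1 action_budget) y2 w1 k1'.
rewrite (succ_scale _ (iter k FC z).2); apply: (le_trans (cnormD _ _)).
rewrite -[k.+1]add1n natrD mulrDl mul1r; apply: lerD f _.
exact: IH (ltnW kn).
Qed.

Lemma orbit_real (x : phase R d) : `|x.1 - Istar| <= 2 * rho -> forall k, (k <= n)%N ->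
  [/\ iter k FC (cpair x) = cpair (iter k F x), `|(iter k F x).1 - x.1| <= k%:R * (eps * M) &
  `|(iter k F x).1 - Istar| < s0 / 2].
Proof.
move=> x1.
have z1 : cnorm ((cpair x).1 - cvec Istar) <= 2 * rho by rewrite -cvecB cnorm_cvec.
have z2 : `|imvec (cpair x).2| <= r / 2 by rewrite imvec_cvec normr0 divr_ge0 // ltW.
have P := orbit_bounds z1 z2.
suff E k : (k <= n)%N -> iter k FC (cpair x) = cpair (iter k F x).
  move=> k kn; have [[_ k1 _] [y1 _]] := P k kn.
  rewrite (E k kn) -!cvecB !cnorm_cvec in k1 y1.
  split=> //; first exact: E.
  by have [] := quarter_le s00 (le_trans y1 action_budget).
elim: k => [|k IH] kn; first by [].
rewrite !iterS IH; last exact: ltnW.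
have [_ [y1 _]] := P k (ltnW kn).
rewrite (IH (ltnW kn)) -cvecB cnorm_cvec in y1.
have [h _] := quarter_le s00 (le_trans y1 action_budget).
exact: (lift_mapC_real h).
Qed.

Hypothesis nu0 : 0 < nu.
Hypothesis conv : forall I, `|I - Istar| <= s0 -> differentiable omega I /\
  forall v, nu * dot v v <= dot ('d omega I v) v.
Hypotheses (eta_budget : n%:R * B <= eta)
  (q_budget : n%:R * (L * (n%:R * (eps * M)) + eps * M) <= q)
  (kick_budget : rho^-1 * (n%:R * (eps * M)) <= eta).
Hypotheses (dl0 : 0 < dl) (dl4 : dl <= 1 / 4) (dlr : dl <= r / 4) (eta0 : 0 < eta) (m4 : (4 <= m)%N)
  (small : 20 * expR 1 * m%:R * eta <= dl) (resonant : Zvec (n%:R *: omega Istar)).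

Let A4 : 2 * rho <= s0 / 4.
Proof.
have h : 0 <= n%:R * (eps * M) by rewrite !mulr_ge0 // ltW.
by apply: le_trans action_budget; rewrite lerDl.
Qed.

Let D : set (phase R d) := [set x | `|x.1 - Istar| < s0 / 2].

Lemma local_orbit_complex (z : (cphase R d : normedModType R[i])) :
  cnorm (z.1 - cvec Istar) <= 2 * rho -> `|imvec z.2| <= r / 2 ->
  [/\ differentiable (iter n (lift_mapC)) z,
    cnorm ((iter n (lift_mapC) z).1 - z.1) <= n%:R * (eps * M) &
    cnorm ((iter n (lift_mapC) z).2 - z.2 - cvec (n%:R *: omega Istar)) <= eta].
Proof.
move=> z1 z2.
have [[h1 h2 h3] _] := orbit_bounds z1 z2 (leqnn n).
split; [exact: h1|exact: h2|].
rewrite cvecZ rmorph_nat; exact: (le_trans h3 eta_budget).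
Qed.

Lemma local_orbit_twist (x : phase R d) : `|x.1 - Istar| <= 2 * rho ->
  `|(iter n F x).2 - x.2 - n%:R *: omega x.1| <= q.
Proof.
move=> x1.
have z1 : cnorm ((cpair x).1 - cvec Istar) <= 2 * rho by rewrite -cvecB cnorm_cvec.
have z2 : `|imvec (cpair x).2| <= r / 2 by rewrite imvec_cvec normr0 divr_ge0 // ltW.
have h := orbit_twist z1 z2 (leqnn n).
have [E _ _] := orbit_real x1 (leqnn n).
have x1' : `|x.1 - Istar| <= s0 by have [] := quarter_le s00 (le_trans x1 A4).
have [_ _ Eo] := realC x1'.
rewrite -cnorm_cvec !cvecB cvecZ rmorph_nat -Eo.
by rewrite E in h; exact: (le_trans h q_budget).
Qed.

Lemma local_convex (J : 'rV[R]_d) (s : R) : `|J| <= 1 -> 0 <= s <= 1 ->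
  nu * (rho * s) * dot J J <= dot J (omega (rho *: (s *: J) + Istar) - omega Istar).
Proof.
move=> J1 /andP[s0' s1]; rewrite scalerA.
apply: convex_segment; first by rewrite mulr_ge0 // ltW.
move=> t /andP[t0 ts].
have h : `|t *: J + Istar - Istar| <= s0.
  rewrite addrK normrZ ger0_norm //.
  have h1 : t * `|J| <= t * 1 by rewrite ler_wpM2l.
  have h2 : rho * s <= rho * 1 by rewrite ler_wpM2l // ltW.
  by have := A4; have := s00; have := rho0; lra.
by have [h1 h2] := conv h; split.
Qed.

Lemma local_omega_lipschitz (I : 'rV[R]_d) : `|I - Istar| <= 2 * rho ->
  `|omega I - omega Istar| <= L * `|I - Istar|.
Proof.
move=> I1; have I4 := le_trans I1 A4; have [I0 _] := quarter_le s00 I4.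
have C4 : `|Istar - Istar| <= s0 / 4 by rewrite subrr normr0 divr_ge0 // ltW.
have [C0 _] := quarter_le s00 C4.
have [_ _ e1] := @realC (I, 0) I0; have [_ _ e2] := @realC (Istar, 0) C0.
rewrite /= in e1 e2.
rewrite -!cnorm_cvec !cvecB -e1 -e2; by apply: omC_lipschitz; rewrite -cvecB cnorm_cvec.
Qed.

Lemma local_stability (u : nat -> phase R d) (r1 N : R) : trajectory F u ->
  `|(u 0%N).1 - Istar| < r1 * rho -> r1 <= 1 / 2 -> n%:R * (eps * M) <= rho / 2 ->
  d%:R * (n%:R * L * rho) * r1 ^+ 2 + 2 * (d%:R * q) +
    2 * (d%:R * (5 * expR 1 * eta * (40 * expR 1 * eta)) +
         d%:R * (rho^-1 * (n%:R * (eps * M)) * 4)) +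
    N * (9 * d%:R * 2^-1 ^+ m) < n%:R * nu * rho / 8 ->
  forall k : nat, k%:R <= N -> `|(u k).1 - Istar| < rho.
Proof.
have Fper (x y : phase R d) : D x -> same_point x y ->
    (F x).1 = (F y).1 /\ (F x).2 - (F y).2 = x.2 - y.2.
  by move=> Dx; apply: F_same_point; exact: half_le s00 Dx.
exact: (resonance_stable (D := D) F_C1 Fper F_exact3 n0 rho0 eM0 nu0 L0 orbit_real
  local_orbit_complex local_orbit_twist local_convex local_omega_lipschitz
  dl0 dl4 dlr eta0 m4 small kick_budget resonant).
Qed.

End near_resonance.

(** * Scales *)

Section scales.
Variables (R : realType) (x eps mu g M L : R).
Hypotheses (x1 : 1 <= x) (eps0 : 0 < eps) (mu0 : 0 < mu) (mu1 : mu <= 1) (g1 : 1 <= g) (M1 : 1 <= M)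
  (L0 : 0 <= L) (xxe : x ^+ 2 * eps <= mu ^+ 2).
Let rh := g * x^-1 * mu.

Let xpos : 0 < x. Proof. exact: lt_le_trans x1. Qed.
Let M0 : 0 <= M. Proof. exact: le_trans M1. Qed.
Let g0 : 0 < g. Proof. exact: lt_le_trans g1. Qed.

Let xe : x * eps <= mu ^+ 2.
Proof.
apply: le_trans xxe; rewrite ler_wpM2r ?(ltW eps0) //.
by rewrite expr2 ler_peMl // ltW.
Qed.

Let mu2 : mu ^+ 2 <= mu.
Proof. by rewrite expr2 ler_piMr // ltW. Qed.

Lemma rho_scale_gt0 : 0 < rh.
Proof. by rewrite !mulr_gt0 ?invr_gt0. Qed.

Lemma rho_scale_le : rh <= g * mu.
Proof.
rewrite /rh mulrAC -[leRHS]mulr1 ler_wpM2l ?invf_le1 //.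
by rewrite mulr_ge0 // ltW.
Qed.

Let x_rho : x * rh = g * mu.
Proof. by rewrite /rh; field; rewrite gt_eqF. Qed.

Lemma action_scale s : (2 * g + M) * mu <= s -> 2 * rh + x * (eps * M) <= s.
Proof.
move=> h; apply: le_trans h.
have h1 := rho_scale_le.
have h2 : x * eps * M <= mu * M by rewrite ler_wpM2r // (le_trans xe mu2).
by lra.
Qed.

Lemma shear_scale : x * (L * (x * (eps * M)) + eps * M) <= (L + 1) * M * mu ^+ 2.
Proof.
have h1 : L * M * (x ^+ 2 * eps) <= L * M * mu ^+ 2 by rewrite ler_wpM2l // mulr_ge0.
have h2 : M * (x * eps) <= M * mu ^+ 2 by rewrite ler_wpM2l.
have -> : x * (L * (x * (eps * M)) + eps * M) = L * M * (x ^+ 2 * eps) + M * (x * eps) by ring.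
by lra.
Qed.

(** Multiplication by the number x of iterates is compensated by the factor
    1/x in rh and by x^2 eps <= mu^2. *)
Lemma angle_scale : x * (L * (2 * rh + x * (eps * M)) + eps * M) <=
  (2 * L * g + (L + 1) * M) * mu.
Proof.
have -> : x * (L * (2 * rh + x * (eps * M)) + eps * M) =
  2 * L * (x * rh) + x * (L * (x * (eps * M)) + eps * M) by ring.
rewrite x_rho [leRHS]mulrDl; apply: lerD; first by apply: eqW; ring.
apply: (le_trans shear_scale).
by rewrite ler_wpM2l // mulr_ge0 // addr_ge0.
Qed.

Lemma kick_scale : rh^-1 * (x * (eps * M)) <= M * mu / g.
Proof.
have -> : rh^-1 * (x * (eps * M)) = M * (x ^+ 2 * eps) / (g * mu).
  by rewrite /rh; field; rewrite !gt_eqF.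
rewrite ler_pdivrMr ?mulr_gt0 //.
have -> : M * mu / g * (g * mu) = M * mu ^+ 2 by field; rewrite gt_eqF.
by rewrite ler_wpM2l.
Qed.

Lemma kick_scale_half : 2 * M * mu <= 1 -> x * (eps * M) <= rh / 2.
Proof.
move=> h; rewrite -(ler_pM2l xpos).
have -> : x * (rh / 2) = g * mu / 2 by rewrite mulrA x_rho.
have -> : x * (x * (eps * M)) = M * (x ^+ 2 * eps) by ring.
have h1 : M * (x ^+ 2 * eps) <= M * mu ^+ 2 by rewrite ler_wpM2l.
have h2 : 2 * M * mu * mu <= 1 * mu by rewrite ler_wpM2r // ltW.
have h3 : 1 * mu <= g * mu by rewrite ler_wpM2r // ltW.
have h4 : mu ^+ 2 = mu * mu by rewrite expr2.
rewrite h4 in h1; lra.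
Qed.

End scales.

(** The largest degree allowed by [newton_bound] is m = floor X with X = dl /
    (20 e C mu), for which 2^-m < 2 exp(- ln 2 X). Half of this exponent is
    spent on the length of the time interval, and the other half gives the
    factor mu. *)
Lemma truncation_bound (R : realType) (dl e C mu : R) : 0 < dl -> 0 < e -> 0 < C -> 0 < mu ->
  80 * e * C * mu <= dl ->
  let c3 := ln 2 * dl / (20 * e * C) / 2 in
  exists m : nat, [/\ (4 <= m)%N, 20 * e * m%:R * (C * mu) <= dl &
    expR (c3 / mu) * 2^-1 ^+ m <= 2 * (mu / c3)].
Proof.
move=> dl0 e0 C0 mu0 h c3.
pose X := dl / (20 * e * C * mu).
have den : 0 < 20 * e * C * mu by rewrite !mulr_gt0.
have X4 : 4 <= X by rewrite ler_pdivlMr //; lra.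
have X0 : 0 <= X by lra.
exists (Num.truncn X); have /andP[t1 t2] := truncn_itv X0.
split.
- by rewrite -ltnS -(ltr_nat R); apply: le_lt_trans t2.
- have : (Num.truncn X)%:R * (20 * e * C * mu) <= dl by rewrite -ler_pdivlMr.
  by have -> : (Num.truncn X)%:R * (20 * e * C * mu) = 20 * e * (Num.truncn X)%:R * (C * mu) by ring.
have ln2 : 0 < ln 2 :> R by rewrite ln_gt0 // ltr1n.
have c30 : 0 < c3 by rewrite !divr_gt0 // !mulr_gt0.
set m := Num.truncn X in t1 t2 *.
have E : c3 / mu * 2 = ln 2 * X by rewrite /c3 /X; field; rewrite !gt_eqF.
have p2 : 2^-1 ^+ m = expR (- (ln 2 * m%:R)) :> R.
  by rewrite expRN exprVn expRM_natr lnK // posrE.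
rewrite p2 -expRD.
have h1 : expR (c3 / mu + - (ln 2 * m%:R)) <= expR (ln 2 - c3 / mu).
  rewrite ler_expR.
  have : ln 2 * X <= ln 2 * (m%:R + 1).
    by rewrite ler_wpM2l ?(ltW ln2) // natr1 ltW.
  by rewrite -E; lra.
apply: (le_trans h1); rewrite expRD lnK ?posrE // ler_pM2l // expRN.
have cm : 0 < c3 / mu by rewrite divr_gt0.
rewrite -[mu / c3]invf_div lef_pV2 ?posrE ?expR_gt0 //.
by apply: (le_trans _ (expR_ge1Dx _)); rewrite lerDr.
Qed.

(** The available energy nu g mu / 8 is divided into eight parts nu g mu / 64.
    Five of them pay for the initial energy, the error q on the angles, the
    two errors of [energy_integral] and the drift. *)
Lemma energy_budget (R : realType) (D x rh L M g nu mu eta q p T W r1 e C : R) :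
  x * rh = g * mu -> 1 <= D -> 1 <= g -> 0 < mu -> 0 < nu -> 0 <= L -> 0 <= M ->
  0 <= r1 -> r1 <= 1 / 2 -> 32 * (D * (L + 1)) * r1 <= nu ->
  q = (L + 1) * M * mu ^+ 2 -> eta = C * mu -> p <= M * mu / g ->
  2 * D * (L + 1) * M * mu <= g * nu / 64 ->
  400 * D * e ^+ 2 * C ^+ 2 * mu <= g * nu / 64 ->
  512 * D * M <= g * nu -> T * (9 * D * W) <= nu * g * mu / 64 ->
  D * (x * L * rh) * r1 ^+ 2 + 2 * (D * q) +
    2 * (D * (5 * e * eta * (40 * e * eta)) + D * (p * 4)) + T * (9 * D * W) < x * nu * rh / 8.
Proof.
move=> hx D1 g1 mu0 nu0 L0 M0 r0 r1h h1 -> -> hp h2 h3 h4 h5.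
have g0 : 0 < g by exact: lt_le_trans g1.
have D0 : 0 < D by exact: lt_le_trans D1.
have gm : 0 < g * mu by rewrite mulr_gt0.
have P : 0 < nu * (g * mu) by rewrite mulr_gt0.
have -> : x * nu * rh / 8 = nu * (g * mu) / 8 by rewrite -hx; ring.
have -> : D * (x * L * rh) * r1 ^+ 2 = (D * L * r1 ^+ 2) * (g * mu) by rewrite -hx; ring.
have a1 : D * L * r1 ^+ 2 <= nu / 64.
  have b0 : D * L * r1 <= D * (L + 1) * r1.
    by rewrite ler_wpM2r // ler_wpM2l ?(ltW D0) // lerDl.
  have b1 : D * L * r1 <= nu / 32 by lra.
  have b2 : D * L * r1 * r1 <= nu / 32 * (1 / 2).
    by apply: ler_pM => //; rewrite !mulr_ge0 // ltW.
  have b3 : D * L * r1 ^+ 2 = D * L * r1 * r1 by rewrite expr2 mulrA.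
  by rewrite b3; lra.
have t1 := ler_wpM2r (ltW gm) a1.
have t2 := ler_wpM2r (ltW mu0) h2.
have t3 := ler_wpM2r (ltW mu0) h3.
have t4 : D * p <= D * (M * mu / g) by rewrite ler_wpM2l // ltW.
have t4' : 512 * (D * (M * mu / g)) <= nu * mu.
  have -> : 512 * (D * (M * mu / g)) = 512 * D * M * mu / g by ring.
  rewrite ler_pdivrMr //.
  have -> : nu * mu * g = g * nu * mu by ring.
  by rewrite ler_wpM2r // ltW.
have t4'' : nu * mu <= nu * (g * mu).
  by rewrite ler_wpM2l ?(ltW nu0) // ler_peMl // ltW.
have e2 : 2 * (D * ((L + 1) * M * mu ^+ 2)) = 2 * D * (L + 1) * M * mu * mu by ring.
have e3 : 2 * (D * (5 * e * (C * mu) * (40 * e * (C * mu))) + D * (p * 4)) =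
  400 * D * e ^+ 2 * C ^+ 2 * mu * mu + 8 * (D * p) by ring.
rewrite e2 e3.
have e5 : nu * g * mu / 64 = nu * (g * mu) / 64 by ring.
have e6 : g * nu / 64 * mu = nu * (g * mu) / 64 by ring.
have e7 : nu / 64 * (g * mu) = nu * (g * mu) / 64 by ring.
rewrite e5 in h5; rewrite e6 in t2 t3; rewrite e7 in t1.
move: t1 t2 t3 t4 t4' t4'' h5 P; clear.
move: (D * L * r1 ^+ 2 * (g * mu)) (2 * D * (L + 1) * M * mu * mu)
  (400 * D * e ^+ 2 * C ^+ 2 * mu * mu) (D * p) (D * (M * mu / g)) (nu * mu) (nu * (g * mu))
  (T * (9 * D * W)).
by move=> *; lra.
Qed.

Lemma small_threshold (R : realType) (s : seq (R * R)) :
  all (fun p => (0 <= p.1) && (0 < p.2)) s ->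
  exists2 mu1 : R, 0 < mu1 & forall mu, 0 < mu -> mu <= mu1 -> all (fun p => p.1 * mu <= p.2) s.
Proof.
elim: s => [_|[A c] s IH /= /andP[/andP[A0 c0] /IH[mu1 mu10 H]]]; first by exists 1.
exists (Num.min mu1 (c / (A + 1))).
  by rewrite lt_min mu10 divr_gt0 // ltr_wpDl.
move=> mu mu0; rewrite le_min => /andP[h1 h2]; rewrite H // andbT.
have A1 : 0 < A + 1 by rewrite ltr_wpDl.
rewrite ler_pdivlMr // in h2; apply: le_trans h2.
by rewrite mulrC ler_wpM2l ?(ltW mu0) // lerDl.
Qed.

Section powers.
Variables (R : realType) (d : nat) (eps : R).
Hypothesis eps0 : 0 < eps.
Let mu := eps `^ (1 / (2 * d.+1%:R)).

Lemma mu_gt0 : 0 < mu. Proof. exact: powR_gt0. Qed.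

Lemma mu_pow : mu ^+ (2 * d.+1) = eps.
Proof.
rewrite -powR_mulrn; last exact: powR_ge0.
rewrite -powRrM natrM mul1r mulVf ?powRr1 //; first exact: ltW.
Qed.

Lemma mu_le (mu1 : R) : 0 < mu1 -> eps <= mu1 ^+ (2 * d.+1) -> mu <= mu1.
Proof.
move=> h1 h; rewrite -(@ler_pXn2r _ (2 * d.+1)) ?nnegrE ?(ltW mu_gt0) ?(ltW h1) //.
by rewrite mu_pow.
Qed.

(** The exponent in the bound on n is chosen so that n mu^d < 1. *)
Lemma resonance_order (n : nat) : n%:R < eps `^ (- (d%:R / (2 * d.+1%:R))) ->
  n%:R ^+ 2 * eps <= mu ^+ 2.
Proof.
have -> : eps `^ (- (d%:R / (2 * d.+1%:R))) = (mu ^+ d)^-1.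
  rewrite powRN -powR_mulrn; last exact: powR_ge0.
  by rewrite -powRrM; congr (_ `^ _)^-1; rewrite mul1r mulrC.
have md : 0 < mu ^+ d by rewrite exprn_gt0 ?mu_gt0.
rewrite -[(_)^-1]mul1r ltr_pdivlMr // => h.
have E : n%:R ^+ 2 * eps = (n%:R * mu ^+ d) ^+ 2 * mu ^+ 2.
  rewrite exprMn -[RHS]mulrA -exprM -exprD; congr (_ * _).
  by rewrite -[LHS]mu_pow; congr (_ ^+ _); rewrite mulnC mulSn addnC.
by rewrite E ler_piMl ?sqr_ge0 // exprn_ile1 ?(ltW h) // mulr_ge0 // ltW.
Qed.

Lemma stability_timeE (c2 c3 : R) : stability_time d c2 c3 eps = c2 * expR (c3 / mu).
Proof. by rewrite /stability_time powRN. Qed.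

End powers.

(** * Uniformity over the ball *)

Lemma cdist_le (R : realType) (d : nat) (z : 'rV[R[i]]_d) (B : set 'rV[R]_d) (x : 'rV[R]_d) (s : R) :
  B x -> cnorm (z - cvec x) <= s -> cdist z B <= s.
Proof.
move=> Bx; apply: le_trans; apply: ge_inf; last by exists x.
by exists 0 => _ [y _ <-]; exact: cnorm_ge0.
Qed.

Lemma Bball_compact (R : realType) (d : nat) (center : 'rV[R]_d) (radius : R) :
  0 <= radius -> compact (Bball center radius).
Proof.
move=> r0.
have -> : Bball center radius =
    [set v | forall i, `[center 0 i - radius, center 0 i + radius]%classic (v ord0 i)].
  apply/seteqP; split => v /=.
    move=> cv i; have := le_trans (rv_norm_le i (center - v)) cv.
    rewrite !mxE in_itv /= ler_norml => /andP[h1 h2].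
    by apply/andP; split; lra.
  move=> cv; apply: rv_norm_lub => // i; have := cv i.
  rewrite !mxE in_itv /= ler_norml => /andP[h1 h2].
  by apply/andP; split; lra.
apply: (@rV_compact R d (fun i => `[center 0 i - radius, center 0 i + radius]%classic)) => i.
exact: segment_compact.
Qed.

(** A continuous function is bounded near each point of a compact set, and
    finitely many of these neighbourhoods cover it. *)
Lemma uniform_bound (R : realType) (d : nat) (B : set 'rV[R]_d)
    (g : 'rV[R[i]]_d -> 'rV[R[i]]_d) : compact B ->
  (forall I, B I -> differentiable g (cvec I : ('rV[R[i]]_d : normedModType R[i]))) ->
  exists s K : R, [/\ 0 < s, 0 <= K & forall I, B I -> forall w,
    cnorm (w - cvec I) <= s -> cnorm (g w) <= K].
Proof.
move=> /compact_near_coveringP cB dg.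
have [|n _ Hn] := cB nat \oo (fun n I => forall w, cnorm (w - cvec I) <= n.+1%:R^-1 ->
  cnorm (g w) <= n%:R) _; last first.
  exists n.+1%:R^-1, n%:R; split; [by rewrite invr_gt0|by []|].
  by move=> I BI; apply: (Hn n) => /=.
move=> I BI; have cg := differentiable_continuous (dg I BI).
have [dl dl0 H] := (cont_eps g (cvec I)).1 cg 1 ltr01.
pose K := cnorm (g (cvec I)) + 1.
have n1 : \forall n \near \oo, n.+1%:R^-1 < dl / 2 :> R.
  have h : 0 < dl / 2 by rewrite divr_gt0.
  exact: (near_infty_natSinv_lt (PosNum h)).
have n2 : \forall n \near \oo, K <= n%:R :> R by exact: nbhs_infty_ger.
have n3 : \forall n \near \oo, n.+1%:R^-1 < dl / 2 /\ K <= n%:R by apply: filterI.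
exists ([set J | `|I - J| < dl / 2], [set n | n.+1%:R^-1 < dl / 2 /\ K <= n%:R]).
  split => //=; apply/nbhs_ballP; exists (dl / 2); first by rewrite /= divr_gt0.
  by move=> J; rewrite -ball_normE.
move=> [J n] /= [IJ [n1' n2']] w wJ; apply: le_trans n2'.
have wI : cnorm (w - cvec I) < dl.
  apply: (le_lt_trans (cnorm_tri (cvec J) _ _)).
  rewrite -cvecB cnorm_cvec distrC [dl]splitr.
  exact: ltrD (le_lt_trans wJ n1') IJ.
have := cnormD (g w - g (cvec I)) (g (cvec I)); rewrite subrK.
have := H w wI; rewrite /K; lra.
Qed.

(** * Choice of the constants *)

(** The initial radius r1 is limited by nu against the Lipschitz constant L of
    the frequency, since the energy is at most d L |J|^2 and at least nu |J|^2
    / 2, in units of gamma mu. The size of gamma pays for the kicks M mu /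
    gamma against nu gamma mu. All other conditions hold for small mu once
    gamma is fixed. *)
Lemma confinement_constants (R : realType) (d : nat) (s0 r nu M L : R) :
  (1 <= d)%N -> 0 < s0 -> 0 < r -> 0 < nu -> 1 <= M -> 0 <= L ->
  exists gamma0 r1 : R, [/\ 0 < gamma0, 0 < r1 <= 1 / 2 & forall gamma, gamma0 <= gamma ->
  exists mu1 c2 c3 : R, [/\ 0 < mu1, 0 < c2, 0 < c3 & forall (eps : R) (n : nat),
    0 < eps -> eps <= mu1 ^+ (2 * d.+1) ->
    (0 < n)%N -> n%:R < eps `^ (- (d%:R / (2 * d.+1%:R))) ->
    let rh := rho d gamma eps n in
    exists dl eta q : R, exists m : nat,
    [/\ [/\ eps <= 1, 0 < rh, 0 < eta, 0 < dl & (4 <= m)%N],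
        [/\ dl <= 1 / 4, dl <= r / 4, 20 * expR 1 * m%:R * eta <= dl &
          n%:R * (eps * M) <= rh / 2],
        [/\ 2 * rh + n%:R * (eps * M) <= s0 / 4,
          n%:R * (L * (2 * rh + n%:R * (eps * M)) + eps * M) <= r / 2,
          n%:R * (L * (2 * rh + n%:R * (eps * M)) + eps * M) <= eta,
          n%:R * (L * (n%:R * (eps * M)) + eps * M) <= q &
          rh^-1 * (n%:R * (eps * M)) <= eta] &
        d%:R * (n%:R * L * rh) * r1 ^+ 2 + 2 * (d%:R * q) +
        2 * (d%:R * (5 * expR 1 * eta * (40 * expR 1 * eta)) +
         d%:R * (rh^-1 * (n%:R * (eps * M)) * 4)) +
        stability_time d c2 c3 eps * (9 * d%:R * 2^-1 ^+ m) < n%:R * nu * rh / 8]]].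
Proof.
move=> d1 s00 r0 nu0 M1 L0.
have D1 : 1 <= d%:R :> R by rewrite ler1n.
have D0 : 0 < d%:R :> R by exact: lt_le_trans D1.
have M0 : 0 < M by exact: lt_le_trans M1.
have e0 : 0 < expR 1 :> R := expR_gt0 1.
have L1 : 0 < L + 1 by rewrite ltr_wpDl.
have DL : 0 < 32 * (d%:R * (L + 1)) by rewrite !mulr_gt0.
exists (Num.max 1 (512 * d%:R * M / nu)), (Num.min (1 / 2) (nu / (32 * (d%:R * (L + 1))))).
split; first by rewrite lt_max ltr01.
  by rewrite lt_min !divr_gt0 //= ge_min lexx.
move=> g; rewrite ge_max ler_pdivrMr // => /andP[g1 gn].
set r1 := Num.min _ _.
have r10 : 0 <= r1 by rewrite le_min !divr_ge0 // ltW.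
have r1h : r1 <= 1 / 2 by rewrite ge_min lexx.
have r1n : 32 * (d%:R * (L + 1)) * r1 <= nu.
  by rewrite mulrC -ler_pdivlMr // ge_min lexx orbT.
clearbody r1.
have g0 : 0 < g by exact: lt_le_trans g1.
pose C := 2 * L * g + (L + 1) * M.
have MC : M <= C.
  rewrite /C; have : 0 <= L * g by rewrite mulr_ge0 // ltW.
  have : 0 <= L * M by rewrite mulr_ge0 // ltW.
  by lra.
have C0 : 0 < C by exact: lt_le_trans MC.
pose dl := Num.min (1 / 4) (r / 4) : R.
have dl0 : 0 < dl by rewrite lt_min !divr_gt0.
have gnu : 0 < g * nu / 64 by rewrite divr_gt0 // mulr_gt0.
have [|mu1 mu10 small] := @small_threshold R [:: (1, 1); (2 * g + M, s0 / 4); (C, r / 2);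
   (2 * M, 1); (80 * expR 1 * C, dl); (2 * d%:R * (L + 1) * M, g * nu / 64);
   (400 * d%:R * expR 1 ^+ 2 * C ^+ 2, g * nu / 64)].
  have p2 : 0 <= 2 * g + M by rewrite ltW // addr_gt0 // mulr_gt0.
  have p4 : 0 <= 2 * M by rewrite mulr_ge0 // ltW.
  have p5 : 0 <= 80 * expR 1 * C by rewrite !mulr_ge0 // ltW.
  have p6 : 0 <= 2 * d%:R * (L + 1) * M by rewrite !mulr_ge0 // ltW.
  have p7 : 0 <= 400 * d%:R * expR 1 ^+ 2 * C ^+ 2.
    by apply: mulr_ge0 (sqr_ge0 _); apply: mulr_ge0 (sqr_ge0 _); exact: mulr_ge0 (ler0n R 400) (ler0n R d).
  have s4 : 0 < s0 / 4 by rewrite divr_gt0.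
  have r2 : 0 < r / 2 by rewrite divr_gt0.
  by rewrite /= ler01 ltr01 p2 s4 (ltW C0) r2 p4 p5 dl0 p6 p7 gnu.
pose c3 := ln 2 * dl / (20 * expR 1 * C) / 2.
have ln2 : 0 < ln 2 :> R by rewrite ln_gt0 // ltr1n.
have c30 : 0 < c3 by rewrite !divr_gt0 // !mulr_gt0.
pose c2 := g * nu * c3 / (64 * (18 * d%:R)).
have p18 : 0 < 64 * (18 * d%:R) :> R by apply: mulr_gt0 => //; apply: mulr_gt0.
have c20 : 0 < c2 by apply: divr_gt0 p18; apply: mulr_gt0 c30; exact: mulr_gt0.
exists mu1, c2, c3; split=> // eps n eps0 epsmu n0 nlt rh.
have mu0 := mu_gt0 d eps0; have mule := mu_le eps0 mu10 epsmu.
have xxe := resonance_order eps0 nlt; have epsE := mu_pow d eps0.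
have TE := stability_timeE d eps c2 c3.
have rhE : rh = g * n%:R^-1 * (eps `^ (1 / (2 * d.+1%:R))) by [].
move: mu0 mule xxe epsE TE rhE; set mu := eps `^ (1 / (2 * d.+1%:R)).
clearbody mu rh => mu0 mule xxe epsE TE rhE.
have /and5P[q1 q2 q3 q4 /and4P[q5 q6 q7 _]] := small mu mu0 mule.
rewrite /= mul1r in q1; rewrite /= in q2 q3 q4 q5 q6 q7.
have x1 : 1 <= n%:R :> R by rewrite ler1n.
have [m [m4 msm mexp]] := truncation_bound dl0 e0 C0 mu0 q5.
have eta0 : 0 < C * mu by rewrite mulr_gt0.
have S1 := action_scale x1 eps0 mu0 q1 g1 M1 xxe q2.
have S2 := angle_scale g x1 eps0 mu0 q1 M1 L0 xxe.
have S3 := shear_scale x1 eps0 M1 L0 xxe.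
have S4 := kick_scale x1 mu0 g1 M1 xxe.
have S5 := kick_scale_half x1 mu0 g1 M1 xxe q4.
have S6 := rho_scale_gt0 x1 mu0 g1.
rewrite -rhE in S1 S2 S4 S5 S6.
have xr : n%:R * rh = g * mu by rewrite rhE; field; rewrite pnatr_eq0 -lt0n n0.
have S7 : M * mu / g <= C * mu.
  rewrite ler_pdivrMr //; apply: (@le_trans _ _ (C * mu * 1)).
    by rewrite mulr1 ler_wpM2r // ltW.
  by rewrite ler_wpM2l // ltW.
(* C mu bounds the displacement of the return map, (L + 1) M mu^2 the error on
   its twist. *)
exists dl, (C * mu), ((L + 1) * M * mu ^+ 2), m; split.
- by split=> //; rewrite -epsE exprn_ile1 // ltW.
- by split=> //; rewrite ge_min lexx ?orbT.
- by split=> //; [exact: le_trans S2 q3|exact: le_trans S4 S7].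
apply: (energy_budget (M := M) (e := expR 1) (C := C) xr D1 g1 mu0 nu0 L0 (ltW M0) r10 r1h r1n
  erefl erefl S4 q6 q7 gn).
rewrite TE.
have -> : c2 * expR (c3 / mu) * (9 * d%:R * 2^-1 ^+ m) =
  (c2 * (9 * d%:R)) * (expR (c3 / mu) * 2^-1 ^+ m) by ring.
have p9 : 0 <= c2 * (9 * d%:R) := mulr_ge0 (ltW c20) (mulr_ge0 (ler0n R 9) (ler0n R d)).
apply: (le_trans (ler_wpM2l p9 mexp)).
by apply: eqW; rewrite /c2 /c3; field; rewrite !gt_eqF.
Qed.

(** * Effective stability near resonances *)

(** The unperturbed map, which belongs to the family, is differentiable, and
    its angle component at angle 0 is the frequency. *)
Lemma frequency_differentiable (R : realType) (d : nat) (omega : 'rV[R]_d -> 'rV[R]_d)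
    (a b : phase R d -> 'rV[R]_d) (I : 'rV[R]_d) :
  differentiable (lift_map omega a b 0) ((I, 0) : phase R d) -> differentiable omega I.
Proof.
move=> dF.
pose inj0 (J : 'rV[R]_d) : phase R d := (J, 0).
have E : omega = snd \o (lift_map omega a b 0 \o inj0).
  by apply/funext => J; rewrite /lift_map /= add0r scale0r addr0.
have d1 : differentiable inj0 I.
  by apply: (@differentiable_pair _ _ _ _ id (fun=> 0)).
have d2 : differentiable (lift_map omega a b 0 \o inj0) I.
  exact: differentiable_comp.
by rewrite E; apply: (differentiable_comp d2); exact: snd_differentiable.
Qed.

Lemma is_loopW (R : realType) (d : nat) (D D' : set (phase R d)) (c : R -> phase R d) :
  (forall x, D x -> D' x) -> is_loop D c -> is_loop D' c.
Proof. by move=> DD' [h1 h2 h3 h4]; split=> // t /h2; exact: DD'. Qed.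

Theorem theorem2p2 (R : realType) (d : nat) (d_ge1 : (1 <= d)%N)
    (center : 'rV[R]_d) (radius : R) (radius_gt0 : 0 < radius)
    (eps0 sigma r : R)
    (eps0_gt0 : 0 < eps0) (sigma_gt0 : 0 < sigma) (r_gt0 : 0 < r)
    (omega : 'rV[R]_d -> 'rV[R]_d) (h0 : 'rV[R]_d -> R)
    (a b : R -> 'rV[R]_d * 'rV[R]_d -> 'rV[R]_d) :
  let B := Bball center radius in
  let DF := map_domain B sigma r in
  let DI := action_domain B sigma in
  let F eps := lift_map omega (a eps) (b eps) eps in
  (forall eps, 0 <= eps <= eps0 -> forall I phi m,
     DI (cvec I) -> Zvec m ->
     a eps (I, phi + m) = a eps (I, phi) /\
     b eps (I, phi + m) = b eps (I, phi)) ->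
  (exists omegaC, analytic_continuation (@cvec R d) (@cvec R d)
     DI omega omegaC) ->
  (exists M : R, forall eps, 0 <= eps <= eps0 -> exists aC bC,
     [/\ analytic_continuation (@cpair R d) (@cvec R d) DF (a eps) aC,
         analytic_continuation (@cpair R d) (@cvec R d) DF (b eps) bC
       & forall z, DF z -> cnorm (aC z) <= M /\ cnorm (bC z) <= M]) ->
  (forall eps, 0 <= eps <= eps0 ->
     exact_symplectic [set x | DF (cpair x)] (F eps)) ->
  is_gradient [set I | DI (cvec I)] h0 omega ->
  strongly_convex [set I | DI (cvec I)] omega ->
  exists gamma0 r0 : R, [/\ 0 < gamma0, 0 < r0 < 1 &
    forall gamma, gamma0 <= gamma ->
    exists eps1 c2 c3 : R, [/\ 0 < eps1 <= eps0, 0 < c2, 0 < c3 &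
      forall (eps : R) (n : nat) (Istar : 'rV[R]_d),
        0 < eps <= eps1 ->
        (0 < n)%N -> n%:R < eps `^ (- (d%:R / (2 * d.+1%:R))) ->
        B Istar -> Zvec (n%:R *: omega Istar) ->
      forall u : nat -> 'rV[R]_d * 'rV[R]_d,
        trajectory (F eps) u ->
        `|(u 0%N).1 - Istar| < r0 * rho d gamma eps n ->
      forall k : nat, k%:R <= stability_time d c2 c3 eps ->
        `|(u k).1 - Istar| < rho d gamma eps n]].
Proof.
move=> B DF DI F per [omC [U0 [_ DIU domC comC]]] [M0 HM] exact_symp _ [nu nu0 conv].
have near0 I : B I -> cnorm (cvec I - cvec I) <= sigma.
  by move=> _; rewrite subrr cnorm0 ltW.
have DIB I : B I -> DI (cvec I) by move=> BI; exact: cdist_le BI (near0 I BI).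
have [s1 [K [s10 K0 HK]]] := uniform_bound (@Bball_compact R d center radius (ltW radius_gt0))
  (fun I BI => domC _ (DIU _ (DIB I BI))).
pose s0 := Num.min sigma s1.
have s00 : 0 < s0 by rewrite lt_min sigma_gt0.
have s0sig : s0 <= sigma by rewrite ge_min lexx.
have s0s1 : s0 <= s1 by rewrite ge_min lexx orbT.
clearbody s0.
pose M := Num.max 1 M0.
have M1 : 1 <= M by rewrite le_max lexx.
have M0M : M0 <= M by rewrite le_max lexx orbT.
clearbody M.
have Mge0 : 0 <= M by exact: le_trans M1.
have L0 : 0 <= 4 * K / s0 by rewrite divr_ge0 ?mulr_ge0 // ltW.
have [gamma0 [r1 [gamma00 r1b H]]] := confinement_constants d_ge1 s00 r_gt0 nu0 M1 L0.
have /andP[r10 r1h] := r1b.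
exists gamma0, r1; split=> //.
  by rewrite r10 (le_lt_trans r1h) // mul1r invf_lt1 // ltr1n.
move=> gamma /H[mu1 [c2 [c3 [mu10 c20 c30 Hc]]]].
exists (Num.min eps0 (mu1 ^+ (2 * d.+1))), c2, c3; split=> //.
  by rewrite lt_min eps0_gt0 exprn_gt0 //= ge_min lexx.
move=> eps n Istar /andP[eps_gt0]; rewrite le_min => /andP[epsle epsmu] n0 nlt BI res u tu u0.
have [dl [eta [q [m [[E1 E2 E3 E4 E5] [E6 E7 E8 E9] [E10 E11 E12 E13 E14] E15]]]]] :=
  Hc eps n eps_gt0 epsmu n0 nlt.
have epsin : 0 <= eps <= eps0 by rewrite (ltW eps_gt0).
have [aC [bC [[Ua [_ DUa da ca]] [Ub [_ DUb db cb]] abM]]] := HM eps epsin.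
have inDI (w : 'rV[R[i]]_d) : cnorm (w - cvec Istar) <= s0 -> DI w.
  by move=> h; apply: cdist_le BI _; exact: le_trans h s0sig.
have inDIr (I : 'rV[R]_d) : `|I - Istar| <= s0 -> DI (cvec I).
  by move=> h; apply: inDI; rewrite -cvecB cnorm_cvec.
have inDF (x : phase R d) : `|x.1 - Istar| <= s0 -> DF (cpair x).
  by move=> h; split; [exact: inDIr|rewrite imvec_cvec normr0 ltW].
have abC (z : (cphase R d : normedModType R[i])) :
    cnorm (z.1 - cvec Istar) <= s0 -> `|imvec z.2| <= r ->
    [/\ differentiable aC z, differentiable bC z, cnorm (aC z) <= M & cnorm (bC z) <= M].
  move=> z1 z2; have Dz : DF z by split=> //; exact: inDI.
  have [ha hb] := abM z Dz; split.
  - exact: da (DUa _ Dz).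
  - exact: db (DUb _ Dz).
  - exact: le_trans ha M0M.
  - exact: le_trans hb M0M.
have oC (w : ('rV[R[i]]_d : normedModType R[i])) : cnorm (w - cvec Istar) <= s0 ->
    differentiable omC w /\ cnorm (omC w) <= K.
  move=> h; split; first exact: domC (DIU _ (inDI w h)).
  by apply: HK BI _ _; exact: le_trans h s0s1.
have realC (x : phase R d) : `|x.1 - Istar| <= s0 ->
    [/\ aC (cpair x) = cvec (a eps x), bC (cpair x) = cvec (b eps x) &
     omC (cvec x.1) = cvec (omega x.1)].
  move=> h; split; [apply: ca; exact: DUa (inDF x h)|apply: cb; exact: DUb (inDF x h)|].
  by apply: comC; exact: DIU (inDIr _ h).
have perx (x : phase R d) (k : 'rV[R]_d) : `|x.1 - Istar| <= s0 -> Zvec k ->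
    a eps (x.1, x.2 + k) = a eps x /\ b eps (x.1, x.2 + k) = b eps x.
  move=> h kZ; have := per eps epsin x.1 x.2 k (inDIr _ h) kZ.
  by rewrite -surjective_pairing.
have Fdiff (x : phase R d) : `|x.1 - Istar| <= s0 ->
    differentiable (lift_map omega (a eps) (b eps) eps) x.
  by move=> /inDF h; have [/(_ x h)[]] := exact_symp eps epsin.
have Floop (c : R -> phase R d) : is_loop [set x : phase R d | `|x.1 - Istar| <= s0] c ->
    loop_action (lift_map omega (a eps) (b eps) eps \o c) = loop_action c.
  move=> hc; apply: (exact_symp eps epsin).2.
  by apply: is_loopW hc => x; exact: inDF.
have convI (I : 'rV[R]_d) : `|I - Istar| <= s0 -> differentiable omega I /\
    forall v, nu * dot v v <= dot ('d omega I v) v.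
  move=> h; split; last by apply: conv; exact: inDIr.
  (* Differentiability of the frequency is read off the map at eps = 0. *)
  have z0 : 0 <= (0 : R) <= eps0 by apply/andP; split; [exact: lexx|exact: ltW].
  have [D0 _] := exact_symp 0 z0.
  by have [d0 _] := D0 (I, 0) (inDF (I, 0) h); exact: frequency_differentiable d0.
exact: (local_stability eps_gt0 E1 Mge0 s00 r_gt0 K0 abC oC realC perx Fdiff Floop n0 E2
  E10 E11 nu0 convI E12 E13 E14 E4 E6 E7 E3 E5 E8 res tu u0 r1h E9 E15).
Qed.
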